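(* For any equation $\mathcal L$: $u_t=A(t,x)u_{xx}+B(t,x)u_x+C(t,x)u$ with analytic $A,B,C$, $A\ne0$, the maximal point symmetry groups (resp. the maximal Lie invariance algebras) of the equations $\mathcal L$ and ${\rm DE}_0(\mathcal L)$ are isomorphic. The canonical isomorphism between the algebras is realized by extending each Lie symmetry operator $Q=\tau\partial_t+\xi\partial_x+(\zeta^1u+\zeta^0)\partial_u$ of $\mathcal L$ to the Lie symmetry operator $$Q_0=Q+\bigl((\zeta^1-\xi_x)\eta+\zeta^1_xu+\zeta^0_x\bigr)\partial_\eta$$ of ${\rm DE}_0(\mathcal L)$.
   Context: All considerations are local. ${\rm DE}_0(\mathcal L)$ is the equation for a function $\eta=\eta(t,x,u)$ of three independent variables (the determining equation for reduction operators $\partial_x+\eta\partial_u$ of $\mathcal L$): $$\eta_t=A(\eta_{xx}+2\eta\eta_{xu}+\eta^2\eta_{uu})+A_x(\eta_x+\eta\eta_u)+(B\eta)_x+C(\eta-u\eta_u)+C_xu.$$ Its point symmetries act in the space of $(t,x,u,\eta)$. Every Lie symmetry operator of $\mathcal L$ has the form $Q=\tau\partial_t+\xi\partial_x+(\zeta^1u+\zeta^0)\partial_u$ with $\tau=\tau(t)$, $\xi=\xi(t,x)$, $\zeta^1=\zeta^1(t,x)$ and $\zeta^0=\zeta^0(t,x)$. *)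

(* Defs.v *)
From HB Require Import structures.
From mathcomp Require Import all_boot all_order all_algebra.
From mathcomp Require Import all_classical all_reals all_analysis.
Set Implicit Arguments.
Unset Strict Implicit.
Unset Printing Implicit Defensive.
Import Order.TTheory GRing.Theory Num.Theory.
Import numFieldNormedType.Exports.
Local Open Scope classical_set_scope.
Local Open Scope ring_scope.

Section Analytic.
Variable R : realType.

(* [f] is the sum, on a polydisc around [a], of a power series that converges
   absolutely on the closed polydisc; multi-indices are summed over the cubes
   {0, ..., N-1}^n. *)
Definition analytic_at n (f : 'rV[R]_n -> R) (a : 'rV[R]_n) : Prop :=
  exists (r : R) (c : {ffun 'I_n -> nat} -> R),
    let idx N (al : {ffun 'I_n -> 'I_N}) : {ffun 'I_n -> nat} :=
      [ffun i => nat_of_ord (al i)] in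
    [/\ 0 < r,
        exists M : R, forall N,
          \sum_(al : {ffun 'I_n -> 'I_N}) `|c (idx N al)| * r ^+ (\sum_i al i)
          <= M
      & forall y : 'rV[R]_n, (forall i, `|y 0 i - a 0 i| < r) ->
          (fun N => \sum_(al : {ffun 'I_n -> 'I_N})
             c (idx N al) * \prod_i (y 0 i - a 0 i) ^+ al i) @ \oo --> f y].

Definition analytic_on n (D : set 'rV[R]_n) (f : 'rV[R]_n -> R) : Prop :=
  forall w, D w -> analytic_at f w.

Definition coordf n m (f : 'rV[R]_n -> 'rV[R]_m) (k : 'I_m) : 'rV[R]_n -> R :=
  fun w => f w 0 k.

Definition analytic_map_on n m (D : set 'rV[R]_n) (f : 'rV[R]_n -> 'rV[R]_m) :=
  forall k, analytic_on D (coordf f k).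

Definition pd n (i : 'I_n) (f : 'rV[R]_n -> R) : 'rV[R]_n -> R :=
  fun w => 'D_(delta_mx 0 i) f w.

End Analytic.

(* In R^(n+1), the space of n independent variables and one dependent one,
   the dependent variable is the last coordinate. *)
Section Jets.
Variable R : realType.

Definition ind n (i : 'I_n) : 'I_n.+1 := lift ord_max i.
Definition dep n : 'I_n.+1 := ord_max.
Definition base n (w : 'rV[R]_n.+1) : 'rV[R]_n := \row_i w 0 (ind i).

(* A scalar second-order equation [F w p P = 0], with [w] the independent and
   dependent variables, [p] the first-order and [P] the (symmetric)
   second-order derivatives. *)
Definition pde n := 'rV[R]_n.+1 -> 'rV[R]_n -> 'M[R]_n -> R.

(* The total derivatives D_i f and D_i D_j f of a function of order zero. *)
Definition tot1 n (p : 'rV[R]_n) (f : 'rV[R]_n.+1 -> R) (i : 'I_n)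
    (w : 'rV[R]_n.+1) : R :=
  pd (ind i) f w + p 0 i * pd (dep n) f w.

Definition tot2 n (p : 'rV[R]_n) (P : 'M[R]_n) (f : 'rV[R]_n.+1 -> R)
    (i j : 'I_n) (w : 'rV[R]_n.+1) : R :=
  pd (ind i) (pd (ind j) f) w + p 0 i * pd (dep n) (pd (ind j) f) w
  + p 0 j * pd (ind i) (pd (dep n) f) w
  + p 0 i * p 0 j * pd (dep n) (pd (dep n) f) w
  + P i j * pd (dep n) f w.

(* Vector fields on R^m, identified with the tuples of their coefficients. *)
Definition vfield m := 'rV[R]_m -> 'rV[R]_m.

Definition bracket m (V W : vfield m) : vfield m := fun w =>
  \row_k \sum_j (V w 0 j * pd j (coordf W k) w - W w 0 j * pd j (coordf V k) w).

(* Coefficients of d/dp_i and d/dP_ij in the second prolongation of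
   [V = xi^k d/dx_k + zeta d/du]:
   D_i zeta - p_k D_i xi^k and
   D_i D_j zeta - p_k D_i D_j xi^k - P_ik D_j xi^k - P_jk D_i xi^k. *)
Definition vprol1 n (V : vfield n.+1) (w : 'rV[R]_n.+1) (p : 'rV[R]_n)
    : 'rV[R]_n :=
  \row_i (tot1 p (coordf V (dep n)) i w
          - \sum_k p 0 k * tot1 p (coordf V (ind k)) i w).

Definition vprol2 n (V : vfield n.+1) (w : 'rV[R]_n.+1) (p : 'rV[R]_n)
    (P : 'M[R]_n) : 'M[R]_n :=
  \matrix_(i, j) (tot2 p P (coordf V (dep n)) i j w
    - \sum_k (p 0 k * tot2 p P (coordf V (ind k)) i j w
              + P i k * tot1 p (coordf V (ind k)) j w
              + P j k * tot1 p (coordf V (ind k)) i w)).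

(* The second prolongation of [V] applied to [F], as a derivative along the
   prolonged field. *)
Definition vprol_app n (V : vfield n.+1) (F : pde n) (w : 'rV[R]_n.+1)
    (p : 'rV[R]_n) (P : 'M[R]_n) : R :=
  derive1 (fun s : R => F (w + s *: V w) (p + s *: vprol1 V w p)
                  (P + s *: vprol2 V w p P)) 0.

(* The Lie symmetry operators of [F] with coefficients analytic on [D], i.e.
   the maximal Lie invariance algebra over [D]. Its elements are to be compared
   on [D] only. *)
Definition lie_algebra n (F : pde n) (D : set 'rV[R]_n.+1)
    : set (vfield n.+1) :=
  [set V | analytic_map_on D V /\
     forall w p P, D w -> P^T = P -> F w p P = 0 -> vprol_app V F w p P = 0].

(* Isomorphism of Lie algebras of vector fields on [D] and [D'], where fields
   are identified when they coincide on [D], resp. [D']. *)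
Record lie_isomorphism m k (D : set 'rV[R]_m) (g : set (vfield m))
    (D' : set 'rV[R]_k) (g' : set (vfield k)) (Lam : vfield m -> vfield k)
    : Prop := LieIsomorphism {
  lie_iso_mem : forall V, g V -> g' (Lam V);
  lie_iso_linear : forall (a : R) V W, g V -> g W ->
    {in D', Lam (fun w => a *: V w + W w) =1 (fun w => a *: Lam V w + Lam W w)};
  lie_iso_bracket : forall V W, g V -> g W ->
    {in D', Lam (bracket V W) =1 bracket (Lam V) (Lam W)};
  lie_iso_inj : forall V W, g V -> g W ->
    {in D', Lam V =1 Lam W} <-> {in D, V =1 W};
  lie_iso_surj : forall V', g' V' -> exists2 V, g V & {in D', Lam V =1 V'}
}.

(* Local maps: only the values on the domain are meaningful. *)
Definition lmap m := (set 'rV[R]_m * ('rV[R]_m -> 'rV[R]_m))%type.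

Definition lcomp m (g f : lmap m) : lmap m :=
  (f.1 `&` f.2 @^-1` g.1, g.2 \o f.2).

Definition eq_lmap m (f g : lmap m) : Prop :=
  f.1 = g.1 /\ {in f.1, f.2 =1 g.2}.

Definition point_transformation m (f : lmap m) : Prop :=
  [/\ open f.1, open (f.2 @` f.1), analytic_map_on f.1 f.2
    & exists2 h : 'rV[R]_m -> 'rV[R]_m, analytic_map_on (f.2 @` f.1) h
        & forall w, f.1 w -> h (f.2 w) = w].

(* The second prolongation of the point transformation [f] maps the jet
   (w, p, P) to (f w, p', P'): the conditions are the first and second total
   derivatives of "new u = v(new x)", v having derivatives p' and P'. *)
Definition prolongs n (f : 'rV[R]_n.+1 -> 'rV[R]_n.+1) (w : 'rV[R]_n.+1)
    (p : 'rV[R]_n) (P : 'M[R]_n) (p' : 'rV[R]_n) (P' : 'M[R]_n) : Prop :=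
  [/\ \det (\matrix_(i, k) tot1 p (coordf f (ind k)) i w) != 0,
      forall i, tot1 p (coordf f (dep n)) i w
        = \sum_k p' 0 k * tot1 p (coordf f (ind k)) i w
    & forall i j, tot2 p P (coordf f (dep n)) i j w
        = \sum_k p' 0 k * tot2 p P (coordf f (ind k)) i j w
          + \sum_k \sum_l P' k l * tot1 p (coordf f (ind k)) i w
                                 * tot1 p (coordf f (ind l)) j w].

(* The pseudogroup of point symmetries of the equation [F] posed on the open
   set [M] of the space of independent and dependent variables. *)
Definition point_symmetries n (M : set 'rV[R]_n.+1) (F : pde n)
    : set (lmap n.+1) :=
  [set f | [/\ point_transformation f, f.1 `<=` M, f.2 @` f.1 `<=` M
     & forall w p P p' P', f.1 w -> P^T = P -> P'^T = P' ->
         prolongs f.2 w p P p' P' -> (F w p P = 0 <-> F (f.2 w) p' P' = 0)]].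

Definition germ_eq m (q : 'rV[R]_m) (f g : lmap m) : Prop :=
  [/\ f.1 q, g.1 q & \forall z \near q, f.2 z = g.2 z].

(* Isomorphism of a pseudogroup [G] acting on a space with a pseudogroup [H]
   acting on a bundle [pi] over this space: [Lam] lifts every element of [G] to
   an element of [H] defined over the whole preimage of its domain and
   projecting onto it; the lifting respects composition and induces a bijection between the
   germs of [G] at [pi q] and the germs of [H] at [q]. This is the usual notion
   of isomorphism for pseudogroups acting on spaces of different dimension: [H]
   is an isomorphic (one-to-one) prolongation of [G]. *)
Record pseudogroup_isomorphism m k (pi : 'rV[R]_k -> 'rV[R]_m)
    (G : set (lmap m)) (H : set (lmap k)) (Lam : lmap m -> lmap k) : Prop :=
  PseudogroupIsomorphism {
  pg_iso_mem : forall g, G g -> H (Lam g);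
  pg_iso_dom : forall g, G g -> (Lam g).1 = pi @^-1` g.1;
  pg_iso_proj : forall g q, G g -> (Lam g).1 q -> pi ((Lam g).2 q) = g.2 (pi q);
  pg_iso_comp : forall g1 g2, G g1 -> G g2 ->
    eq_lmap (Lam (lcomp g2 g1)) (lcomp (Lam g2) (Lam g1));
  pg_iso_germ : forall g1 g2 q, G g1 -> G g2 ->
    germ_eq q (Lam g1) (Lam g2) <-> germ_eq (pi q) g1 g2;
  pg_iso_surj : forall h q, H h -> h.1 q ->
    exists2 g, G g & germ_eq q (Lam g) h
}.

End Jets.

(* Coordinates (t, x), (t, x, u) and (t, x, u, eta). *)
Definition it {n} : 'I_n.+1 := ord0.
Definition ix {n} : 'I_n.+2 := @Ordinal n.+2 1 isT.
Definition iu {n} : 'I_n.+3 := @Ordinal n.+3 2 isT.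
Definition ie {n} : 'I_n.+4 := @Ordinal n.+4 3 isT.

Section Equations.
Variable R : realType.
Implicit Types A B C : 'rV[R]_2 -> R.

Definition eqL A B C : pde R 2 := fun w p P =>
  let z := base w in
  p 0 it - (A z * P ix ix + B z * p 0 ix + C z * w 0 iu).

(* Here p and P hold the derivatives of eta with respect to (t, x, u). *)
Definition eqDE0 A B C : pde R 3 := fun w p P =>
  let z := base (base w) in
  let u := w 0 iu in
  let eta := w 0 ie in
  p 0 it
  - (A z * (P ix ix + 2 * eta * P ix iu + eta ^+ 2 * P iu iu)
     + pd ix A z * (p 0 ix + eta * p 0 iu)
     + (pd ix B z * eta + B z * p 0 ix)
     + C z * (eta - u * p 0 iu)
     + pd ix C z * u).

Definition opQ (tau : R -> R) (xi zeta1 zeta0 : 'rV[R]_2 -> R) : vfield R 3 :=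
  fun w => let z := base w in
  \row_i [:: tau (w 0 it); xi z; zeta1 z * w 0 iu + zeta0 z]`_i.

Definition opQ0 (tau : R -> R) (xi zeta1 zeta0 : 'rV[R]_2 -> R) : vfield R 4 :=
  fun w => let z := base (base w) in
  \row_i [:: tau (w 0 it); xi z; zeta1 z * w 0 iu + zeta0 z;
             (zeta1 z - pd ix xi z) * w 0 ie + pd ix zeta1 z * w 0 iu
             + pd ix zeta0 z]`_i.

Definition box n (J : 'I_n -> set R) : set 'rV[R]_n :=
  [set w | forall i, J i (w 0 i)].

End Equations.

(* Main.v *)
Require Import Defs.
From HB Require Import structures.
From mathcomp Require Import all_boot all_order all_algebra finmap.
From mathcomp Require Import all_classical all_reals all_analysis.
From mathcomp Require Import ring lra.

(* Both isomorphisms come from comparing jets. A symmetry of either equation is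
   tested on jets whose second-order part is prescribed after the
   transformation; the second-order part along the kernel of the leading
   quadratic form then forces the components t, x, u of the symmetry to be
   independent of eta (with t a function of t and x a function of (t, x)), and
   eta to transform like u_x. What remains of the determining system of DE_0,
   read along p_u with p_x + eta p_u = 0, is a quadratic polynomial in eta whose
   three coefficients are exactly the determining equations of L, the polynomial
   in u_x having become one in eta. Conversely the determining equations of the
   lifted map are total derivatives of those of L. *)
Set Implicit Arguments.
Unset Strict Implicit.
Unset Printing Implicit Defensive.
Import Order.TTheory GRing.Theory Num.Theory.
Import numFieldNormedType.Exports.
Local Open Scope classical_set_scope.
Local Open Scope ring_scope.

(** * Power series and analytic functions *)

(** The second-order part of either equation is [A] times the square of one direction: [v P v^T]
    with [v = (0, 1)] for [L] and [v = (0, 1, eta)] for the reduction equation. A symmetry has to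
    carry this direction to the same direction at the image point; what is left is polynomial in the
    free slopes and is split coefficient by coefficient. For finite transformations the total
    Jacobian may degenerate at some slopes, so coefficients can be compared only along short
    segments of good slopes. Dropping [eta] from a function with zero [eta]-derivative is legitimate
    only along connected fibres; hence boxes for the algebras, and germs (boxes around a point) for
    the pseudogroups. In the other direction, lifted objects are invariant because the condition for
    the reduction equation is a derivative along [d_x + eta d_u], with [eta] differentiated too, of
    the condition for [L]. Analyticity is established only for the operations that occur: sums,
    products, reciprocals (the lift divides by [X_x]), partial derivatives, pullback along [base]
    and restriction to a slice. Other composites are handled by differentiability and the chain
    rule. *)

Section UnconditionalSums.
Context {R : realType}.

(** Convergence along the directed set of finite subsets, not along an enumeration: products,
    reindexing and regrouping then need no rearrangement theorem. *)
Definition hasum (I : choiceType) (f : I -> R) (l : R) :=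
  forall e, 0 < e -> exists A0 : {fset I},
    forall A : {fset I}, (A0 `<=` A)%fset -> `|\sum_(i <- A) f i - l| < e.

Definition absum (I : choiceType) (f : I -> R) (M : R) :=
  forall A : {fset I}, \sum_(i <- A) `|f i| <= M.

Lemma eq_of_small (x y : R) : (forall e, 0 < e -> `|x - y| < e) -> x = y.
Proof.
move=> h; apply/eqP; rewrite -subr_eq0 -normr_le0 leNgt; apply/negP => d.
by have := h _ d; rewrite ltxx.
Qed.

Section OneIndex.
Variable I : choiceType.
Implicit Types (f g : I -> R) (A B : {fset I}).

Lemma sum_fsetD A B f : (A `<=` B)%fset ->
  \sum_(i <- B) f i = \sum_(i <- A) f i + \sum_(i <- (B `\` A)%fset) f i.
Proof.
move=> /fsubsetP AB; rewrite (big_fsetID _ (mem A)) /=; congr (_ + _).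
  by apply: eq_fbigl => i; rewrite !inE/=; case: (boolP (i \in A)) => [/AB ->|];
    rewrite ?andbT ?andbF.
by apply: eq_fbigl => i; rewrite !inE/= andbC.
Qed.

Lemma sum_fset_le A B f : (forall i, 0 <= f i) -> (A `<=` B)%fset ->
  \sum_(i <- A) f i <= \sum_(i <- B) f i.
Proof. by move=> f0 AB; rewrite (sum_fsetD _ AB) lerDl sumr_ge0. Qed.

Lemma eq_hasum f g l : f =1 g -> hasum f l -> hasum g l.
Proof. by move=> /funext ->. Qed.

Lemma absum_le f g M : (forall i, `|f i| <= `|g i|) -> absum g M -> absum f M.
Proof. by move=> fg gM A; apply: le_trans (gM A); apply: ler_sum. Qed.

Lemma absum_ge0 f M : absum f M -> 0 <= M.
Proof. by move=> /(_ fset0%fset); rewrite big_seq_fset0. Qed.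

Lemma absumD f g M N : absum f M -> absum g N -> absum (f \+ g) (M + N).
Proof.
move=> fM gN A; apply: le_trans (lerD (fM A) (gN A)).
by rewrite -big_split/=; apply: ler_sum => i _; exact: ler_normD.
Qed.

Lemma absumZ k f M : absum f M -> absum (fun i => k * f i) (`|k| * M).
Proof.
move=> fM A; under eq_bigr do rewrite normrM.
by rewrite -mulr_sumr ler_wpM2l.
Qed.

Lemma hasumD f g l m : hasum f l -> hasum g m -> hasum (f \+ g) (l + m).
Proof.
move=> fl gm e e0; have e2 : 0 < e / 2 by rewrite divr_gt0.
have [A hA] := fl _ e2; have [B hB] := gm _ e2.
exists (A `|` B)%fset => C; rewrite fsubUset => /andP[/hA h1 /hB h2].
by rewrite big_split/= opprD addrACA (le_lt_trans (ler_normD _ _))//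
  [e]splitr ltrD.
Qed.

Lemma hasumZ k f l : hasum f l -> hasum (fun i => k * f i) (k * l).
Proof.
move=> fl e e0; have k0 : 0 < `|k| + 1 by rewrite ltr_wpDl.
have [A hA] := fl _ (divr_gt0 e0 k0); exists A => B /hA.
rewrite -mulr_sumr -mulrBr normrM ltr_pdivlMr// => /(le_lt_trans _); apply.
by rewrite mulrC ler_wpM2l// lerDl.
Qed.

Lemma hasum_uniq f l m : hasum f l -> hasum f m -> l = m.
Proof.
move=> fl fm; apply: eq_of_small => e e0.
have e2 : 0 < e / 2 by rewrite divr_gt0.
have [A hA] := fl _ e2; have [B hB] := fm _ e2.
have h1 := hA _ (fsubsetUl A B); have h2 := hB _ (fsubsetUr A B).
rewrite (_ : l - m = (\sum_(i <- (A `|` B)%fset) f i - m) -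
  (\sum_(i <- (A `|` B)%fset) f i - l)); last by ring.
by rewrite (le_lt_trans (ler_normB _ _))// [e]splitr ltrD.
Qed.

Lemma hasum_norm_le f l M : hasum f l -> absum f M -> `|l| <= M.
Proof.
move=> fl fM; apply/ler_addgt0Pr => e e0; have [A hA] := fl _ e0.
rewrite (_ : l = \sum_(i <- A) f i - (\sum_(i <- A) f i - l)); last by ring.
rewrite (le_trans (ler_normB _ _))//; apply: lerD; last by rewrite ltW// hA.
exact: le_trans (ler_norm_sum _ _ _) (fM A).
Qed.

Lemma ge0_hasum f M : (forall i, 0 <= f i) ->
  (forall A, \sum_(i <- A) f i <= M) -> exists l, hasum f l.
Proof.
move=> f0 fM; set E := range (fun A : {fset I} => \sum_(i <- A) f i).
have Es : has_sup E.
  split; first by exists (\sum_(i <- fset0) f i); exists fset0.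
  by exists M => _ [A _ <-].
exists (sup E) => e e0; have [_ [A _ <-] hA] := sup_adherent e0 Es.
exists A => B AB; have := sum_fset_le f0 AB.
have : \sum_(i <- B) f i <= sup E by apply: sup_upper_bound => //; exists B.
by rewrite ltr_norml => h1 h2; apply/andP; split; lra.
Qed.

(** [f = (f + |f|) - |f|] is a difference of two nonnegative families with bounded finite sums. *)
Lemma absum_hasum f M : absum f M -> exists l, hasum f l.
Proof.
move=> fM; have [l hl] : exists l, hasum (fun i => `|f i|) l by exact: ge0_hasum fM.
have [m hm] : exists m, hasum (fun i => f i + `|f i|) m.
  apply: (@ge0_hasum _ (M + M)) => [i|A].
    by rewrite -lerBlDr sub0r lerNl -normrN ler_norm.
  rewrite big_split/= lerD//; apply: le_trans (fM A).
  by apply: ler_sum => i _; exact: ler_norm.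
exists (m + -1 * l); apply: eq_hasum (hasumD hm (hasumZ (-1) hl)) => i /=.
by ring.
Qed.

Lemma hasum_cvg f l (S : nat -> {fset I}) :
  (forall A, \forall N \near \oo, (A `<=` S N)%fset) ->
  hasum f l -> (fun N => \sum_(i <- S N) f i) @ \oo --> l.
Proof.
move=> hS fl; apply/cvgrPdist_lt => e /fl[A hA].
by near=> N; rewrite distrC hA//; near: N; exact: hS.
Unshelve. all: by end_near. Qed.

(** Absolute summability already provides some unconditional sum; the cofinal sequence [S] only
    identifies it, by uniqueness of limits. *)
Lemma cvg_hasum f l M (S : nat -> {fset I}) : absum f M ->
  (forall A, \forall N \near \oo, (A `<=` S N)%fset) ->
  (fun N => \sum_(i <- S N) f i) @ \oo --> l -> hasum f l.
Proof.
move=> fM hS fl; have [m fm] := absum_hasum fM.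
by have := hasum_cvg hS fm; move/(cvg_unique _ fl) => -> //.
Qed.

End OneIndex.

Lemma sum_imfset (I J : choiceType) (phi : J -> I) (f : I -> R) (A : {fset J}) :
  injective phi ->
  \sum_(i <- (phi @` A)%fset) f i = \sum_(j <- A) f (phi j).
Proof. by move=> inj; rewrite big_imfset//= => ? ? _ _ /inj. Qed.

Section Reindex.
Variables (I J : choiceType) (phi : J -> I) (psi : I -> J) (f : I -> R).
Hypothesis phiK : cancel phi psi.
Hypothesis f0 : forall i, phi (psi i) != i -> f i = 0.

Let inj := can_inj phiK.

(** [C] is the preimage of [B]; the indices lost lie off the image of [phi], where [f] vanishes. The
    parameter [h] covers the sums of [f] (identity) and of [|f|] (norm) at once. *)
Lemma sum_preimfset (A : {fset J}) (B : {fset I}) : (phi @` A `<=` B)%fset ->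
  exists2 C : {fset J}, (A `<=` C)%fset & forall h : R -> R, h 0 = 0 ->
    \sum_(i <- B) h (f i) = \sum_(j <- C) h (f (phi j)).
Proof.
move=> AB; pose C := [fset j in (psi @` B)%fset | phi j \in B]%fset.
exists C => [|h h0].
  apply/fsubsetP => j jA; have jB : phi j \in B.
    by move/fsubsetP : AB; apply; exact: in_imfset.
  by rewrite !inE/= jB andbT -{1}(phiK j); apply: in_imfset.
rewrite -(sum_imfset (fun i => h (f i))  _ inj).
apply/esym/big_fset_incl; first by apply/fsubsetP => _ /imfsetP[j /= jC ->];
  move: jC; rewrite !inE/= => /andP[].
move=> i iB iC; rewrite f0 ?h0//; apply: contra iC => /eqP E.
by rewrite -E; apply: in_imfset; rewrite !inE/= E iB andbT; exact: in_imfset.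
Qed.

Lemma hasum_reindex l : hasum f l <-> hasum (f \o phi) l.
Proof.
split => fl e /fl[A hA].
  exists (psi @` A)%fset => B AB.
  rewrite -(sum_imfset f B inj).
  rewrite (_ : \sum_(j <- [fset phi x | x in B]%fset) f j =
    \sum_(i <- ([fset phi x | x in B] `|` A)%fset) f i).
    by apply: hA; exact: fsubsetUr.
  apply: big_fset_incl; first exact: fsubsetUl.
  move=> i; rewrite inE => /orP[-> //|iA] iB; apply: f0.
  apply: contra iB => /eqP <-; apply: in_imfset => /=.
  by move/fsubsetP : AB; apply; exact: in_imfset.
exists (phi @` A)%fset => B /sum_preimfset[C AC /(_ id erefl) ->].
exact: hA.
Qed.

Lemma absum_reindex M : absum f M <-> absum (f \o phi) M.
Proof.
split=> fM A; first by rewrite -(sum_imfset (fun i => `|f i|) A inj).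
have [|C _ E] := @sum_preimfset fset0 A; first by apply/fsubsetP => ? /imfsetP[].
by rewrite (E Num.norm (normr0 _)); exact: fM.
Qed.

End Reindex.

Lemma sum_fsetM (I J : choiceType) (f : I -> J -> R) (A : {fset I}) (B : {fset J}) :
  \sum_(p <- (A `*` B)%fset) f p.1 p.2 = \sum_(i <- A) \sum_(j <- B) f i j.
Proof.
rewrite [RHS](pair_big_dep_cond _ _ (fun=> B) xpredT (fun _ _ => true)).
apply: eq_fbigl => -[i j]; rewrite in_fsetM/=.
apply/andP/imfset2P => [[iA jB]|[k kA [l lB [-> ->]]]].
  by exists i; rewrite ?inE/= ?iA//; exists j; rewrite ?inE/= ?jB.
by move: kA lB; rewrite !inE/= !andbT.
Qed.

(** A finite set of pairs is enclosed in the product of its two projections, on which the sum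
    factors. *)
Lemma absum_prod (I J : choiceType) (f : I -> R) (g : J -> R) M N :
  absum f M -> absum g N -> absum (fun p => f p.1 * g p.2) (M * N).
Proof.
move=> fM gN A; set A1 := (@fst I J @` A)%fset; set A2 := (@snd I J @` A)%fset.
have sub : (A `<=` A1 `*` A2)%fset.
  by apply/fsubsetP => p pA; rewrite in_fsetM !in_imfset.
apply: le_trans (sum_fset_le _ sub) _ => [p|]; first exact: normr_ge0.
rewrite (sum_fsetM (fun i j => `|f i * g j|)).
under eq_bigr => i _ do under eq_bigr => j _ do rewrite normrM.
under eq_bigr => i _ do rewrite -mulr_sumr.
by rewrite -mulr_suml ler_pM ?sumr_ge0.
Qed.

Lemma hasum_prod (I J : choiceType) (f : I -> R) (g : J -> R) M N l m :
  absum f M -> absum g N -> hasum f l -> hasum g m ->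
  hasum (fun p => f p.1 * g p.2) (l * m).
Proof.
move=> fM gN fl gm; have [k hk] := absum_hasum (absum_prod fM gN).
suff <- : k = l * m by [].
apply: eq_of_small => e e0.
(* With [d = (e / 2) / (|m| + M + 1)], the splitting [F G - l m = F (G - m) + (F - l) m] costs at
   most [M d + d |m| <= e / 2] on a rectangle; the other half of [e] pays for replacing [k] by
   [F G]. *)
have b0 : 0 < `|m| + M + 1 by have := absum_ge0 fM; have := normr_ge0 m; lra.
have e2 : 0 < e / 2 by lra.
have d0 : 0 < e / 2 / (`|m| + M + 1) by rewrite divr_gt0.
have [C hC] := hk _ e2; have [A hA] := fl _ d0; have [B hB] := gm _ d0.
set A' := (A `|` (@fst I J @` C))%fset; set B' := (B `|` (@snd I J @` C))%fset.
have sub : (C `<=` A' `*` B')%fset.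
  by apply/fsubsetP => p pC; rewrite in_fsetM !inE !(in_imfset _ _ pC) !orbT.
have := hC _ sub; rewrite (sum_fsetM (fun i j => f i * g j)).
have := hA A' (fsubsetUl _ _); have := hB B' (fsubsetUl _ _).
under [in X in _ -> _ -> X -> _]eq_bigr => i _ do rewrite -mulr_sumr.
rewrite -mulr_suml; have := le_trans (ler_norm_sum _ _ _) (fM A').
set F := \sum_(i <- A') f i; set G := \sum_(j <- B') g j => FM h1 h2 h3.
rewrite (_ : k - l * m = F * (G - m) + (F - l) * m - (F * G - k)); last by ring.
apply: le_lt_trans (ler_normB _ _) _; rewrite [e]splitr ler_ltD//.
apply: le_trans (ler_normD _ _) _; rewrite !normrM.
have : `|F| * `|G - m| <= M * (e / 2 / (`|m| + M + 1)).
  by rewrite ler_pM// ltW.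
have : `|F - l| * `|m| <= e / 2 / (`|m| + M + 1) * `|m|.
  by rewrite ler_wpM2r// ltW.
have : e / 2 / (`|m| + M + 1) * (`|m| + M + 1) = e / 2.
  by rewrite divfK// gt_eqF.
by set d := e / 2 / _ in d0 * => E h4 h5; nra.
Qed.

Section Fibers.
Variables (I K : choiceType) (p : K -> I) (fib : I -> {fset K}) (f : K -> R).
Hypothesis fibP : forall i k, (k \in fib i) = (p k == i).

Lemma sum_fibers (g : K -> R) (A : {fset I}) :
  exists2 B : {fset K}, (forall k, (k \in B) = (p k \in A)) &
  \sum_(i <- A) \sum_(k <- fib i) g k = \sum_(k <- B) g k.
Proof.
exists (\big[fsetU/fset0]_(i <- A) fib i).
  move=> k; apply/bigfcupP/idP => [[i]|kA].
    by rewrite andbT fibP => iA /eqP ->.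
  by exists (p k); rewrite ?kA// fibP.
rewrite partition_disjoint_bigfcup// => i j _ _ ij.
rewrite -fsetI_eq0; apply/eqP/fsetP => k; rewrite !inE !fibP.
by apply/negP => /andP[/eqP-> /eqP E]; rewrite E eqxx in ij.
Qed.

Lemma hasum_fibers l : hasum f l -> hasum (fun i => \sum_(k <- fib i) f k) l.
Proof.
move=> fl e /fl[A hA]; exists (p @` A)%fset => B AB.
have [C CP ->] := sum_fibers f B; apply: hA; apply/fsubsetP => k kA.
by rewrite CP; move/fsubsetP : AB; apply; exact: in_imfset.
Qed.

Lemma absum_fibers M : absum f M -> absum (fun i => \sum_(k <- fib i) f k) M.
Proof.
move=> fM A; have [B _ E] := sum_fibers (fun k => `|f k|) A.
apply: le_trans (fM B); rewrite -E; apply: ler_sum => i _.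
exact: ler_norm_sum.
Qed.

End Fibers.
End UnconditionalSums.

(** * Multi-indices, monomials and Cauchy products of coefficient families *)

Section MultiIndices.
Context {R : realType}.
Variable n : nat.
Implicit Types (x y a : 'rV[R]_n).

Definition mindex := {ffun 'I_n -> nat}.
Implicit Types (al be ga : mindex).

Definition mdeg al := (\sum_i al i)%N.
Definition madd al be : mindex := [ffun i => (al i + be i)%N].
Definition msub al be : mindex := [ffun i => (al i - be i)%N].
Definition mnull : mindex := [ffun=> 0%N].
Definition munit (i : 'I_n) : mindex := [ffun j => (j == i : nat)].
Definition mon x al : R := \prod_i x 0 i ^+ al i.

Lemma mdegD al be : mdeg (madd al be) = (mdeg al + mdeg be)%N.
Proof. by rewrite /mdeg -big_split/=; apply: eq_bigr => i _; rewrite ffunE. Qed.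

Lemma mdeg0 : mdeg mnull = 0%N.
Proof. by rewrite /mdeg big1// => i _; rewrite ffunE. Qed.

Lemma mdeg_unit i : mdeg (munit i) = 1%N.
Proof.
rewrite /mdeg (bigD1 i)//= ffunE eqxx big1 ?addn0// => j ji.
by rewrite ffunE (negbTE ji).
Qed.

Lemma mdeg_ge al i : (al i <= mdeg al)%N.
Proof. by rewrite /mdeg (bigD1 i)//= leq_addr. Qed.

Lemma mdeg_eq0 al : mdeg al = 0%N -> al = mnull.
Proof.
by move=> a0; apply/ffunP => i; rewrite ffunE; have := mdeg_ge al i; rewrite a0; case: (al i).
Qed.

Lemma madd0 al : madd al mnull = al.
Proof. by apply/ffunP => i; rewrite !ffunE addn0. Qed.

Lemma maddC al be : madd al be = madd be al.
Proof. by apply/ffunP => i; rewrite !ffunE addnC. Qed.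

Lemma mon0 x : mon x mnull = 1.
Proof. by rewrite /mon big1// => i _; rewrite ffunE. Qed.

Lemma monD x al be : mon x (madd al be) = mon x al * mon x be.
Proof. by rewrite /mon -big_split/=; apply: eq_bigr => i _; rewrite ffunE exprD. Qed.

Lemma mon_unit x i : mon x (munit i) = x 0 i.
Proof.
rewrite /mon (bigD1 i)//= ffunE eqxx big1 ?mulr1// => j ji.
by rewrite ffunE (negbTE ji).
Qed.

Lemma normr_mon x al : `|mon x al| = \prod_i `|x 0 i| ^+ al i.
Proof. by rewrite /mon normr_prod; apply: eq_bigr => i _; rewrite normrX. Qed.

Lemma mon_le x r al : (forall i, `|x 0 i| <= r) -> `|mon x al| <= r ^+ mdeg al.
Proof.
move=> xr; rewrite normr_mon /mdeg expr_sum.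
by apply: ler_prod => i _; rewrite exprn_ge0//= lerXn2r ?nnegrE// (le_trans _ (xr i)).
Qed.

Lemma mon_at0 al : al != mnull -> mon 0 al = 0.
Proof.
move=> a0; have [i ai] : exists i, al i != 0%N.
  by apply/existsP; apply: contraNT a0 => /existsPn h; apply/eqP/ffunP => i;
    rewrite ffunE; apply/eqP; rewrite -[_ == _]negbK.
by rewrite /mon (bigD1 i)//= mxE expr0n (negbTE ai) mul0r.
Qed.

Definition trunc N (al : {ffun 'I_n -> 'I_N}) : mindex :=
  [ffun i => nat_of_ord (al i)].

Lemma trunc_inj N : injective (@trunc N).
Proof.
by move=> a b /ffunP ab; apply/ffunP => i; apply: val_inj; have := ab i; rewrite !ffunE.
Qed.

Definition cube N : {fset mindex} := (@trunc N @` {: {ffun 'I_n -> 'I_N}})%fset.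

Lemma mem_cube N al : (al \in cube N) = [forall i, (al i < N)%N].
Proof.
apply/imfsetP/forallP => [[be _ ->] i|h]; first by rewrite ffunE.
by exists [ffun i => Ordinal (h i)] => //; apply/ffunP => i; rewrite !ffunE.
Qed.

Lemma sum_cube (F : mindex -> R) N :
  \sum_(al : {ffun 'I_n -> 'I_N}) F (trunc al) = \sum_(al <- cube N) F al.
Proof.
rewrite big_imfset/=; last by move=> ? ? _ _ /trunc_inj.
by rewrite -big_enum/=; apply: eq_bigl.
Qed.

Lemma cube_cofinal (A : {fset mindex}) : \forall N \near \oo, (A `<=` cube N)%fset.
Proof.
exists (\max_(al <- A) mdeg al).+1 => //= N /= AN; apply/fsubsetP => al alA.
rewrite mem_cube; apply/forallP => i; apply: leq_trans AN; rewrite ltnS.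
apply: leq_trans (mdeg_ge al i) _.
by rewrite (big_fsetD1 al)//= leq_maxl.
Qed.

(** The cube only makes the set finite: both parts of a splitting have degree at most [mdeg al], so
    it excludes no pair. *)
Definition splits al : {fset mindex * mindex} :=
  [fset p in (cube (mdeg al).+1 `*` cube (mdeg al).+1)%fset | madd p.1 p.2 == al]%fset.

Lemma splitsP al p : (p \in splits al) = (madd p.1 p.2 == al).
Proof.
rewrite !inE/=; apply: andb_idl => /eqP <-; rewrite !mem_cube.
by apply/andP; split; apply/forallP => i; rewrite ltnS mdegD;
  apply: leq_trans (mdeg_ge _ i) _; rewrite ?leq_addr ?leq_addl.
Qed.

Definition conv (c d : mindex -> R) al :=
  \sum_(p <- splits al) c p.1 * d p.2.

End MultiIndices.

(** * Power series expansions and the algebra of analytic functions *)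

Section PowerSeries.
Context {R : realType}.

Lemma nbhs_rowP n (a : 'rV[R]_n) (P : set 'rV[R]_n) :
  nbhs a P <-> exists2 r : R, 0 < r & forall y : 'rV[R]_n, (forall i, `|y 0 i - a 0 i| < r) -> P y.
Proof.
split=> [/nbhs_ballP[r /= r0 rP]|[r r0 rP]].
  exists r => // y yr; apply: rP; split=> // i j; rewrite ord1 /ball/= distrC; exact: yr.
apply/nbhs_ballP; exists r => //= y [_ ya]; apply: rP => i.
by have := ya 0 i; rewrite /ball/= distrC.
Qed.

(** The radius, coefficients and bound are kept as parameters, since reciprocals and derivatives
    need explicit estimates on them. The same [r] bounds the polydisc and serves as the point of
    absolute convergence. *)
Definition psum n (f : 'rV[R]_n -> R) (a : 'rV[R]_n) (r : R)
    (c : mindex n -> R) (M : R) :=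
  [/\ 0 < r, absum (fun al => c al * r ^+ mdeg al) M &
      forall y : 'rV[R]_n, (forall i, `|y 0 i - a 0 i| < r) ->
        hasum (fun al => c al * mon (y - a) al) (f y)].

(** Cubes are cofinal among finite sets of multi-indices, so bounds on cubes bound all finite sums,
    and limits along cubes are unconditional sums. *)
Lemma analyticP n (f : 'rV[R]_n -> R) a :
  analytic_at f a <-> exists r c M, psum f a r c M.
Proof.
have E r (c : mindex n -> R) : 0 < r -> forall N,
    \sum_(al : {ffun 'I_n -> 'I_N}) `|c (trunc al)| * r ^+ (\sum_i al i) =
    \sum_(al <- cube n N) `|c al * r ^+ mdeg al|.
  move=> r0 N; rewrite -sum_cube; apply: eq_bigr => al _.
  rewrite normrM [X in _ = _ * X]ger0_norm ?exprn_ge0 ?(ltW r0)//.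
  by congr (_ * _ ^+ _); apply: eq_bigr => i _; rewrite ffunE.
have F (c : mindex n -> R) (y : 'rV[R]_n) :
    (fun N => \sum_(al : {ffun 'I_n -> 'I_N})
       c (trunc al) * \prod_i (y 0 i - a 0 i) ^+ al i) =
    (fun N => \sum_(al <- cube n N) c al * mon (y - a) al).
  apply/funext => N; rewrite -sum_cube; apply: eq_bigr => al _; congr (_ * _).
  by rewrite /mon; apply: eq_bigr => i _; rewrite !mxE ffunE.
split=> [[r [c /= [r0 [M cM] cf]]]|[r [c [M [r0 cM cf]]]]].
  have cM' : absum (fun al => c al * r ^+ mdeg al) M.
    move=> A; have [N _ /(_ N (leqnn N)) AN] := cube_cofinal A.
    apply: le_trans (sum_fset_le _ AN) _ => [?|]; first exact: normr_ge0.
    by rewrite -E//; exact: cM.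
  exists r, c, M; split=> // y ya; apply: cvg_hasum (@cube_cofinal n) _.
    apply: (absum_le _ cM') => al; rewrite !normrM ler_wpM2l//.
    rewrite (@ger0_norm _ (r ^+ _)) ?exprn_ge0 ?(ltW r0)// mon_le// => i.
    by rewrite !mxE ltW.
  by rewrite -F; exact: cf.
exists r, c; split=> //; first by exists M => N; rewrite E.
by move=> y ya; rewrite F; exact: hasum_cvg (@cube_cofinal n) (cf y ya).
Qed.

Lemma psum_absum n (f : 'rV[R]_n -> R) a r c M (y : 'rV[R]_n) : psum f a r c M ->
  (forall i, `|y 0 i - a 0 i| < r) -> absum (fun al => c al * mon (y - a) al) M.
Proof.
move=> [r0 cM _] ya; apply: (absum_le _ cM) => al.
rewrite !normrM ler_wpM2l// (@ger0_norm _ (r ^+ _)) ?exprn_ge0 ?(ltW r0)//.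
by rewrite mon_le// => i; rewrite !mxE ltW.
Qed.

Lemma psum_shrink n (f : 'rV[R]_n -> R) a r s c M : 0 < s -> s <= r ->
  psum f a r c M -> psum f a s c M.
Proof.
move=> s0 sr [r0 cM cf]; split=> // [|y ys]; last first.
  by apply: cf => i; exact: lt_le_trans (ys i) sr.
apply: (absum_le _ cM) => al; rewrite !normrM ler_wpM2l//.
by rewrite !ger0_norm ?exprn_ge0 ?(ltW s0) ?(ltW r0)// lerXn2r ?nnegrE ?(ltW s0) ?(ltW r0).
Qed.

Lemma psum_at n (f : 'rV[R]_n -> R) a r c M : psum f a r c M -> f a = c (mnull n).
Proof.
move=> [r0 _ cf]; apply: hasum_uniq (cf a _) _ => [i|]; first by rewrite subrr normr0.
move=> e e0; exists [fset mnull n]%fset => A A0; rewrite subrr.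
rewrite (_ : \sum_(i <- A) _ = c (mnull n)) ?subrr ?normr0//.
rewrite -(@big_fset_incl _ _ _ _ [fset mnull n]%fset A)// ?big_seq_fset1.
  by rewrite mon0 mulr1.
by move=> al _; rewrite inE => /mon_at0 ->; rewrite mulr0.
Qed.

Lemma analytic_near n (f g : 'rV[R]_n -> R) a :
  (\forall y \near a, f y = g y) -> analytic_at f a -> analytic_at g a.
Proof.
move=> /nbhs_rowP[s s0 sfg] /analyticP[r [c [M fP]]]; apply/analyticP.
have m0 : 0 < Num.min r s by rewrite lt_min s0; case: fP => ->.
have mr : Num.min r s <= r by rewrite ge_min lexx.
exists (Num.min r s), c, M.
case: (psum_shrink m0 mr fP) => _ cM cf; split=> // y ya.
rewrite -sfg; first exact: cf.
by move=> i; apply: lt_le_trans (ya i) _; rewrite ge_min lexx orbT.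
Qed.

Lemma analytic_two n (f g : 'rV[R]_n -> R) a :
  analytic_at f a -> analytic_at g a ->
  exists r c d M N, psum f a r c M /\ psum g a r d N.
Proof.
move=> /analyticP[r [c [M fP]]] /analyticP[s [d [N gP]]].
exists (Num.min r s), c, d, M, N.
have m0 : 0 < Num.min r s by rewrite lt_min; case: fP => ->; case: gP => ->.
by split; [apply: psum_shrink fP|apply: psum_shrink gP] => //;
  rewrite ge_min lexx ?orbT.
Qed.

Lemma analyticD n (f g : 'rV[R]_n -> R) a :
  analytic_at f a -> analytic_at g a -> analytic_at (fun y => f y + g y) a.
Proof.
move=> fa /(analytic_two fa)[r [c [d [M [N [[r0 cM cf] [_ dN dg]]]]]]].
apply/analyticP; exists r, (c \+ d), (M + N); split=> // [|y ya].
  by apply: (absum_le _ (absumD cM dN)) => al /=; rewrite mulrDl.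
by apply: eq_hasum (hasumD (cf y ya) (dg y ya)) => al /=; rewrite mulrDl.
Qed.

Lemma absum_single n (be : mindex n) (v : R) :
  absum (fun al => if al == be then v else 0) `|v|.
Proof.
move=> A; have [bA|bA] := boolP (be \in A).
  rewrite (big_fsetD1 be)//= eqxx big1_seq ?addr0// => i /andP[_].
  by rewrite !inE => /andP[/negbTE ->]; rewrite normr0.
rewrite big1_seq// => i /andP[_ iA]; case: eqP => [E|]; last by rewrite normr0.
by rewrite -E iA in bA.
Qed.

Lemma hasum_single n (be : mindex n) (v : R) :
  hasum (fun al => if al == be then v else 0) v.
Proof.
move=> e e0; exists [fset be]%fset => A; rewrite fsub1set => bA.
rewrite (big_fsetD1 be)//= eqxx big1_seq ?addr0 ?subrr ?normr0// => i /andP[_].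
by rewrite !inE => /andP[/negbTE ->].
Qed.

Lemma analytic_mon n (be : mindex n) a : analytic_at (fun y => mon (y - a) be : R) a.
Proof.
apply/analyticP; exists 1, (fun al => if al == be then 1 else 0), `|1|.
split=> // [|y ya].
  apply: (absum_le _ (absum_single be 1)) => al; rewrite expr1n mulr1.
  by case: ifP.
apply: eq_hasum (hasum_single be (mon (y - a) be)) => al.
by case: eqP => [->|_]; rewrite ?mul1r ?mul0r.
Qed.

Lemma analyticZ n k (f : 'rV[R]_n -> R) a :
  analytic_at f a -> analytic_at (fun y => k * f y) a.
Proof.
move=> /analyticP[r [c [M [r0 cM cf]]]]; apply/analyticP.
exists r, (fun al => k * c al), (`|k| * M); split=> // [|y ya].
  by apply: (absum_le _ (absumZ k cM)) => al /=; rewrite mulrA.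
by apply: eq_hasum (hasumZ k (cf y ya)) => al /=; rewrite mulrA.
Qed.

Lemma analytic_cst n (k : R) (a : 'rV[R]_n) : analytic_at (fun=> k) a.
Proof.
apply: analytic_near (analyticZ k (analytic_mon (mnull n) a)).
by near=> y; rewrite mon0 mulr1.
Unshelve. all: by end_near. Qed.

Lemma analytic_coord n (i : 'I_n) (a : 'rV[R]_n) : analytic_at (fun y => y 0 i : R) a.
Proof.
apply: analytic_near (analyticD (analytic_cst (a 0 i) a) (analytic_mon (munit i) a)).
by near=> y; rewrite mon_unit !mxE; ring.
Unshelve. all: by end_near. Qed.

Lemma absum_conv n (c d : mindex n -> R) M N :
  absum c M -> absum d N -> absum (conv c d) (M * N).
Proof.
move=> cM dN; have := absum_fibers (p := fun p => madd p.1 p.2)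
  (fun al p => @splitsP n al p) (absum_prod cM dN).
exact.
Qed.

Lemma hasum_conv n (c d : mindex n -> R) M N l m :
  absum c M -> absum d N -> hasum c l -> hasum d m -> hasum (conv c d) (l * m).
Proof.
move=> cM dN cl dm; have := hasum_fibers (p := fun p => madd p.1 p.2)
  (fun al p => @splitsP n al p) (hasum_prod cM dN cl dm).
exact.
Qed.

(** Used with [w] a monomial at a point and with [w] the power [r ^+ mdeg al], both multiplicative
    in the multi-index. *)
Lemma conv_mon n (c d : mindex n -> R) (w : mindex n -> R) :
  (forall al be, w (madd al be) = w al * w be) ->
  conv (fun al => c al * w al) (fun al => d al * w al) =1
  (fun al => conv c d al * w al).
Proof.
move=> wD al; rewrite /conv mulr_suml; apply: eq_big_seq => p.
by rewrite splitsP => /eqP <-; rewrite wD mulrACA.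
Qed.

Lemma psumM n (f g : 'rV[R]_n -> R) a r c d M N :
  psum f a r c M -> psum g a r d N ->
  psum (fun y => f y * g y) a r (conv c d) (M * N).
Proof.
move=> fP gP; have [r0 cM cf] := fP; have [_ dN dg] := gP; split=> // [|y ya].
  apply: (absum_le _ (absum_conv cM dN)) => al.
  by rewrite (conv_mon c d (w := fun al => r ^+ mdeg al))// => ? ?; rewrite mdegD exprD.
have := hasum_conv (psum_absum fP ya) (psum_absum gP ya) (cf y ya) (dg y ya).
by apply: eq_hasum; apply: conv_mon => ? ?; rewrite monD.
Qed.

Lemma analyticM n (f g : 'rV[R]_n -> R) a :
  analytic_at f a -> analytic_at g a -> analytic_at (fun y => f y * g y) a.
Proof.
move=> fa /(analytic_two fa)[r [c [d [M [N [fP gP]]]]]].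
by apply/analyticP; exists r, (conv c d), (M * N); exact: psumM.
Qed.

End PowerSeries.

(** * Reciprocals of analytic functions *)

Section Reciprocal.
Context {R : realType}.
Variable n : nat.
Implicit Types (c d : mindex n -> R).

Definition mdelta (al : mindex n) : R := if al == mnull n then 1 else 0.

(** Fixed-point iteration [d := 1 - c d] for the inverse of [1 + c], started at 0. When [c] has no
    constant term, step [k] settles all coefficients of degree below [k], which is why [inv_series]
    reads degree [m] at step [m + 1]. *)
Fixpoint inv_approx c k : mindex n -> R :=
  if k is k'.+1 then fun al => mdelta al - conv c (inv_approx c k') al else fun=> 0.

Lemma inv_approxS c k al :
  inv_approx c k.+1 al = mdelta al - conv c (inv_approx c k) al.
Proof. by []. Qed.

Definition inv_series c (al : mindex n) := inv_approx c (mdeg al).+1 al.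

(** Without a constant term in [c], the coefficient of [c d] at [al] sees only coefficients of [d]
    of lower degree. *)
Lemma conv_eq c d d' al : c (mnull n) = 0 ->
  (forall be, (mdeg be < mdeg al)%N -> d be = d' be) -> conv c d al = conv c d' al.
Proof.
move=> c0 dd; apply: eq_big_seq => -[be ga]; rewrite splitsP/= => /eqP E.
have [->|b0] := eqVneq be (mnull n); first by rewrite c0 !mul0r.
rewrite dd// -E mdegD -[X in (X < _)%N]add0n ltn_add2r lt0n.
by apply: contra b0 => /eqP /mdeg_eq0 ->.
Qed.

Lemma inv_approx_stable c k al : c (mnull n) = 0 -> (mdeg al < k)%N ->
  inv_approx c k al = inv_series c al.
Proof.
move=> c0; have step j be : (mdeg be < j)%N -> inv_approx c j.+1 be = inv_approx c j be.
  elim: j be => // j IH be bj; rewrite [LHS]/=; congr (_ - _).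
  by apply: conv_eq => // ga gb; apply: IH; rewrite (leq_trans gb).
elim: k => // k IH; rewrite ltnS leq_eqVlt => /orP[/eqP <-//|ak].
by rewrite step// IH.
Qed.

Lemma inv_seriesE c al : c (mnull n) = 0 ->
  inv_series c al = mdelta al - conv c (inv_series c) al.
Proof.
move=> c0; rewrite -(@inv_approx_stable c (mdeg al).+2)// inv_approxS; congr (_ - _).
by apply: conv_eq => // be ba; rewrite inv_approx_stable// (leq_trans ba).
Qed.

(** The bound 2 is preserved by the iteration, as [1 + M * 2 <= 2]. A finite sum involves finitely
    many coefficients, all stable at one common step [K]. *)
Lemma absum_inv_series c r M : 0 < r -> c (mnull n) = 0 -> M <= 2^-1 ->
  absum (fun al => c al * r ^+ mdeg al) M ->
  absum (fun al => inv_series c al * r ^+ mdeg al) 2.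
Proof.
move=> r0 c0 M2 cM.
have h k : absum (fun al => inv_approx c k al * r ^+ mdeg al) 2.
  elim: k => [|k IH] /=.
    by move=> A; rewrite big1 ?ler0n// => i _; rewrite mul0r normr0.
  move=> A; apply: le_trans (_ : 1 + M * 2 <= _); last by lra.
  have rD (al be : mindex n) : r ^+ mdeg (madd al be) = r ^+ mdeg al * r ^+ mdeg be.
    by rewrite mdegD exprD.
  have E := @conv_mon _ _ c (inv_approx c k) _ rD.
  have := absumD (absum_single (mnull n) (1 : R)) (absumZ (-1) (absum_conv cM IH)).
  rewrite normrN normr1 mul1r => /(_ A); apply: le_trans.
  apply: ler_sum => al _ /=; rewrite E mulrBl mulN1r /mdelta; case: eqP => [->|_]; last by rewrite mul0r.
  by rewrite mdeg0 expr0 !mulr1.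
move=> A; pose K := (\max_(al <- A) mdeg al).+1.
apply: le_trans (h K A); rewrite le_eqVlt; apply/orP; left; apply/eqP.
apply: eq_big_seq => al alA; rewrite (inv_approx_stable (k := K))// /K ltnS.
by rewrite (big_fsetD1 al)//= leq_maxl.
Qed.

Lemma analyticV (f : 'rV[R]_n -> R) a :
  f a != 0 -> analytic_at f a -> analytic_at (fun y => (f y)^-1) a.
Proof.
move=> fa0 fan; pose g y := (f a)^-1 * f y.
suff gan : analytic_at (fun y => (g y)^-1) a.
  apply: analytic_near (analyticZ (f a)^-1 gan); near=> y.
  by rewrite /g invfM invrK mulrA mulVf ?mul1r.
have /analyticP[r [c [M gP]]] : analytic_at g a by exact: analyticZ.
have g1 : c (mnull n) = 1 by rewrite -(psum_at gP) /g mulVf.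
case: (gP) => r0 cM _; have M0 := absum_ge0 cM.
(* Shrinking the radius by the factor [t] multiplies every term of positive degree by at most [t],
   so the nonconstant part of [g] gets absolute sum at most [t * M <= 1/2]. *)
pose t := (2 * (M + 1))^-1.
have t0 : 0 < t by rewrite invr_gt0; lra.
have tM : t * M <= 2^-1.
  rewrite /t invfM -mulrA ler_piMr ?invr_ge0 ?ler0n//.
  by rewrite mulrC ler_pdivrMr; lra.
have t1 : t <= 1 by rewrite invf_le1; lra.
pose s := t * r; have s0 : 0 < s by rewrite mulr_gt0.
have sr : s <= r by rewrite /s ger_pMl.
have gs := psum_shrink s0 sr gP.
pose c' al := c al - mdelta al.
have c'0 : c' (mnull n) = 0 by rewrite /c' g1 /mdelta eqxx subrr.
have c'M : absum (fun al => c' al * s ^+ mdeg al) (t * M).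
  rewrite -[t]ger0_norm ?(ltW t0)//; apply: absum_le (absumZ t cM) => al.
  rewrite /c' /mdelta; have [->|a0] := eqVneq al (mnull n).
    by rewrite g1 subrr mul0r normr0.
  rewrite subr0 /s exprMn mulrCA !normrM ler_wpM2r// ?mulr_ge0// normrX.
  rewrite ger0_norm ?(ltW t0)//.
  case: (mdeg al) (@mdeg_eq0 n al) => [/(_ erefl) E|k _]; first by rewrite E eqxx in a0.
  by rewrite exprS ler_piMr ?(ltW t0)// exprn_ile1// ltW.
apply/analyticP; exists s, (inv_series c'), 2.
have iM := absum_inv_series s0 c'0 tM c'M.
split=> // y ya; have [_ _ /(_ y ya) gy] := gs.
have xs al : `|mon (y - a) al| <= `|s ^+ mdeg al|.
  rewrite [leRHS]ger0_norm ?exprn_ge0 ?(ltW s0)//.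
  by apply: mon_le => i; rewrite !mxE ltW.
have iy : absum (fun al => inv_series c' al * mon (y - a) al) 2.
  by apply: absum_le iM => al; rewrite !normrM ler_wpM2l.
have [l hl] := absum_hasum iy.
have cy : absum (fun al => c' al * mon (y - a) al) (t * M).
  by apply: absum_le c'M => al; rewrite !normrM ler_wpM2l.
have hd : hasum (fun al => mdelta al * mon (y - a) al) 1.
  apply: eq_hasum (hasum_single (mnull n) 1) => al; rewrite /mdelta.
  by case: eqP => [->|]; rewrite ?mon0 ?mulr1 ?mul0r.
have hc : hasum (fun al => c' al * mon (y - a) al) (g y + -1 * 1).
  by apply: eq_hasum (hasumD gy (hasumZ (-1) hd)) => al /=; rewrite /c'; ring.
have := hasumD hd (hasumZ (-1) (hasum_conv cy iy hc hl)) => hR.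
(* Summing the fixed-point equation of [inv_series] gives [l = 1 - (g y - 1) l], that is
   [g y * l = 1]. *)
have E : l = 1 + -1 * ((g y + -1 * 1) * l).
  apply: hasum_uniq hl (eq_hasum _ hR) => al /=.
  rewrite (@conv_mon _ _ c' (inv_series c') (mon (y - a))); last exact: monD.
  by rewrite [inv_series c' al in RHS]inv_seriesE// mulrBl mulN1r.
suff -> : (g y)^-1 = l by [].
have gl : g y * l = 1 by move: E; move: (g y) => u E; lra.
have g0 : g y != 0 by apply: contra_eq_neq gl => ->; rewrite mul0r eq_sym oner_neq0.
by apply: (mulfI g0); rewrite gl mulfV.
Unshelve. all: by end_near. Qed.

End Reciprocal.

(** * Termwise differentiation and symmetry of second derivatives *)

Section Derivatives.
Context {R : realType}.

(** Induction on [m]: the remainder [E] becomes [(x + s) E + m s^2 x^(m-1)]. The factor [rho ^+ 2]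
    on the left stands for an exponent [m - 2] on the right, which would be truncated for small
    [m]. *)
Lemma pow_taylor (x s rho : R) m : `|x| <= rho -> `|x + s| <= rho ->
  `|(x + s) ^+ m - x ^+ m - s * (m%:R * x ^+ m.-1)| * rho ^+ 2
  <= (m%:R * s) ^+ 2 * rho ^+ m.
Proof.
move=> xr xsr; have r0 : 0 <= rho := le_trans (normr_ge0 _) xr.
elim: m => [|m IH].
  by rewrite !expr0 !mul0r mulr0 subr0 subrr normr0 mul0r expr0n/= mul0r.
rewrite (_ : _ - _ = (x + s) * ((x + s) ^+ m - x ^+ m - s * (m%:R * x ^+ m.-1)) +
   m%:R * s ^+ 2 * x ^+ m.-1); last first.
  case: m {IH} => [|m]; first by rewrite /= !expr0 expr1; ring.
  by rewrite /= -!natr1 !exprS; ring.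
set E := (_ - _ - _) in IH *; apply: le_trans (_ : (`|x + s| * `|E| +
   `|m%:R * s ^+ 2 * x ^+ m.-1|) * rho ^+ 2 <= _).
  by rewrite ler_wpM2r ?exprn_ge0// -normrM ler_normD.
rewrite mulrDl -mulrA.
apply: le_trans (_ : rho * ((m%:R * s) ^+ 2 * rho ^+ m) + m%:R * s ^+ 2 * rho ^+ m.+1 <= _).
  apply: lerD; first by apply: ler_pM => //; rewrite mulr_ge0// exprn_ge0.
  have ms0 : 0 <= m%:R * s ^+ 2 by rewrite mulr_ge0 ?sqr_ge0.
  rewrite normrM (ger0_norm ms0) -(mulrA _ `|_| _).
  case: m {IH E} ms0 => [|m] ms0 /=; first by rewrite !mul0r.
  apply: ler_wpM2l; first by rewrite mulr_ge0 ?sqr_ge0.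
  rewrite normrX -[m.+2]addn2 (exprD rho m 2) ler_wpM2r ?sqr_ge0//.
  by rewrite lerXn2r.
rewrite -subr_ge0 (_ : _ - _ = m.+1%:R * (s ^+ 2 * rho ^+ m.+1)).
  by apply: mulr_ge0 => //; apply: mulr_ge0; rewrite ?sqr_ge0 ?exprn_ge0.
by rewrite (exprS rho m) -natr1; ring.
Qed.

Lemma derive_of_quadratic n (f : 'rV[R]_n -> R) y v g K d : 0 < d ->
  (forall s, `|s| < d -> `|f (s *: v + y) - f y - s * g| <= K * s ^+ 2) ->
  is_derive y v f g.
Proof.
move=> d0 h.
suff H : (fun s : R => s^-1 *: ((f \o shift y) (s *: v) - f y)) @ 0^' --> g.
  apply: DeriveDef; first by apply/cvg_ex; exists g.
  exact: cvg_lim H.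
apply/cvgrPdist_le => e e0; pose b := Num.min d (e / (`|K| + 1)).
have K1 : 0 < `|K| + 1 by rewrite ltr_wpDl.
have b0 : 0 < b by rewrite lt_min d0 divr_gt0.
have hb : \forall s \near (0 : R)^', `|s| < b by exact: dnbhs0_lt.
near=> s; have s0 : s != 0 by near: s; exact: nbhs_dnbhs_neq.
have : `|s| < b by near: s.
rewrite lt_min => /andP[/h sd sK].
rewrite distrC /= -(mulKf s0 g) -scalerBr normrZ normfV ler_pdivrMl ?normr_gt0//.
apply: le_trans sd _; rewrite -real_normK ?num_real// expr2 mulrA mulrC.
rewrite ler_wpM2l//; move: sK; rewrite ltr_pdivlMr// => sK.
apply: le_trans (ltW sK); rewrite mulrC ler_wpM2l//.
by apply: le_trans (ler_norm K) _; rewrite lerDl.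
Unshelve. all: by end_near. Qed.

Variable n : nat.
Implicit Types (x y a : 'rV[R]_n) (al be : mindex n).

Definition mon_rest (i : 'I_n) x al : R := \prod_(j | j != i) x 0 j ^+ al j.

Lemma mon_split i x al : mon x al = x 0 i ^+ al i * mon_rest i x al.
Proof. by rewrite /mon (bigD1 i). Qed.

Lemma mon_rest_shift i (s : R) x al :
  mon_rest i (s *: delta_mx 0 i + x) al = mon_rest i x al.
Proof.
by apply: eq_bigr => j ji; rewrite !mxE eqxx (negbTE ji) andbF mulr0 add0r.
Qed.

Lemma mon_rest_le i x al rho : (forall j, `|x 0 j| <= rho) -> 0 <= rho ->
  `|mon_rest i x al| * rho ^+ al i <= rho ^+ mdeg al.
Proof.
move=> xr r0; rewrite /mdeg (bigD1 i)//= exprD mulrC ler_wpM2l ?exprn_ge0//.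
rewrite normr_prod expr_sum; apply: ler_prod => j _; rewrite normr_ge0 normrX.
by rewrite lerXn2r ?nnegrE.
Qed.

Definition dcoef (i : 'I_n) (c : mindex n -> R) be :=
  c (madd be (munit i)) * (be i).+1%:R.

Lemma mon_const (r : R) al : mon (const_mx r) al = r ^+ mdeg al.
Proof. by rewrite /mon /mdeg expr_sum; apply: eq_bigr => i _; rewrite mxE. Qed.

Lemma exp4_dominates (m : nat) : (m%:R : R) <= 4 ^+ m /\ (m%:R : R) ^+ 2 <= 4 ^+ m.
Proof.
have h : (m%:R : R) <= 2 ^+ m by rewrite -natrX ler_nat ltnW// ltn_expl.
have E : (4 : R) ^+ m = 2 ^+ m * 2 ^+ m by rewrite -exprMn -natrM.
rewrite E; split; last by rewrite expr2 ler_pM.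
by apply: le_trans h _; rewrite ler_peMl ?exprn_ege1 ?exprn_ge0 ?ler1n.
Qed.

(** On radius [rho = r / 4], the derivative and the quadratic remainder of a monomial of exponent
    [m] cost factors [m] and [m^2]; both are at most [4^m], the gain from [r^m = 4^m rho^m]. *)
Lemma psum_pd (f : 'rV[R]_n -> R) a r c M i : psum f a r c M ->
  psum (pd i f) a (r / 4) (dcoef i c) ((r / 4)^-1 * M) /\
  (forall y, (forall j, `|y 0 j - a 0 j| < r / 4) ->
    is_derive y (delta_mx 0 i) f (pd i f y)).
Proof.
move=> fP; have [r0 cM cf] := fP; set rho := r / 4.
have p0 : 0 < rho by rewrite divr_gt0.
have pr : rho < r by rewrite /rho; lra.
have rE k : r ^+ k = 4 ^+ k * rho ^+ k by rewrite -exprMn /rho mulrC divfK.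
have rk0 k : 0 <= r ^+ k by rewrite exprn_ge0 ?(ltW r0).
have pk0 k : 0 <= rho ^+ k by rewrite exprn_ge0 ?(ltW p0).
(* The [i]-th derivative of the monomial; at [al i = 0] the truncated exponent is harmless because
   the leading factor is 0. *)
pose q x al : R := (al i)%:R * x 0 i ^+ (al i).-1 * mon_rest i x al.
have qP x al : (forall j, `|x 0 j| <= rho) -> rho * `|q x al| <= r ^+ mdeg al.
  move=> xr; rewrite /q 2!normrM normr_nat normrX rE.
  case E : (al i) => [|m]; first by rewrite !mul0r mulr0 -rE.
  apply: le_trans (_ : m.+1%:R * (`|mon_rest i x al| * rho ^+ m.+1) <= _).
    rewrite /= (_ : rho * _ = m.+1%:R * (`|mon_rest i x al| * (rho * `|x 0 i| ^+ m)));
      last by ring.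
    by rewrite !ler_wpM2l// exprS ler_wpM2l ?(ltW p0)// lerXn2r ?nnegrE ?(ltW p0).
  rewrite -E; apply: ler_pM => //; first by rewrite mulr_ge0.
    apply: le_trans (exp4_dominates _).1 _; rewrite ler_weXn2l ?ler1n//.
    exact: mdeg_ge.
  by rewrite mon_rest_le// ltW.
have tP x s al : (forall j, `|x 0 j| <= rho) -> `|x 0 i + s| <= rho ->
    `|mon (s *: delta_mx 0 i + x) al - mon x al - s * q x al| * rho ^+ 2 <=
    s ^+ 2 * r ^+ mdeg al.
  move=> xr xs; rewrite !(mon_split i) mon_rest_shift !mxE !eqxx mulr1 /q.
  rewrite (_ : _ - _ - _ = ((x 0 i + s) ^+ al i - x 0 i ^+ al i -
    s * ((al i)%:R * x 0 i ^+ (al i).-1)) * mon_rest i x al); last first.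
    by rewrite (addrC s); ring.
  rewrite normrM mulrAC.
  apply: le_trans (_ : ((al i)%:R * s) ^+ 2 * rho ^+ al i * `|mon_rest i x al| <= _).
    by rewrite ler_wpM2r// pow_taylor.
  rewrite (_ : _ * _ * _ = s ^+ 2 *
    ((al i)%:R ^+ 2 * (`|mon_rest i x al| * rho ^+ al i))); last by ring.
  rewrite ler_wpM2l ?sqr_ge0// rE ler_pM ?sqr_ge0 ?mulr_ge0//.
    apply: le_trans (exp4_dominates _).2 _; rewrite ler_weXn2l ?ler1n//.
    exact: mdeg_ge.
  by rewrite mon_rest_le// ltW.
have gM x : (forall j, `|x 0 j| <= rho) -> absum (fun al => c al * q x al) (rho^-1 * M).
  move=> xr; rewrite -[rho^-1]gtr0_norm ?invr_gt0//.
  apply: absum_le (absumZ rho^-1 cM) => al.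
  rewrite (mulrCA _ (c al)) [leLHS]normrM [leRHS]normrM ler_wpM2l//.
  by rewrite [leRHS]ger0_norm ?mulr_ge0 ?invr_ge0 ?(ltW p0)// ler_pdivlMl// qP.
have main y : (forall j, `|y 0 j - a 0 j| < rho) -> exists2 l,
    hasum (fun al => c al * q (y - a) al) l & is_derive y (delta_mx 0 i) f l.
  move=> ya; have xr j : `|(y - a) 0 j| <= rho by rewrite !mxE ltW.
  have [l hl] := absum_hasum (gM _ xr); exists l => //.
  have d0 : 0 < rho - `|(y - a) 0 i| by rewrite subr_gt0 !mxE.
  apply: (derive_of_quadratic (K := (rho ^+ 2)^-1 * M) d0) => s sd.
  have xs : `|(y - a) 0 i + s| <= rho.
    by apply: le_trans (ler_normD _ _) _; lra.
  have y'a j : `|(s *: delta_mx 0 i + y) 0 j - a 0 j| < r.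
    apply: le_lt_trans pr; have [->|ji] := eqVneq j i.
      by move: xs; rewrite !mxE !eqxx mulr1 addrAC [s + _]addrC -addrA.
    by rewrite !mxE (negbTE ji) andbF mulr0 add0r -[_ - _]/(y 0 j - a 0 j) ltW.
  have y2 j : `|y 0 j - a 0 j| < r by exact: lt_trans (ya j) pr.
  have := hasumD (hasumD (cf _ y'a) (hasumZ (-1) (cf _ y2))) (hasumZ (- s) hl).
  rewrite mulN1r mulNr => /hasum_norm_le; apply => A.
  have K0 : 0 <= (rho ^+ 2)^-1 * s ^+ 2.
    by rewrite mulr_ge0 ?invr_ge0 ?sqr_ge0.
  rewrite mulrAC -[X in X * M]ger0_norm//.
  apply: le_trans (absumZ ((rho ^+ 2)^-1 * s ^+ 2) cM A).
  apply: ler_sum => al _ /=; rewrite -(addrA _ y).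
  rewrite (_ : _ + _ + _ = c al * (mon (s *: delta_mx 0 i + (y - a)) al -
    mon (y - a) al - s * q (y - a) al)); last by ring.
  rewrite (mulrCA (rho ^- 2 * _) (c al)) [leLHS]normrM [leRHS]normrM ler_wpM2l//.
  rewrite (ger0_norm (mulr_ge0 K0 (rk0 _))) -(mulrA (rho ^- 2)).
  rewrite ler_pdivlMl ?exprn_gt0//.
  by rewrite mulrC tP.
have mainE y : (forall j, `|y 0 j - a 0 j| < rho) ->
    hasum (fun al => c al * q (y - a) al) (pd i f y).
  by move=> /main[l hl [_ yl]]; rewrite /pd yl.
(* The terms [q] are indexed by the exponent before differentiation; adding a unit in direction [i]
   passes to the exponent after it. Indices not of this form have [al i = 0] and contribute
   nothing. *)
have phiK : cancel (fun be => madd be (munit i)) (fun al => msub al (munit i)).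
  by move=> be; apply/ffunP => j; rewrite !ffunE addnK.
have q0 x al : madd (msub al (munit i)) (munit i) != al -> c al * q x al = 0.
  move=> h; suff E : al i = 0%N by rewrite /q E !mul0r mulr0.
  apply/eqP; apply: contraNT h; rewrite -lt0n => h; apply/eqP/ffunP => j.
  by rewrite !ffunE; case: eqP => [->|_]; rewrite ?subnK// subn0 addn0.
have qE x be : c (madd be (munit i)) * q x (madd be (munit i)) =
    dcoef i c be * mon x be.
  rewrite /q /dcoef (mon_split i) -!mulrA ffunE ffunE eqxx addn1; congr (_ * (_ * (_ * _))).
  by apply: eq_bigr => j ji; rewrite !ffunE (negbTE ji) addn0.
split; last first.
  by move=> y /main[l _ yl]; case: (yl) => _ E; rewrite /pd E.
split=> // [|y ya].
  have : absum (fun al => c al * q (const_mx rho) al) (rho^-1 * M).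
    by apply: gM => j; rewrite mxE gtr0_norm.
  move=> /(absum_reindex phiK (q0 _)); apply: absum_le => be /=.
  by rewrite qE mon_const.
have := mainE y ya; move=> /(hasum_reindex phiK (q0 _)).
by apply: eq_hasum => be /=; rewrite qE.
Qed.

Lemma analytic_pd (f : 'rV[R]_n -> R) a i : analytic_at f a -> analytic_at (pd i f) a.
Proof.
move=> /analyticP[r [c [M fP]]]; apply/analyticP.
by have [h _] := psum_pd i fP; exists (r / 4), (dcoef i c), ((r / 4)^-1 * M).
Qed.

Lemma analytic_is_derive (f : 'rV[R]_n -> R) a i : analytic_at f a ->
  is_derive a (delta_mx 0 i) f (pd i f a).
Proof.
move=> /analyticP[r [c [M fP]]]; have [[r0 _ _] h] := psum_pd i fP.
by apply: h => j; rewrite subrr normr0.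
Qed.

Lemma psum_pd_at (f : 'rV[R]_n -> R) a r c M i : psum f a r c M ->
  pd i f a = c (munit i).
Proof.
move=> /(psum_pd i)[/psum_at -> _]; rewrite /dcoef ffunE mulr1; congr c.
by apply/ffunP => j; rewrite !ffunE.
Qed.

(** Both sides are the constant coefficient of a series differentiated twice, an expression
    symmetric in [i] and [j]. *)
Lemma pd_comm (f : 'rV[R]_n -> R) a i j : analytic_at f a ->
  pd i (pd j f) a = pd j (pd i f) a.
Proof.
move=> /analyticP[r [c [M fP]]].
have [/(psum_pd_at i) -> _] := psum_pd j fP.
have [/(psum_pd_at j) -> _] := psum_pd i fP.
by rewrite /dcoef !ffunE maddC [j == i]eq_sym.
Qed.

End Derivatives.

(** * Differentiability of analytic functions and the chain rule *)

Section Differentiability.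
Context {R : realType}.
Variable n : nat.
Implicit Types (x y a : 'rV[R]_n) (al be : mindex n).

Lemma munit_inj : injective (@munit n).
Proof.
by move=> i j /ffunP/(_ j); rewrite !ffunE eqxx; case: eqP.
Qed.

Lemma mdeg_eq1 al : mdeg al = 1%N -> exists i, al = munit i.
Proof.
move=> a1; have [i ai] : exists i, (0 < al i)%N.
  apply/existsP; apply: contra_eqT a1 => /existsPn h.
  by rewrite /mdeg big1// => i _; apply/eqP; rewrite -leqn0 leqNgt.
exists i; have E : al = madd (msub al (munit i)) (munit i).
  by apply/ffunP => j; rewrite !ffunE; case: eqP => [->|_]; rewrite ?subnK// subn0 addn0.
rewrite E [LHS]maddC; have := congr1 (@mdeg n) E.
rewrite a1 mdegD mdeg_unit addn1 => -[/esym/mdeg_eq0 ->]; exact: madd0.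
Qed.

Lemma hasum_remove (I : choiceType) (f : I -> R) l (S : {fset I}) : hasum f l ->
  hasum (fun i => if i \in S then 0 else f i) (l - \sum_(i <- S) f i).
Proof.
move=> fl e /fl[A hA]; exists (A `|` S)%fset => B; rewrite fsubUset => /andP[AB SB].
have := hA B AB; rewrite !(sum_fsetD _ SB).
rewrite [X in _ -> `|X + _ - _| < _]big1_seq; last by move=> i /andP[_ ->].
rewrite add0r [X in _ -> `|X - _| < _](eq_big_seq f).
  by rewrite opprB addrCA addrA.
by move=> i; rewrite !inE => /andP[/negbTE ->].
Qed.

Lemma mx_norm_ge m p (x : 'M[R]_(m, p)) i j : `|x i j| <= `|x|.
Proof.
rewrite [leRHS]/Num.Def.normr/= mx_normrE.
exact: (le_bigmax _ (fun ij => `|x ij.1 ij.2|) (i, j)).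
Qed.

(** After removal of degrees 0 and 1, each remaining monomial has degree [k + 2] and is at most
    [(|y - a| / r)^2 r^(k+2)]. *)
Lemma psum_taylor (f : 'rV[R]_n -> R) a r c M y : psum f a r c M ->
  `|y - a| < r ->
  `|f y - (c (mnull n) + \sum_i c (munit i) * (y 0 i - a 0 i))|
    <= M / r ^+ 2 * `|y - a| ^+ 2.
Proof.
move=> [r0 cM cf] ya; have yi i : `|(y - a) 0 i| <= `|y - a| by exact: mx_norm_ge.
have := cf y; set S := (mnull n |` [fset munit i | i : 'I_n])%fset.
have : forall i, `|y 0 i - a 0 i| < r.
  by move=> i; have := yi i; rewrite !mxE => /le_lt_trans; apply.
move=> h /(_ h)/(hasum_remove S); rewrite big_fsetU1/=; last first.
  apply/negP => /imfsetP[i _ /(congr1 (@mdeg n))].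
  by rewrite mdeg0 mdeg_unit.
rewrite big_imfset/=; last by move=> ? ? _ _ /munit_inj.
rewrite mon0 mulr1 big_enum/=; under eq_bigr do rewrite mon_unit !mxE.
move=> /hasum_norm_le; apply => A.
have K0 : 0 <= `|y - a| ^+ 2 / r ^+ 2 by rewrite mulr_ge0 ?invr_ge0 ?sqr_ge0.
rewrite (_ : M / r ^+ 2 * _ = `|y - a| ^+ 2 / r ^+ 2 * M); last by ring.
rewrite -[X in X * M](ger0_norm K0).
apply: le_trans (absumZ _ cM A); apply: ler_sum => al _.
case: ifPn => [_|aS]; first by rewrite normr0.
have : (1 < mdeg al)%N.
  case E : (mdeg al) => [|[|k]]//.
    by move: aS; rewrite (mdeg_eq0 E) !inE eqxx.
  have [i ai] := mdeg_eq1 E; move: aS; rewrite ai !inE negb_or => /andP[_].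
  by move=> /imfsetP; case; exists i.
case E : (mdeg al) => [|[|k]]// _.
rewrite (mulrCA (_ / _) (c al)) [leLHS]normrM [leRHS]normrM ler_wpM2l//.
apply: le_trans (mon_le (r := `|y - a|) al yi) _.
rewrite E (ger0_norm (mulr_ge0 K0 (exprn_ge0 _ (ltW r0)))).
rewrite -mulrA -[k.+2]addn2 !(exprD _ k 2) mulrC ler_wpM2l ?sqr_ge0//.
by rewrite mulrCA mulVf ?mulr1 ?lerXn2r ?nnegrE ?(ltW r0) ?(ltW ya)// expf_neq0 ?gt_eqF.
Qed.

Lemma differentiable_quadratic (V : normedModType R) (h : V -> R) (a : V) (K r : R) :
  0 < r -> (forall y : V, `|y - a| < r -> `|h y| <= K * `|y - a| ^+ 2) ->
  differentiable h a.
Proof.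
move=> r0 hK.
have ha : h a = 0.
  apply/eqP; rewrite -normr_le0; apply: le_trans (hK a _) _; rewrite subrr normr0//.
  by rewrite expr0n mulr0.
have H : h \o shift a = cst (h a) + (\0 : {linear V -> R}) +o_ (0 : V) id.
  apply/eqaddoP => _/posnumP[e]; near=> y.
  rewrite /= !fctE/= ha addr0 subr0.
  have y1 : `|y| < r by near: y; exact: nbhs0_lt.
  have y2 : `|y| < e%:num / (`|K| + 1) by near: y; apply: nbhs0_lt; rewrite divr_gt0// ltr_wpDl.
  apply: le_trans (hK _ _) _; rewrite addrK// expr2 mulrA ler_wpM2r//.
  move: y2; rewrite ltr_pdivlMr ?ltr_wpDl// => /ltW; apply: le_trans.
  by rewrite mulrC ler_wpM2l// (le_trans (ler_norm K))// lerDl.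
have E : 'd h a = (\0 : {linear V -> R}) :> (V -> R).
  by apply: diff_unique H => y; exact: cst_continuous.
by apply/diff_locallyP; rewrite E; split=> // y; exact: cst_continuous.
Unshelve. all: by end_near. Qed.

Lemma analytic_differentiable (f : 'rV[R]_n -> R) a :
  analytic_at f a -> differentiable f a.
Proof.
move=> /analyticP[r [c [M fP]]]; have [r0 _ _] := fP.
pose g y := c (mnull n) + \sum_i c (munit i) * (y 0 i - a 0 i).
rewrite (_ : f = g + (f - g)); last by apply/funext => y; rewrite !fctE/= addrC subrK.
apply: differentiableD; last first.
  by apply: (differentiable_quadratic r0) => y ya; exact: (psum_taylor fP ya).
rewrite (_ : g = cst (c (mnull n)) +
    \sum_i (cst (c (munit i)) * ((fun y : 'rV[R]_n => y 0 i : R) - cst (a 0 i)))).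
  apply: differentiableD; first exact: differentiable_cst.
  apply: differentiable_sum => i; apply: differentiableM; first exact: differentiable_cst.
  apply: differentiableB; last exact: differentiable_cst.
  exact: differentiable_coord.
by apply/funext => y; rewrite /g !fctE/= fct_sumE.
Qed.

Lemma diff_pd (f : 'rV[R]_n -> R) a v : differentiable f a ->
  'd f a v = \sum_i v 0 i * pd i f a.
Proof.
move=> fa; rewrite {1}(row_sum_delta v) linear_sum; apply: eq_bigr => i _.
by rewrite linearZ/= /pd deriveE.
Qed.

Lemma pd_coord i k a : pd i (fun y : 'rV[R]_n => y 0 k : R) a = (i == k)%:R.
Proof.
rewrite /pd; apply: (@derive_val _ _ _ _ _ _ _ _).
apply: (derive_of_quadratic (K := 0) (d := 1)) => // s _.
rewrite !mxE eqxx /= addrK [k == i]eq_sym subrr normr0 mul0r.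
by [].
Qed.

(** The source is an arbitrary normed space, so that this serves both for lines ([V] equal to [R])
    and for maps between coordinate spaces. *)
Lemma chain_rule (V : normedModType R) (g : V -> 'rV[R]_n) (f : 'rV[R]_n -> R)
    (b v : V) :
  (forall k, differentiable (fun z => g z 0 k) b) -> differentiable f (g b) ->
  is_derive b v (f \o g) (\sum_k 'D_v (fun z => g z 0 k) b * pd k f (g b)).
Proof.
move=> gd fd; have E : g = \sum_k (fun z => g z 0 k *: delta_mx 0 k).
  by apply/funext => y; rewrite fct_sumE -row_sum_delta.
have gb : differentiable g b.
  by rewrite E; apply: differentiable_sum => k; apply: differentiableZl.
have cd : differentiable (f \o g) b by exact: differentiable_comp.
have -> : \sum_k 'D_v (fun z => g z 0 k) b * pd k f (g b) = 'D_v (f \o g) b.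
  rewrite [RHS]deriveE// diff_comp//= diff_pd//; apply: eq_bigr => k _; congr (_ * _).
  have ek : differentiable (fun y : 'rV[R]_n => y 0 k : R) (g b).
    exact: differentiable_coord.
  rewrite deriveE//.
  rewrite (_ : (fun z => g z 0 k) = (fun y : 'rV[R]_n => y 0 k : R) \o g)//.
  rewrite diff_comp//= diff_pd// (bigD1 k)//= big1 ?addr0 => [|i ik].
    by rewrite pd_coord eqxx mulr1.
  by rewrite pd_coord (negbTE ik) mulr0.
by apply: DeriveDef => //; exact: diff_derivable.
Qed.

End Differentiability.

(** * Pullback along the projection [base] and restriction to its slices *)

Section Fibration.
Context {R : realType}.
Variable n : nat.
Implicit Types (w : 'rV[R]_n.+1) (z : 'rV[R]_n).

Definition row_ext z (e : R) : 'rV[R]_n.+1 :=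
  \row_k (if unlift ord_max k is Some i then z 0 i else e).

Lemma row_ext_ind z e i : row_ext z e 0 (ind i) = z 0 i.
Proof. by rewrite mxE liftK. Qed.

Lemma row_ext_dep z e : row_ext z e 0 (dep n) = e.
Proof. by rewrite mxE unlift_none. Qed.

Lemma base_row_ext z e : base (row_ext z e) = z.
Proof. by apply/rowP => i; rewrite mxE row_ext_ind. Qed.

Lemma indP (k : 'I_n.+1) : (exists i, k = ind i) \/ k = dep n.
Proof. by case: (unliftP ord_max k) => [i ->|->]; [left; exists i|right]. Qed.

Lemma row_ext_base w : row_ext (base w) (w 0 (dep n)) = w.
Proof.
apply/rowP => k; have [[i ->]|->] := indP k; last exact: row_ext_dep.
by rewrite row_ext_ind mxE.
Qed.

Lemma ind_neq_dep i : (ind i == dep n) = false.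
Proof. by apply/negbTE; rewrite eq_sym neq_lift. Qed.

Lemma ind_inj : injective (@ind n).
Proof. exact: lift_inj. Qed.

Lemma base_shift w i (s : R) :
  base (s *: delta_mx 0 (ind i) + w) = s *: delta_mx 0 i + base w.
Proof. by apply/rowP => j; rewrite !mxE (inj_eq ind_inj). Qed.

Lemma base_shift_dep w (s : R) : base (s *: delta_mx 0 (dep n) + w) = base w.
Proof. by apply/rowP => j; rewrite !mxE ind_neq_dep andbF mulr0 add0r. Qed.

Lemma pd_base (f : 'rV[R]_n -> R) i : pd (ind i) (f \o @base R n) = pd i f \o @base R n.
Proof.
by apply/funext => w; rewrite /pd /derive; under eq_fun do rewrite /= base_shift.
Qed.

Lemma pd_base_dep (f : 'rV[R]_n -> R) : pd (dep n) (f \o @base R n) = fun=> 0.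
Proof.
apply/funext => w; rewrite /pd /derive.
under eq_fun do rewrite /= base_shift_dep subrr scaler0.
exact: lim_cst.
Qed.

Definition mext (al : mindex n) : mindex n.+1 :=
  [ffun k => if unlift ord_max k is Some i then al i else 0%N].

Definition mres (al : mindex n.+1) : mindex n := [ffun i => al (ind i)].

Lemma mextK : cancel mext mres.
Proof. by move=> al; apply/ffunP => i; rewrite !ffunE liftK. Qed.

Lemma mext_ind al i : mext al (ind i) = al i.
Proof. by rewrite ffunE liftK. Qed.

Lemma mext_dep al : mext al (dep n) = 0%N.
Proof. by rewrite ffunE unlift_none. Qed.

Lemma mext_mres al : mext (mres al) != al -> al (dep n) != 0%N.
Proof.
apply: contraNN => /eqP h; apply/eqP/ffunP => k.
have [[i ->]|->] := indP k; first by rewrite mext_ind ffunE.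
by rewrite mext_dep h.
Qed.

Lemma prod_ind (F : 'I_n.+1 -> R) : \prod_k F k = F (dep n) * \prod_i F (ind i).
Proof.
rewrite (bigD1 (dep n))//=; congr (_ * _).
rewrite (reindex_omap (@ind n) (unlift ord_max)) => [|k kd]; last first.
  by have [[i ->]|E] := indP k; [rewrite /ind liftK|rewrite E eqxx in kd].
by apply: eq_bigl => i; rewrite ind_neq_dep/= /ind liftK eqxx.
Qed.

Lemma mon_mext (x : 'rV[R]_n.+1) al : mon x (mext al) = mon (base x) al.
Proof.
rewrite /mon prod_ind mext_dep expr0 mul1r; apply: eq_bigr => i _.
by rewrite mext_ind mxE.
Qed.

Lemma mdeg_mext al : mdeg (mext al) = mdeg al.
Proof.
have := mon_mext (const_mx 2) al; rewrite (_ : base _ = const_mx 2); last first.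
  by apply/rowP => i; rewrite !mxE.
rewrite !mon_const => /(congr1 (fun u => 2 * u)); rewrite -!exprS -!natrX.
by move/eqP; rewrite eqr_nat eqn_exp2l// eqSS => /eqP.
Qed.

(** The same series, with multi-indices padded by exponent 0 in the last variable. *)
Lemma analytic_base (f : 'rV[R]_n -> R) w :
  analytic_at f (base w) -> analytic_at (f \o @base R n) w.
Proof.
move=> /analyticP[r [c [M [r0 cM cf]]]]; apply/analyticP.
pose c' (al : mindex n.+1) := if al (dep n) == 0%N then c (mres al) else 0.
have c'E al : c' (mext al) = c al by rewrite /c' mext_dep eqxx mextK.
have c'0 al : mext (mres al) != al -> c' al = 0.
  by move=> /mext_mres/negbTE h; rewrite /c' h.
exists r, c', M; split=> // [|y yw].
  apply/(absum_reindex mextK) => [al /c'0->|]; first by rewrite mul0r.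
  by apply: absum_le cM => al /=; rewrite c'E mdeg_mext.
apply/(hasum_reindex mextK) => [al /c'0->|]; first by rewrite mul0r.
have yb i : `|base y 0 i - base w 0 i| < r by rewrite !mxE.
apply: eq_hasum (cf _ yb) => al /=; rewrite c'E mon_mext; congr (_ * mon _ _).
by apply/rowP => i; rewrite !mxE.
Qed.

(** The expansion is centred at height [e], so on the slice all terms with a positive last exponent
    vanish. *)
Lemma analytic_slice (f : 'rV[R]_n.+1 -> R) z e :
  analytic_at f (row_ext z e) -> analytic_at (fun z => f (row_ext z e)) z.
Proof.
move=> /analyticP[r [c [M [r0 cM cf]]]]; apply/analyticP.
exists r, (c \o mext), M; split=> // [A|y yz].
  have := cM (mext @` A)%fset; rewrite sum_imfset; last exact: can_inj mextK.
  by under eq_bigr do rewrite mdeg_mext.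
have yd i : `|row_ext y e 0 i - row_ext z e 0 i| < r.
  by have [[j ->]|->] := indP i; rewrite ?row_ext_ind// !row_ext_dep subrr normr0.
move: (cf _ yd) => /(hasum_reindex mextK) h.
apply: eq_hasum (h _) => [al /=|al /mext_mres ad].
  rewrite mon_mext; congr (_ * mon _ _).
  by apply/rowP => i; rewrite !mxE liftK.
rewrite /mon (bigD1 (dep n))//= !mxE unlift_none subrr expr0n (negbTE ad) mul0r.
by rewrite mulr0.
Qed.

End Fibration.

(** Derivative values and matrix entries become variables, leaving [ring] and [lra] a purely
    polynomial problem. *)
Ltac atomize := repeat match goal with
  | |- context [pd ?i ?f ?w] => generalize (pd i f w); intro
  | |- context [fun_of_matrix ?M ?i ?j] => generalize (fun_of_matrix M i j); intro
  end.

Ltac atomize_app f := repeat match goal with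
  | |- context [f ?w] => generalize (f w); intro
  end.

(** * Coordinates [t], [x], [u], [eta], and the linearizations of the two equations *)

Section Coordinates.
Context {R : realType}.

Lemma lineE m n (M N : 'M[R]_(m, n)) (s : R) i j :
  (M + s *: N) i j = M i j + s * N i j.
Proof. by rewrite !mxE. Qed.

Lemma ind2 : (@ind 2 it = it) * (@ind 2 ix = ix) * (dep 2 = iu).
Proof. by split; [split|]; apply: val_inj. Qed.

Lemma ind3 : (@ind 3 it = it) * (@ind 3 ix = ix) * (@ind 3 iu = iu) * (dep 3 = ie).
Proof. by split; [split; [split|]|]; apply: val_inj. Qed.

Lemma sum_I2 (F : 'I_2 -> R) : \sum_k F k = F it + F ix.
Proof.
by rewrite !big_ord_recl big_ord0 addr0; congr (F _ + F _); apply: val_inj.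
Qed.

Lemma sum_I3 (F : 'I_3 -> R) : \sum_k F k = F it + F ix + F iu.
Proof.
rewrite !big_ord_recl big_ord0 addr0 addrA.
by congr (F _ + F _ + F _); apply: val_inj.
Qed.

Lemma sum_I4 (F : 'I_4 -> R) : \sum_k F k = F it + F ix + F iu + F ie.
Proof.
rewrite !big_ord_recl big_ord0 addr0 !addrA.
by congr (F _ + F _ + F _ + F _); apply: val_inj.
Qed.

Lemma I2P (k : 'I_2) : k = it \/ k = ix.
Proof. by case: k => [[|[|//]]] h; [left|right]; apply: val_inj. Qed.

Lemma I3P (k : 'I_3) : [\/ k = it, k = ix | k = iu].
Proof.
by case: k => [[|[|[|//]]]] h; [constructor 1|constructor 2|constructor 3]; apply: val_inj.
Qed.

Lemma I4P (k : 'I_4) : [\/ k = it, k = ix, k = iu | k = ie].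
Proof.
by case: k => [[|[|[|[|//]]]]] h;
  [constructor 1|constructor 2|constructor 3|constructor 4]; apply: val_inj.
Qed.

Lemma base3 (w : 'rV[R]_3) : (base w 0 it = w 0 it) * (base w 0 ix = w 0 ix).
Proof. by rewrite !mxE !ind2. Qed.

Lemma base4 (w : 'rV[R]_4) :
  (base w 0 it = w 0 it) * (base w 0 ix = w 0 ix) * (base w 0 iu = w 0 iu).
Proof. by rewrite !mxE !ind3. Qed.

Lemma pd_base3 (f : 'rV[R]_2 -> R) :
  (pd it (f \o @base R 2) = pd it f \o @base R 2) *
  (pd ix (f \o @base R 2) = pd ix f \o @base R 2) *
  (pd iu (f \o @base R 2) = fun=> 0).
Proof. by rewrite -!ind2 !pd_base pd_base_dep. Qed.

Lemma pd_base4 (f : 'rV[R]_3 -> R) :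
  (pd it (f \o @base R 3) = pd it f \o @base R 3) *
  (pd ix (f \o @base R 3) = pd ix f \o @base R 3) *
  (pd iu (f \o @base R 3) = pd iu f \o @base R 3) *
  (pd ie (f \o @base R 3) = fun=> 0).
Proof.
have := (pd_base f it, pd_base f ix, pd_base f iu, pd_base_dep f).
by rewrite !ind3 => -[[[-> ->] ->] ->].
Qed.

Lemma pd_near n (f g : 'rV[R]_n -> R) w i : (\forall y \near w, f y = g y) ->
  pd i f w = pd i g w.
Proof. by move=> fg; apply: near_eq_derive. Qed.

Lemma pd_eq_on n (D : set 'rV[R]_n) (f g : 'rV[R]_n -> R) w i : open D ->
  (forall y, D y -> f y = g y) -> D w -> pd i f w = pd i g w.
Proof.
move=> Do fg Dw; apply: pd_near; near=> y; apply: fg; near: y.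
exact: open_nbhs_nbhs.
Unshelve. all: by end_near. Qed.

Lemma pd_cst n (k : R) (w : 'rV[R]_n) i : pd i (fun=> k) w = 0.
Proof. exact: derive_cst. Qed.

Lemma pd_eq_cst n (D : set 'rV[R]_n) (f : 'rV[R]_n -> R) k w i : open D ->
  (forall y, D y -> f y = k) -> D w -> pd i f w = 0.
Proof. by move=> Do fk Dw; rewrite (pd_eq_on i Do fk Dw) pd_cst. Qed.

Lemma is_derive_affine (a b : R) : is_derive (0 : R) 1 (fun s : R => a + s * b) b.
Proof.
have h := is_deriveD (is_derive_cst a (0 : R) 1)
  (is_deriveM (is_derive_id (0 : R) 1) (is_derive_cst b (0 : R) 1)).
apply: is_derive_eq h _.
by rewrite scaler0 !add0r -[b *: 1]/(b * 1) mulr1.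
Qed.

Section RulesR.
Variables (f g : R -> R) (df dg : R).

Lemma is_derive_add : is_derive (0 : R) 1 f df -> is_derive (0 : R) 1 g dg ->
  is_derive (0 : R) 1 (fun s => f s + g s) (df + dg).
Proof. by move=> hf hg; exact: (is_deriveD hf hg). Qed.

Lemma is_derive_sub : is_derive (0 : R) 1 f df -> is_derive (0 : R) 1 g dg ->
  is_derive (0 : R) 1 (fun s => f s - g s) (df - dg).
Proof. by move=> hf hg; exact: (is_deriveB hf hg). Qed.

Lemma is_derive_mul : is_derive (0 : R) 1 f df -> is_derive (0 : R) 1 g dg ->
  is_derive (0 : R) 1 (fun s => f s * g s) (f 0 * dg + g 0 * df).
Proof. by move=> hf hg; exact: (is_deriveM hf hg). Qed.

End RulesR.

Section Rules.
Variable n : nat.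
Implicit Types (f g : 'rV[R]_n -> R).

Lemma pdD f g w i : analytic_at f w -> analytic_at g w ->
  pd i (fun y => f y + g y) w = pd i f w + pd i g w.
Proof.
move=> /(analytic_is_derive i)[fd _] /(analytic_is_derive i)[gd _].
exact: deriveD.
Qed.

Lemma pdM f g w i : analytic_at f w -> analytic_at g w ->
  pd i (fun y => f y * g y) w = f w * pd i g w + g w * pd i f w.
Proof.
move=> /(analytic_is_derive i)[fd _] /(analytic_is_derive i)[gd _].
exact: (deriveM fd gd).
Qed.

Lemma pdB f g w i : analytic_at f w -> analytic_at g w ->
  pd i (fun y => f y - g y) w = pd i f w - pd i g w.
Proof.
move=> /(analytic_is_derive i)[fd _] /(analytic_is_derive i)[gd _].
exact: deriveB.
Qed.

Lemma pdZ k f w i : analytic_at f w ->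
  pd i (fun y => k * f y) w = k * pd i f w.
Proof. by move=> /(analytic_is_derive i)[fd _]; exact: deriveZ. Qed.

Lemma analyticN f w : analytic_at f w -> analytic_at (fun y => - f y) w.
Proof.
by move=> /(analyticZ (-1)); apply: analytic_near; near=> y; rewrite mulN1r.
Unshelve. all: by end_near. Qed.

Lemma analyticB f g w : analytic_at f w -> analytic_at g w ->
  analytic_at (fun y => f y - g y) w.
Proof. by move=> fw /analyticN; exact: analyticD. Qed.

Lemma pd_comp m (g : 'rV[R]_m -> 'rV[R]_n) f b i :
  (forall k, analytic_at (coordf g k) b) -> analytic_at f (g b) ->
  pd i (f \o g) b = \sum_k pd i (coordf g k) b * pd k f (g b).
Proof.
move=> gb fb; have := @chain_rule R n _ g f b (delta_mx 0 i)
  (fun k => analytic_differentiable (gb k)) (analytic_differentiable fb).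
by move=> [_].
Qed.

Lemma is_derive_line f w v : analytic_at f w ->
  is_derive (0 : R) 1 (fun s : R => f (w + s *: v)) (\sum_k v 0 k * pd k f w).
Proof.
move=> fw; have lin k : is_derive (0 : R) 1 (fun s : R => (w + s *: v) 0 k) (v 0 k).
  by under eq_fun do rewrite !mxE; exact: is_derive_affine.
have := @chain_rule R n R (fun s : R => w + s *: v) f 0 1.
move=> h; apply: is_derive_eq (h _ _) _; rewrite ?scale0r ?addr0.
- by move=> k; apply/derivable1_diffP; case: (lin k).
- exact: analytic_differentiable.
- by apply: eq_bigr => k _; case: (lin k) => _ ->.
Qed.

End Rules.
Lemma is_derive_base3 (A : 'rV[R]_2 -> R) (w v : 'rV[R]_3) : analytic_at A (base w) ->
  is_derive (0 : R) 1 (fun s : R => A (base (w + s *: v)))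
    (v 0 it * pd it A (base w) + v 0 ix * pd ix A (base w)).
Proof.
move=> Aw; have := is_derive_line (base v) Aw.
rewrite sum_I2 !base3.
rewrite (_ : (fun s : R => A (base (w + s *: v))) = fun s => A (base w + s *: base v))//.
by apply/funext => s; congr A; apply/rowP => i; rewrite !mxE.
Qed.

Lemma derive_eqL A B C (w v : 'rV[R]_3) (p q : 'rV[R]_2) (P Q : 'M[R]_2) :
  analytic_at A (base w) -> analytic_at B (base w) -> analytic_at C (base w) ->
  derive1 (fun s : R => eqL A B C (w + s *: v) (p + s *: q) (P + s *: Q)) 0 =
  q 0 it - ((v 0 it * pd it A (base w) + v 0 ix * pd ix A (base w)) * P ix ix
    + A (base w) * Q ix ix
    + (v 0 it * pd it B (base w) + v 0 ix * pd ix B (base w)) * p 0 ix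
    + B (base w) * q 0 ix
    + (v 0 it * pd it C (base w) + v 0 ix * pd ix C (base w)) * w 0 iu
    + C (base w) * v 0 iu).
Proof.
move=> /(is_derive_base3 v) hA /(is_derive_base3 v) hB /(is_derive_base3 v) hC.
have mulE : (fun s : R => eqL A B C (w + s *: v) (p + s *: q) (P + s *: Q)) =
  (fun s : R => (p 0 it + s * q 0 it) -
   (A (base (w + s *: v)) * (P ix ix + s * Q ix ix) +
    B (base (w + s *: v)) * (p 0 ix + s * q 0 ix) +
    C (base (w + s *: v)) * (w 0 iu + s * v 0 iu))).
  by apply/funext => s; rewrite /eqL !lineE.
rewrite derive1E mulE.
have h := is_derive_sub (is_derive_affine (p 0 it) (q 0 it))
  (is_derive_add (is_derive_add
    (is_derive_mul hA (is_derive_affine (P ix ix) (Q ix ix)))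
    (is_derive_mul hB (is_derive_affine (p 0 ix) (q 0 ix))))
    (is_derive_mul hC (is_derive_affine (w 0 iu) (v 0 iu)))).
case: h => _ ->; rewrite scale0r addr0 !mul0r !addr0.
by atomize; atomize_app A; atomize_app B; atomize_app C; ring.
Qed.

Lemma is_derive_base4 (A : 'rV[R]_2 -> R) (w v : 'rV[R]_4) : analytic_at A (base (base w)) ->
  is_derive (0 : R) 1 (fun s : R => A (base (base (w + s *: v))))
    (v 0 it * pd it A (base (base w)) + v 0 ix * pd ix A (base (base w))).
Proof.
move=> Aw; have := is_derive_base3 (base v) Aw; rewrite !base4.
rewrite (_ : (fun s : R => A (base (base (w + s *: v)))) =
  fun s => A (base (base w + s *: base v)))//.
by apply/funext => s; congr (A (base _)); apply/rowP => i; rewrite !mxE.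
Qed.

Lemma derive_eqDE0 A B C (w v : 'rV[R]_4) (p q : 'rV[R]_3) (P Q : 'M[R]_3) :
  let z := base (base w) in
  let dv f := v 0 it * pd it f z + v 0 ix * pd ix f z in
  let eta := w 0 ie in let u := w 0 iu in let th := v 0 ie in
  analytic_at A z -> analytic_at B z -> analytic_at C z ->
  derive1 (fun s : R => eqDE0 A B C (w + s *: v) (p + s *: q) (P + s *: Q)) 0 =
  q 0 it -
   (dv A * (P ix ix + 2 * eta * P ix iu + eta ^+ 2 * P iu iu)
    + A z * (Q ix ix + 2 * eta * Q ix iu + eta ^+ 2 * Q iu iu
             + 2 * th * (P ix iu + eta * P iu iu))
    + dv (pd ix A) * (p 0 ix + eta * p 0 iu)
    + pd ix A z * (q 0 ix + eta * q 0 iu + th * p 0 iu)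
    + dv (pd ix B) * eta + pd ix B z * th
    + dv B * p 0 ix + B z * q 0 ix
    + dv C * (eta - u * p 0 iu) + C z * (th - v 0 iu * p 0 iu - u * q 0 iu)
    + dv (pd ix C) * u + pd ix C z * v 0 iu).
Proof.
move=> z dv eta u th Az Bz Cz.
have hA := is_derive_base4 v Az; have hB := is_derive_base4 v Bz.
have hC := is_derive_base4 v Cz.
have hAx := is_derive_base4 v (analytic_pd ix Az).
have hBx := is_derive_base4 v (analytic_pd ix Bz).
have hCx := is_derive_base4 v (analytic_pd ix Cz).
(* Everything is regrouped into sums and products of coefficient functions along the line and affine
   functions of [s], to which the rules apply syntactically; the square of [eta] becomes a repeated
   product. *)
have E : (fun s : R => eqDE0 A B C (w + s *: v) (p + s *: q) (P + s *: Q)) =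
  (fun s : R => (p 0 it + s * q 0 it) -
   (A (base (base (w + s *: v))) * ((P ix ix + s * Q ix ix)
      + ((2 * eta + s * (2 * th)) * (P ix iu + s * Q ix iu)
      + (eta + s * th) * ((eta + s * th) * (P iu iu + s * Q iu iu)))) +
    pd ix A (base (base (w + s *: v))) *
      ((p 0 ix + s * q 0 ix) + (eta + s * th) * (p 0 iu + s * q 0 iu)) +
    (pd ix B (base (base (w + s *: v))) * (eta + s * th) +
     B (base (base (w + s *: v))) * (p 0 ix + s * q 0 ix)) +
    C (base (base (w + s *: v))) * ((eta + s * th) -
      (u + s * v 0 iu) * (p 0 iu + s * q 0 iu)) +
    pd ix C (base (base (w + s *: v))) * (u + s * v 0 iu))).
  apply/funext => s; rewrite /eqDE0 !lineE /eta /u /th.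
  by atomize; atomize_app A; atomize_app B; atomize_app C; ring.
rewrite derive1E E.
have aff := is_derive_affine.
have heta := aff eta th; have hu := aff u (v 0 iu).
have h := is_derive_sub (aff (p 0 it) (q 0 it)) (is_derive_add (is_derive_add
  (is_derive_add (is_derive_add
   (is_derive_mul hA (is_derive_add (aff (P ix ix) (Q ix ix))
     (is_derive_add (is_derive_mul (aff (2 * eta) (2 * th)) (aff (P ix iu) (Q ix iu)))
      (is_derive_mul heta (is_derive_mul heta (aff (P iu iu) (Q iu iu)))))))
   (is_derive_mul hAx (is_derive_add (aff (p 0 ix) (q 0 ix))
      (is_derive_mul heta (aff (p 0 iu) (q 0 iu))))))
   (is_derive_add (is_derive_mul hBx heta) (is_derive_mul hB (aff (p 0 ix) (q 0 ix)))))
   (is_derive_mul hC (is_derive_sub heta (is_derive_mul hu (aff (p 0 iu) (q 0 iu))))))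
   (is_derive_mul hCx hu)).
case: h => _ ->; rewrite scale0r addr0 !mul0r !addr0 -/z /dv.
rewrite -/z /eta /u /th.
by atomize; atomize_app A; atomize_app B; atomize_app C; ring.
Qed.

End Coordinates.

(** * Lie symmetry algebras *)

Section LinearEquationLie.
Context {R : realType}.
Variables (Om : set 'rV[R]_2) (A B C : 'rV[R]_2 -> R).
Hypothesis Om_open : open Om.
Hypotheses (A_an : analytic_on Om A) (B_an : analytic_on Om B) (C_an : analytic_on Om C).
Hypothesis A_neq0 : forall z, Om z -> A z != 0.

Lemma open_base n (D : set 'rV[R]_n) : open D -> open (@base R n @^-1` D).
Proof.
move=> Do; rewrite openE => w /= Dw.
have := open_nbhs_nbhs (conj Do Dw) => /nbhs_rowP[r r0 rD].
apply/nbhs_rowP; exists r => // y yw; apply: rD => i; rewrite !mxE.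
exact: yw.
Qed.

Lemma tot1_2 (p : 'rV[R]_2) f w :
  (tot1 p f it w = pd it f w + p 0 it * pd iu f w) *
  (tot1 p f ix w = pd ix f w + p 0 ix * pd iu f w).
Proof. by rewrite /tot1 !ind2. Qed.

Lemma tot2_2 (p : 'rV[R]_2) P f w :
  tot2 p P f ix ix w = pd ix (pd ix f) w + p 0 ix * pd iu (pd ix f) w
  + p 0 ix * pd ix (pd iu f) w + p 0 ix * p 0 ix * pd iu (pd iu f) w
  + P ix ix * pd iu f w.
Proof. by rewrite /tot2 !ind2. Qed.

Lemma vprol_app_eqL V w p P : Om (base w) -> P^T = P ->
  let z := base w in
  let tau := coordf V it in let xi := coordf V ix in let ups := coordf V iu in
  let dv f := V w 0 it * pd it f z + V w 0 ix * pd ix f z in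
  vprol_app V (eqL A B C) w p P =
    tot1 p ups it w - (p 0 it * tot1 p tau it w + p 0 ix * tot1 p xi it w)
    - (dv A * P ix ix
       + A z * (tot2 p P ups ix ix w
                - (p 0 it * tot2 p P tau ix ix w + p 0 ix * tot2 p P xi ix ix w
                   + 2 * (P ix it * tot1 p tau ix w + P ix ix * tot1 p xi ix w)))
       + dv B * p 0 ix
       + B z * (tot1 p ups ix w - (p 0 it * tot1 p tau ix w + p 0 ix * tot1 p xi ix w))
       + dv C * w 0 iu + C z * V w 0 iu).
Proof.
move=> zOm Psym z tau xi ups dv.
rewrite /vprol_app derive_eqL; [|exact: A_an|exact: B_an|exact: C_an].
rewrite ![vprol1 _ _ _ _ _]mxE [vprol2 _ _ _ _ _ _]mxE !sum_I2 !ind2 -/z -/tau -/xi -/ups /dv.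
by atomize_app A; atomize_app B; atomize_app C; atomize;
  atomize_app (tot1 p ups); ring.
Qed.

(** Test jets: in [jet2_2 b c], [b] is [u_xx] and [c] is [u_tx]; [u_tt] is set to 0, as it occurs
    neither in the equation nor in the invariance condition. *)
Definition jet1_2 (a b : R) : 'rV[R]_2 := \row_i [:: a; b]`_i.
Definition jet2_2 (b c : R) : 'M[R]_2 :=
  \matrix_(i, j) nth 0 (nth [::] [:: [:: 0; c]; [:: c; b]] i) j.

Lemma jet1_2E a b : (jet1_2 a b 0 it = a) * (jet1_2 a b 0 ix = b).
Proof. by rewrite !mxE. Qed.

Lemma jet2_2E b c : (jet2_2 b c ix ix = b) * (jet2_2 b c ix it = c).
Proof. by rewrite !mxE. Qed.

Lemma jet2_2_sym b c : (jet2_2 b c)^T = jet2_2 b c.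
Proof. by apply/matrixP => i j; rewrite !mxE; case: (I2P i) => ->; case: (I2P j) => ->. Qed.

(** Once [tau_x], [tau_u], [xi_u] and the second [u]-derivative of the [u]-component vanish, the
    invariance condition modulo the equation is [lie_e2 + u_x lie_e1 + u_xx lie_e0]. *)
Definition lie_e0 (V : vfield R 3) w :=
  let z := base w in
  2 * A z * pd ix (coordf V ix) w - A z * pd it (coordf V it) w
  - (V w 0 it * pd it A z + V w 0 ix * pd ix A z).

Definition lie_e1 (V : vfield R 3) w :=
  let z := base w in
  B z * (pd ix (coordf V ix) w - pd it (coordf V it) w) - pd it (coordf V ix) w
  - 2 * A z * pd ix (pd iu (coordf V iu)) w + A z * pd ix (pd ix (coordf V ix)) w
  - (V w 0 it * pd it B z + V w 0 ix * pd ix B z).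

Definition lie_e2 (V : vfield R 3) w :=
  let z := base w in let u := w 0 iu in
  pd it (coordf V iu) w + C z * u * (pd iu (coordf V iu) w - pd it (coordf V it) w)
  - A z * pd ix (pd ix (coordf V iu)) w
  - (V w 0 it * pd it C z + V w 0 ix * pd ix C z) * u
  - B z * pd ix (coordf V iu) w - C z * V w 0 iu.

Definition lie_struct (D : set 'rV[R]_3) (V : vfield R 3) := forall w, D w ->
  [/\ pd ix (coordf V it) w = 0 /\ pd iu (coordf V it) w = 0,
      pd iu (coordf V ix) w = 0, pd iu (pd iu (coordf V iu)) w = 0
    & [/\ lie_e0 V w = 0, lie_e1 V w = 0 & lie_e2 V w = 0]].

Section Domain.
Variable D : set 'rV[R]_3.
Hypotheses (D_open : open D) (D_Om : forall w, D w -> Om (base w)).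

Lemma lie_algebra_struct V : lie_algebra (eqL A B C) D V -> lie_struct D V.
Proof.
move=> [Van Vinv].
have H w a b c : D w -> let pt := A (base w) * b + B (base w) * a + C (base w) * w 0 iu in
    vprol_app V (eqL A B C) w (jet1_2 pt a) (jet2_2 b c) = 0.
  move=> Dw pt; apply: Vinv; rewrite ?jet2_2_sym//.
  by rewrite /eqL !jet1_2E jet2_2E subrr.
have H' w a b c (Dw : D w) := etrans (esym (vprol_app_eqL V _ (D_Om Dw) (jet2_2_sym b c))) (H w a b c Dw).
(* Changing only [u_tx] leaves the equation satisfied, so its coefficient [2 A D_x tau] vanishes;
   then [a = u_x] is varied. *)
have tau0 w a : D w -> pd ix (coordf V it) w + a * pd iu (coordf V it) w = 0.
  move=> Dw; have A0 : A (base w) != 0 by apply/A_neq0/D_Om.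
  have h1 := H' w a 0 1 Dw; have h0 := H' w a 0 0 Dw.
  move: h1 h0; rewrite /= !tot2_2 !tot1_2 !jet1_2E !jet2_2E.
  move: (A (base w)) A0 => Aw A0; atomize; atomize_app B; atomize_app C => h1 h0.
  apply: (mulfI A0); lra.
have tx w : D w -> pd ix (coordf V it) w = 0 by move=> /(tau0 w 0); rewrite mul0r addr0.
have tu w : D w -> pd iu (coordf V it) w = 0.
  by move=> Dw; have := tau0 w 1 Dw; rewrite tx// add0r mul1r.
(* The mixed second difference over [u_x], [u_xx] in {0, 1} isolates the coefficient [2 A xi_u] of
   [u_x u_xx]. *)
have xu w : D w -> pd iu (coordf V ix) w = 0.
  move=> Dw; have A0 : A (base w) != 0 by apply/A_neq0/D_Om.
  have h11 := H' w 1 1 0 Dw; have h10 := H' w 1 0 0 Dw.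
  have h01 := H' w 0 1 0 Dw; have h00 := H' w 0 0 0 Dw.
  move: h11 h10 h01 h00; rewrite /= !tot2_2 !tot1_2 !jet1_2E !jet2_2E.
  move: (tx w Dw) (tu w Dw) (pd_eq_cst ix D_open tx Dw) (pd_eq_cst iu D_open tx Dw)
    (pd_eq_cst ix D_open tu Dw) (pd_eq_cst iu D_open tu Dw).
  move: (A (base w)) A0 => Aw A0; atomize; atomize_app B; atomize_app C.
  move=> -> -> -> -> -> -> h11 h10 h01 h00; apply: (mulfI A0); lra.
move=> w Dw; have A0 : A (base w) != 0 by apply/A_neq0/D_Om.
split; [by split; [exact: tx|exact: tu]|exact: xu| |].
  (* The second difference in [u_x] at 1, 0, -1 leaves only the second [u]-derivative of the
     [u]-component, times [A]. *)
  have := (H' w 1 0 0 Dw, H' w (-1) 0 0 Dw, H' w 0 0 0 Dw).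
  rewrite /= !tot2_2 !tot1_2 !jet1_2E !jet2_2E.
  move: (tx w Dw) (tu w Dw) (pd_eq_cst ix D_open tx Dw) (pd_eq_cst iu D_open tx Dw)
    (pd_eq_cst ix D_open tu Dw) (pd_eq_cst iu D_open tu Dw)
    (xu w Dw) (pd_eq_cst ix D_open xu Dw) (pd_eq_cst iu D_open xu Dw)
    (pd_comm iu ix (Van ix w Dw)).
  move: (A (base w)) A0 => Aw A0; atomize; atomize_app B; atomize_app C.
  move=> -> -> -> -> -> -> -> -> -> -> [[h1 h2] h3]; apply: (mulfI A0); lra.
have := (H' w 1 0 0 Dw, H' w (-1) 0 0 Dw, H' w 0 1 0 Dw, H' w 0 0 0 Dw).
rewrite /lie_e0 /lie_e1 /lie_e2 /= !tot2_2 !tot1_2 !jet1_2E !jet2_2E.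
move: (tx w Dw) (tu w Dw) (pd_eq_cst ix D_open tx Dw) (pd_eq_cst iu D_open tx Dw)
  (pd_eq_cst ix D_open tu Dw) (pd_eq_cst iu D_open tu Dw)
  (xu w Dw) (pd_eq_cst ix D_open xu Dw) (pd_eq_cst iu D_open xu Dw)
  (pd_comm iu ix (Van ix w Dw)) (pd_comm iu ix (Van iu w Dw)).
move: (A (base w)) A0 => Aw A0; atomize; atomize_app B; atomize_app C.
move=> -> -> -> -> -> -> -> -> -> -> -> [[[h1 h2] h3] h4].
by split; lra.
Qed.

Lemma struct_lie_algebra V : analytic_map_on D V -> lie_struct D V ->
  lie_algebra (eqL A B C) D V.
Proof.
move=> Van Vs; split=> // w p P Dw Ps.
rewrite (vprol_app_eqL V p (D_Om Dw) Ps) /= /eqL.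
have tx y : D y -> pd ix (coordf V it) y = 0 by move=> /Vs[[]].
have tu y : D y -> pd iu (coordf V it) y = 0 by move=> /Vs[[]].
have xu y : D y -> pd iu (coordf V ix) y = 0 by move=> /Vs[].
have [_ _ + [+ + +]] := Vs w Dw.
rewrite /lie_e0 /lie_e1 /lie_e2 /= !tot2_2 !tot1_2.
move: (tx w Dw) (tu w Dw) (pd_eq_cst ix D_open tx Dw) (pd_eq_cst iu D_open tx Dw)
  (pd_eq_cst ix D_open tu Dw) (pd_eq_cst iu D_open tu Dw)
  (xu w Dw) (pd_eq_cst ix D_open xu Dw) (pd_eq_cst iu D_open xu Dw)
  (pd_comm iu ix (Van ix w Dw)) (pd_comm iu ix (Van iu w Dw)).
move: (p 0 it) (p 0 ix) (P ix ix) => pt a b.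
atomize_app A; atomize_app B; atomize_app C; atomize.
move=> -> -> -> -> -> -> -> -> -> -> -> -> e0 e1 e2 /subr0_eq ->.
match type of e0 with ?t0 = 0 => match type of e1 with ?t1 = 0 =>
match type of e2 with ?t2 = 0 => transitivity (t2 + a * t1 + b * t0) end end end.
  by ring.
by rewrite e0 e1 e2 !mulr0 !addr0.
Qed.

End Domain.
End LinearEquationLie.

(** * Differentiation of identities, and functions affine in the last coordinate *)

Section DerivativeCalculus.
Context {R : realType}.
Variable n : nat.
Implicit Types (f g : 'rV[R]_n -> R).

(* [ider f w i d] is solved for [d] by the rules below. *)
Definition ider f (w : 'rV[R]_n) i d := analytic_at f w /\ pd i f w = d.

Lemma iderD f g w i d e : ider f w i d -> ider g w i e ->
  ider (fun y => f y + g y) w i (d + e).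
Proof. by move=> [fw <-] [gw <-]; split; [exact: analyticD|exact: pdD]. Qed.

Lemma iderB f g w i d e : ider f w i d -> ider g w i e ->
  ider (fun y => f y - g y) w i (d - e).
Proof. by move=> [fw <-] [gw <-]; split; [exact: analyticB|exact: pdB]. Qed.

Lemma iderM f g w i d e : ider f w i d -> ider g w i e ->
  ider (fun y => f y * g y) w i (f w * e + g w * d).
Proof. by move=> [fw <-] [gw <-]; split; [exact: analyticM|exact: pdM]. Qed.

Lemma iderC k w i : ider (fun=> k) w i 0.
Proof. by split; [exact: analytic_cst|exact: pd_cst]. Qed.

Lemma ider_coord k w i : ider (fun y => y 0 k) w i (i == k)%:R.
Proof. by split; [exact: analytic_coord|exact: pd_coord]. Qed.

Lemma ider_fun f w i : analytic_at f w -> ider f w i (pd i f w).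
Proof. by []. Qed.

(** Meant for an unknown [d]: solving the [ider] premise by the rules computes the differentiated
    identity. *)
Lemma ider_zero (D : set 'rV[R]_n) f w i d : open D -> (forall y, D y -> f y = 0) ->
  D w -> ider f w i d -> d = 0.
Proof. by move=> Do f0 Dw [_ <-]; exact: pd_eq_cst Do f0 Dw. Qed.

End DerivativeCalculus.

Section AffineLift.
Context {R : realType}.
Variable n : nat.
Variables (D : set 'rV[R]_n) (D' : set 'rV[R]_n.+1).
Implicit Types (f g : 'rV[R]_n -> R).
Hypotheses (D_open : open D) (D'_open : open D') (D'D : forall w, D' w -> D (base w)).

Definition afl (a b : 'rV[R]_n -> R) (w : 'rV[R]_n.+1) :=
  a (base w) + w 0 (dep n) * b (base w).

Lemma analytic_onB f g : analytic_on D f -> analytic_on D g ->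
  analytic_on D (fun y => f y - g y).
Proof. by move=> fD gD w Dw; apply: analyticB; [exact: fD|exact: gD]. Qed.

Lemma analytic_on_pd f i : analytic_on D f -> analytic_on D (pd i f).
Proof. by move=> fD w Dw; apply: analytic_pd; exact: fD. Qed.

Lemma analytic_on_base f : analytic_on D f -> analytic_on D' (f \o @base R n).
Proof. by move=> fD w D'w; apply: analytic_base; exact/fD/D'D. Qed.

Lemma analytic_on_afl a b : analytic_on D a -> analytic_on D b -> analytic_on D' (afl a b).
Proof.
move=> /analytic_on_base aD /analytic_on_base bD w D'w.
by apply: analyticD (aD w D'w) (analyticM (analytic_coord (dep n) w) (bD w D'w)).
Qed.

Lemma pd_afl a b w i : analytic_on D a -> analytic_on D b -> D' w ->
  pd (ind i) (afl a b) w = afl (pd i a) (pd i b) w.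
Proof.
move=> /analytic_on_base aD /analytic_on_base bD D'w.
have [_ ->] := iderD (ider_fun (ind i) (aD w D'w))
  (iderM (ider_coord (dep n) w (ind i)) (ider_fun (ind i) (bD w D'w))).
by rewrite !pd_base ind_neq_dep mulr0 addr0.
Qed.

Lemma pd_afl_dep a b w : analytic_on D a -> analytic_on D b -> D' w ->
  pd (dep n) (afl a b) w = b (base w).
Proof.
move=> /analytic_on_base aD /analytic_on_base bD D'w.
have [_ ->] := iderD (ider_fun (dep n) (aD w D'w))
  (iderM (ider_coord (dep n) w (dep n)) (ider_fun (dep n) (bD w D'w))).
by rewrite !pd_base_dep eqxx mulr0 mulr1 !add0r.
Qed.

Lemma pd2_afl a b w i j : analytic_on D a -> analytic_on D b -> D' w ->
  (pd (ind j) (pd (ind i) (afl a b)) w = afl (pd j (pd i a)) (pd j (pd i b)) w) *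
  (pd (dep n) (pd (ind i) (afl a b)) w = pd i b (base w)) *
  (pd (ind i) (pd (dep n) (afl a b)) w = pd i b (base w)) *
  (pd (dep n) (pd (dep n) (afl a b)) w = 0).
Proof.
move=> aD bD D'w.
have E y : D' y -> pd (ind i) (afl a b) y = afl (pd i a) (pd i b) y by exact: pd_afl.
have F y : D' y -> pd (dep n) (afl a b) y = (b \o @base R n) y by exact: pd_afl_dep.
rewrite (pd_eq_on (ind j) D'_open E D'w) (pd_eq_on (dep n) D'_open E D'w).
rewrite (pd_eq_on (ind i) D'_open F D'w) (pd_eq_on (dep n) D'_open F D'w).
rewrite pd_base pd_base_dep pd_afl ?pd_afl_dep//; exact: analytic_on_pd.
Qed.

End AffineLift.

Section ReductionEquation.
Context {R : realType}.

Lemma tot1_3 (p : 'rV[R]_3) f w :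
  (tot1 p f it w = pd it f w + p 0 it * pd ie f w) *
  (tot1 p f ix w = pd ix f w + p 0 ix * pd ie f w) *
  (tot1 p f iu w = pd iu f w + p 0 iu * pd ie f w).
Proof. by rewrite /tot1 !ind3. Qed.

Lemma tot2_3 (p : 'rV[R]_3) P f w :
  (tot2 p P f ix ix w = pd ix (pd ix f) w + p 0 ix * pd ie (pd ix f) w
    + p 0 ix * pd ix (pd ie f) w + p 0 ix * p 0 ix * pd ie (pd ie f) w
    + P ix ix * pd ie f w) *
  (tot2 p P f ix iu w = pd ix (pd iu f) w + p 0 ix * pd ie (pd iu f) w
    + p 0 iu * pd ix (pd ie f) w + p 0 ix * p 0 iu * pd ie (pd ie f) w
    + P ix iu * pd ie f w) *
  (tot2 p P f iu iu w = pd iu (pd iu f) w + p 0 iu * pd ie (pd iu f) w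
    + p 0 iu * pd iu (pd ie f) w + p 0 iu * p 0 iu * pd ie (pd ie f) w
    + P iu iu * pd ie f w).
Proof. by rewrite /tot2 !ind3. Qed.

Lemma vprol1_3 (V : vfield R 4) w p i :
  vprol1 V w p 0 i = tot1 p (coordf V ie) i w
    - (p 0 it * tot1 p (coordf V it) i w + p 0 ix * tot1 p (coordf V ix) i w
       + p 0 iu * tot1 p (coordf V iu) i w).
Proof. by rewrite mxE sum_I3 !ind3. Qed.

Lemma vprol2_3 (V : vfield R 4) w p P i j :
  vprol2 V w p P i j = tot2 p P (coordf V ie) i j w
    - (p 0 it * tot2 p P (coordf V it) i j w + P i it * tot1 p (coordf V it) j w
        + P j it * tot1 p (coordf V it) i w
       + (p 0 ix * tot2 p P (coordf V ix) i j w + P i ix * tot1 p (coordf V ix) j w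
        + P j ix * tot1 p (coordf V ix) i w)
       + (p 0 iu * tot2 p P (coordf V iu) i j w + P i iu * tot1 p (coordf V iu) j w
        + P j iu * tot1 p (coordf V iu) i w)).
Proof. by rewrite mxE sum_I3 !ind3. Qed.

(* The prolongation to [eta = u_x]: the coefficient at [eta] is
   [D_x zeta - u_x D_x xi], for fields with [xi_u = 0]. *)
Definition lift_field (V : vfield R 3) : vfield R 4 := fun w =>
  row_ext (V (base w))
    (afl (pd ix (coordf V iu))
         (fun y => pd iu (coordf V iu) y - pd ix (coordf V ix) y) w).

Lemma coordf_lift V :
  (coordf (lift_field V) it = coordf V it \o @base R 3) *
  (coordf (lift_field V) ix = coordf V ix \o @base R 3) *
  (coordf (lift_field V) iu = coordf V iu \o @base R 3) *
  (coordf (lift_field V) ie = afl (pd ix (coordf V iu))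
         (fun y => pd iu (coordf V iu) y - pd ix (coordf V ix) y)).
Proof.
have E i : coordf (lift_field V) (ind i) = coordf V i \o @base R 3.
  by apply/funext => w; rewrite /coordf row_ext_ind.
have := (E it, E ix, E iu); rewrite !ind3 => -[[-> ->] ->]; split=> //.
by apply/funext => w; rewrite -ind3 /coordf row_ext_dep.
Qed.

End ReductionEquation.

(** Consumes, after [atomize], the leading equations that give a variable its value; equations on
    compound terms are left in the goal. *)
Ltac subst_facts := repeat match goal with
  | |- ?x = _ -> _ => is_var x; let E := fresh in intro E; try rewrite E; clear E
  | |- 0 = ?x -> _ => first [is_var x; let E := fresh in intro E; try rewrite -E; clear E
                            | let E := fresh in intro E; clear E]
  end.

(** * Lifted fields are symmetries of the reduction equation *)

Section LiftAlgebra.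
Context {R : realType}.
Variables (Om : set 'rV[R]_2) (A B C : 'rV[R]_2 -> R).
Hypotheses (A_an : analytic_on Om A) (B_an : analytic_on Om B) (C_an : analytic_on Om C).
Variables (D : set 'rV[R]_3) (D' : set 'rV[R]_4).
Hypotheses (D_open : open D) (D'_open : open D') (D'D : forall w, D' w -> D (base w)).
Hypothesis D_Om : forall w, D w -> Om (base w).

Lemma ider_base (f : 'rV[R]_2 -> R) (w : 'rV[R]_3) : analytic_at f (base w) ->
  (ider (fun y : 'rV[R]_3 => f (base y)) w it (pd it f (base w)) *
   ider (fun y : 'rV[R]_3 => f (base y)) w ix (pd ix f (base w)) *
   ider (fun y : 'rV[R]_3 => f (base y)) w iu 0)%type.
Proof.
move=> fw; have h := analytic_base fw; have E := pd_base3 f.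
split; [split|]; split; try exact: h.
- exact: (congr1 (fun g => g w) E.1.1).
- exact: (congr1 (fun g => g w) E.1.2).
- exact: (congr1 (fun g => g w) E.2).
Qed.

Lemma analytic_lift V : analytic_map_on D V -> analytic_map_on D' (lift_field V).
Proof.
move=> Van k; case: (I4P k) => ->; rewrite coordf_lift.
- by move=> y Dy; apply: analytic_base; exact/Van/D'D.
- by move=> y Dy; apply: analytic_base; exact/Van/D'D.
- by move=> y Dy; apply: analytic_base; exact/Van/D'D.
- by apply: (analytic_on_afl D'D); [|apply: analytic_onB]; apply: analytic_on_pd; exact: Van.
Qed.

Variable V : vfield R 3.
Hypotheses (Van : analytic_map_on D V) (Vs : lie_struct A B C D V).
Variable w : 'rV[R]_3.
Hypothesis Dw : D w.

Lemma ider_V k i : ider (fun y => V y 0 k) w i (pd i (coordf V k) w).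
Proof. exact: ider_fun (Van k Dw). Qed.

Lemma ider_pdV k j i : ider (pd j (coordf V k)) w i (pd i (pd j (coordf V k)) w).
Proof. exact: ider_fun (analytic_pd _ (Van k Dw)). Qed.

Lemma ider_pd2V k j l i : ider (pd l (pd j (coordf V k))) w i (pd i (pd l (pd j (coordf V k))) w).
Proof. exact: ider_fun (analytic_pd _ (analytic_pd _ (Van k Dw))). Qed.

Let zOm := D_Om Dw.

Definition ider_A := ider_base (A_an zOm).
Definition ider_B := ider_base (B_an zOm).
Definition ider_C := ider_base (C_an zOm).
Definition ider_pdA i := ider_base (analytic_pd i (A_an zOm)).
Definition ider_pdB i := ider_base (analytic_pd i (B_an zOm)).
Definition ider_pdC i := ider_base (analytic_pd i (C_an zOm)).

Ltac pick h := match goal with |- ider _ _ ?i _ =>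
  lazymatch i with it => refine h.1.1 | ix => refine h.1.2 | iu => refine h.2 end end.

Ltac prove_ider := repeat lazymatch goal with
  | |- ider (fun y => @Algebra.add _ (@?f y) (@Algebra.opp _ (@?g y))) _ _ _ =>
      refine (@iderB _ _ f g _ _ _ _ _ _)
  | |- ider (fun y => @Algebra.add _ (@?f y) (@?g y)) _ _ _ =>
      refine (@iderD _ _ f g _ _ _ _ _ _)
  | |- ider (fun y => @GRing.mul _ (@?f y) (@?g y)) _ _ _ =>
      refine (@iderM _ _ f g _ _ _ _ _ _)
  | |- ider (fun y => fun_of_matrix (V y) _ ?k) _ ?i _ => refine (ider_V k i)
  | |- ider (fun y => fun_of_matrix y _ ?k) _ ?i _ => refine (ider_coord k w i)
  | |- ider (fun y => pd ?l (pd ?j (coordf V ?k)) y) _ ?i _ => refine (ider_pd2V k j l i)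
  | |- ider (fun y => pd ?j (coordf V ?k) y) _ ?i _ => refine (ider_pdV k j i)
  | |- ider (fun y => A (base y)) _ _ _ => pick ider_A
  | |- ider (fun y => B (base y)) _ _ _ => pick ider_B
  | |- ider (fun y => C (base y)) _ _ _ => pick ider_C
  | |- ider (fun y => pd ?l A (base y)) _ _ _ => pick (ider_pdA l)
  | |- ider (fun y => pd ?l B (base y)) _ _ _ => pick (ider_pdB l)
  | |- ider (fun y => pd ?l C (base y)) _ _ _ => pick (ider_pdC l)
  | |- ider (fun y => ?k) _ ?i _ => refine (iderC k w i)
  end.

Local Opaque pd.

Lemma pd_lift_base (f : 'rV[R]_3 -> R) (y : 'rV[R]_4) : base y = w ->
  let g := f \o @base R 3 in
  (g y = f w) *
  (pd it g y = pd it f w) * (pd ix g y = pd ix f w) * (pd iu g y = pd iu f w) *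
  (pd ie g y = 0) *
  (pd ix (pd ix g) y = pd ix (pd ix f) w) * (pd ix (pd iu g) y = pd ix (pd iu f) w) *
  (pd iu (pd iu g) y = pd iu (pd iu f) w) *
  (pd ie (pd ix g) y = 0) * (pd ie (pd iu g) y = 0) * (pd ie (pd ie g) y = 0) *
  (pd ix (pd ie g) y = 0) * (pd iu (pd ie g) y = 0).
Proof. by move=> E; cbv zeta; rewrite !pd_base4 !pd_cst /= E. Qed.

Lemma pd_lift_afl (a b : 'rV[R]_3 -> R) (y : 'rV[R]_4) :
  analytic_on D a -> analytic_on D b -> D' y -> base y = w ->
  let g := afl a b in let eta := y 0 ie in
  (g y = a w + eta * b w) *
  (pd it g y = pd it a w + eta * pd it b w) *
  (pd ix g y = pd ix a w + eta * pd ix b w) *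
  (pd iu g y = pd iu a w + eta * pd iu b w) * (pd ie g y = b w) *
  (pd ix (pd ix g) y = pd ix (pd ix a) w + eta * pd ix (pd ix b) w) *
  (pd ix (pd iu g) y = pd ix (pd iu a) w + eta * pd ix (pd iu b) w) *
  (pd iu (pd iu g) y = pd iu (pd iu a) w + eta * pd iu (pd iu b) w) *
  (pd ie (pd ix g) y = pd ix b w) * (pd ie (pd iu g) y = pd iu b w) *
  (pd ie (pd ie g) y = 0) *
  (pd ix (pd ie g) y = pd ix b w) * (pd iu (pd ie g) y = pd iu b w).
Proof.
move=> aD bD D'y E; cbv zeta.
have [[[e1 e2] e3] e4] := ind3.
have aE u v : afl u v y = u w + y 0 ie * v w by rewrite /afl E e4.
have h1 i j : ind i = j -> pd j (afl a b) y = pd i a w + y 0 ie * pd i b w.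
  by move=> <-; rewrite (pd_afl D'D i aD bD D'y) aE.
have h2 i j i' j' : ind i = i' -> ind j = j' -> pd j' (pd i' (afl a b)) y =
    pd j (pd i a) w + y 0 ie * pd j (pd i b) w.
  by move=> <- <-; rewrite (pd2_afl D'_open D'D i j aD bD D'y).1.1.1 aE.
have h3 i i' : ind i = i' -> pd ie (pd i' (afl a b)) y = pd i b w.
  by move=> <-; rewrite -e4 (pd2_afl D'_open D'D i i aD bD D'y).1.1.2 E.
have h4 i i' : ind i = i' -> pd i' (pd ie (afl a b)) y = pd i b w.
  by move=> <-; rewrite -e4 (pd2_afl D'_open D'D i i aD bD D'y).1.2 E.
have h5 : pd ie (pd ie (afl a b)) y = 0.
  by rewrite -e4 (pd2_afl D'_open D'D it it aD bD D'y).2.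
have h6 : pd ie (afl a b) y = b w by rewrite -e4 (pd_afl_dep D'D aD bD D'y) E.
exact: (aE a b, h1 _ _ e1, h1 _ _ e2, h1 _ _ e3, h6, h2 _ _ _ _ e2 e2, h2 _ _ _ _ e3 e2,
  h2 _ _ _ _ e3 e3, h3 _ _ e2, h3 _ _ e3, h5, h4 _ _ e2, h4 _ _ e3).
Qed.

Lemma lift_invariant (y : 'rV[R]_4) p P : D' y -> base y = w -> P^T = P ->
  eqDE0 A B C y p P = 0 -> vprol_app (lift_field V) (eqDE0 A B C) y p P = 0.
Proof.
move=> D'y yw Psym.
have tx x : D x -> pd ix (coordf V it) x = 0 by move=> /Vs[[]].
have tu x : D x -> pd iu (coordf V it) x = 0 by move=> /Vs[[]].
have xu x : D x -> pd iu (coordf V ix) x = 0 by move=> /Vs[].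
have uu x : D x -> pd iu (pd iu (coordf V iu)) x = 0 by move=> /Vs[].
have e0 x : D x -> lie_e0 A V x = 0 by move=> /Vs[_ _ _ []].
have e1 x : D x -> lie_e1 A B V x = 0 by move=> /Vs[_ _ _ []].
have e2 x : D x -> lie_e2 A B C V x = 0 by move=> /Vs[_ _ _ []].
(* The left-hand side is left open; [prove_ider] follows the syntax of the determining equation and
   fills in its derivative. *)
eassert (e0x : _ = 0 :> R).
  apply: (ider_zero (i := ix) D_open e0 Dw); rewrite /lie_e0; cbv zeta; prove_ider.
eassert (e1x : _ = 0 :> R).
  apply: (ider_zero (i := ix) D_open e1 Dw); rewrite /lie_e1; cbv zeta; prove_ider.
eassert (e2x : _ = 0 :> R).
  apply: (ider_zero (i := ix) D_open e2 Dw); rewrite /lie_e2; cbv zeta; prove_ider.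
eassert (e2u : _ = 0 :> R).
  apply: (ider_zero (i := iu) D_open e2 Dw); rewrite /lie_e2; cbv zeta; prove_ider.
have e0w := e0 w Dw; have e1w := e1 w Dw; have e2w := e2 w Dw.
rewrite /lie_e0 /lie_e1 /lie_e2 in e0w e1w e2w.
have [ix_iu iu_iu] : (ix == iu :> 'I_3)%:R = 0 :> R /\ (iu == iu :> 'I_3)%:R = 1 :> R by [].
rewrite ix_iu iu_iu in e2x e2u.
have Vt : V w 0 it = coordf V it w by []. have Vx : V w 0 ix = coordf V ix w by [].
have Vu : V w 0 iu = coordf V iu w by [].
rewrite {}Vt {}Vx {}Vu in e0w e1w e2w e0x e1x e2x e2u.
have Tan := Van it; have Xan := Van ix; have Uan := Van iu.
have UxD := analytic_on_pd ix Uan; have UuD := analytic_on_pd iu Uan.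
have XxD := analytic_on_pd ix Xan.
have bD := analytic_onB UuD XxD.
have LT := pd_lift_base (coordf V it) yw.
have LX := pd_lift_base (coordf V ix) yw.
have LU := pd_lift_base (coordf V iu) yw.
have LH := pd_lift_afl UxD bD D'y yw.
have b1 i : pd i (fun x => pd iu (coordf V iu) x - pd ix (coordf V ix) x) w =
    pd i (pd iu (coordf V iu)) w - pd i (pd ix (coordf V ix)) w.
  by apply: pdB; [exact: UuD|exact: XxD].
have b2 i j : pd j (pd i (fun x => pd iu (coordf V iu) x - pd ix (coordf V ix) x)) w =
    pd j (pd i (pd iu (coordf V iu))) w - pd j (pd i (pd ix (coordf V ix))) w.
  rewrite -pdB; [|exact: analytic_on_pd Dw|exact: analytic_on_pd Dw].
  by apply: (pd_eq_on _ D_open) Dw => x Dx; apply: pdB; [exact: UuD|exact: XxD].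
have c3 f i j k : analytic_on D f -> pd k (pd i (pd j f)) w = pd k (pd j (pd i f)) w.
  by move=> fD; apply: (pd_eq_on _ D_open) Dw => x Dx; exact/pd_comm/fD.
(* In this and the next two facts the [u]-derivatives are moved innermost, where they meet a
   function that vanishes on all of [D]. *)
have uxu : pd iu (pd iu (pd ix (coordf V iu))) w = 0.
  rewrite (c3 _ iu ix iu Uan) (pd_comm iu ix (UuD w Dw)).
  exact: pd_eq_cst D_open uu Dw.
have xxu : pd iu (pd iu (pd ix (coordf V ix))) w = 0.
  rewrite (c3 _ iu ix iu Xan) (pd_comm iu ix (analytic_on_pd iu Xan Dw)).
  by apply: (pd_eq_cst (k := 0) _ D_open) Dw => x Dx; exact: pd_eq_cst D_open xu Dx.
have xxxu : pd ix (pd iu (pd ix (coordf V ix))) w = 0.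
  rewrite (c3 _ iu ix ix Xan).
  by apply: (pd_eq_cst (k := 0) _ D_open) Dw => x Dx; exact: pd_eq_cst D_open xu Dx.
rewrite /vprol_app derive_eqDE0; 
  [|by rewrite yw; exact: A_an|by rewrite yw; exact: B_an|by rewrite yw; exact: C_an].
rewrite /eqDE0 yw !vprol1_3 !vprol2_3 !tot1_3 !tot2_3.
have lt : lift_field V y 0 it = coordf V it w by rewrite -LT -coordf_lift.
have lx : lift_field V y 0 ix = coordf V ix w by rewrite -LX -coordf_lift.
have lu : lift_field V y 0 iu = coordf V iu w by rewrite -LU -coordf_lift.
cbv zeta in LT, LX, LU, LH.
have lh := etrans (congr1 (fun g => g y) (coordf_lift V).2) LH.1.1.1.1.1.1.1.1.1.1.1.1.
rewrite {1}/coordf in lh.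
rewrite lt lx lu lh !coordf_lift.
move: e0w e1w e2w e0x e1x e2x e2u.
move: (tx w Dw) (tu w Dw) (pd_eq_cst ix D_open tx Dw) (pd_eq_cst iu D_open tx Dw)
  (pd_eq_cst ix D_open tu Dw) (pd_eq_cst iu D_open tu Dw)
  (pd_comm ix it (Tan w Dw)) (pd_comm iu it (Tan w Dw))
  (pd_eq_cst it D_open tx Dw) (pd_eq_cst it D_open tu Dw).
have [[[[[[[[[[[[_ t1] t2] t3] t4] t5] t6] t7] t8] t9] t10] t11] t12] := LT;
  move: t1 t2 t3 t4 t5 t6 t7 t8 t9 t10 t11 t12.
have [[[[[[[[[[[[_ t1] t2] t3] t4] t5] t6] t7] t8] t9] t10] t11] t12] := LX;
  move: t1 t2 t3 t4 t5 t6 t7 t8 t9 t10 t11 t12.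
have [[[[[[[[[[[[_ t1] t2] t3] t4] t5] t6] t7] t8] t9] t10] t11] t12] := LU;
  move: t1 t2 t3 t4 t5 t6 t7 t8 t9 t10 t11 t12.
have [[[[[[[[[[[[_ t1] t2] t3] t4] t5] t6] t7] t8] t9] t10] t11] t12] := LH;
  move: t1 t2 t3 t4 t5 t6 t7 t8 t9 t10 t11 t12.
move: (xu w Dw) (pd_eq_cst it D_open xu Dw) (pd_eq_cst ix D_open xu Dw)
  (pd_eq_cst iu D_open xu Dw) (pd_comm iu ix (Xan w Dw)) (pd_comm iu it (Xan w Dw))
  (pd_comm it ix (Xan w Dw)) xxu xxxu
  (uu w Dw) (pd_eq_cst ix D_open uu Dw) (pd_eq_cst iu D_open uu Dw)
  (pd_comm iu ix (Uan w Dw)) (pd_comm iu it (Uan w Dw)) (pd_comm it ix (Uan w Dw))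
  uxu (c3 _ iu ix ix Uan) (pd_comm iu ix (UxD w Dw)).
have zOm' := D_Om Dw.
move: (pd_comm it ix (A_an zOm')) (pd_comm it ix (B_an zOm')) (pd_comm it ix (C_an zOm')).
have Pxu : P iu ix = P ix iu by rewrite -{1}Psym mxE.
have wu : w 0 iu = y 0 iu by rewrite -yw base4.
move: (b1 it) (b1 ix) (b1 iu) (b2 ix ix) (b2 iu ix) (b2 iu iu) Pxu wu.
move: (p 0 it) (p 0 ix) (p 0 iu) (y 0 ie) (P ix ix) (P ix iu) (P iu iu) =>
  pt px pu eta Pxx Pxu Puu.
atomize; atomize_app A; atomize_app B; atomize_app C; atomize_app (coordf V it);
  atomize_app (coordf V ix); atomize_app (coordf V iu).
subst_facts.
move=> E0 E1 E2 E0x E1x E2x E2u /subr0_eq ->.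
(* Let [D_v] be the derivative along [d_x + eta d_u], so [D_v eta = a] and [D_v a = b + a p_u], and
   let [E = e2 + eta e1 + a e0] be the condition for [L] at [u_x = eta]. The combination below is
   [D_v E - p_u E]; the [u]-derivatives of [e0] and [e1] vanish by the structure of [V]. *)
set a := px + eta * pu; set b := Pxx + 2 * eta * Pxu + eta ^+ 2 * Puu.
match type of E0 with ?t0 = 0 => match type of E1 with ?t1 = 0 =>
match type of E2 with ?t2 = 0 => match type of E0x with ?t0x = 0 =>
match type of E1x with ?t1x = 0 => match type of E2x with ?t2x = 0 =>
match type of E2u with ?t2u = 0 =>
  transitivity (a * t0x + eta * t1x + t2x + eta * t2u + a * t1 + b * t0 - pu * (eta * t1 + t2))
end end end end end end end.
  by rewrite /a /b; clear; ring.
by rewrite E0 E1 E2 E0x E1x E2x E2u !mulr0 !addr0 mulr0 subr0.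
Qed.

End LiftAlgebra.

(** * Determining equations of the reduction equation *)

Section ReductionAlgebra.
Context {R : realType}.
Variables (Om : set 'rV[R]_2) (A B C : 'rV[R]_2 -> R).
Hypotheses (A_an : analytic_on Om A) (B_an : analytic_on Om B) (C_an : analytic_on Om C).
Hypothesis A_neq0 : forall z, Om z -> A z != 0.
Variable D' : set 'rV[R]_4.
Hypotheses (D'_open : open D') (D'_Om : forall w, D' w -> Om (base (base w))).

Local Opaque pd.

(* [v^T P v] with [v = (0, 1, eta)] is [b], whatever [al] and [be]. *)
Definition jet2_3 (eta al b be : R) : 'M[R]_3 := \matrix_(i, j)
  nth 0 (nth [::] [:: [:: 0; al; 0]; [:: al; b - 2 * eta * be; be]; [:: 0; be; 0]] i) j.
Definition jet1_3 (a b c : R) : 'rV[R]_3 := \row_i [:: a; b; c]`_i.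

Lemma jet1_3E a b c :
  (jet1_3 a b c 0 it = a) * (jet1_3 a b c 0 ix = b) * (jet1_3 a b c 0 iu = c).
Proof. by rewrite !mxE. Qed.

Lemma jet2_3E eta al b be : let P := jet2_3 eta al b be in
  (P ix it = al) * (P ix ix = b - 2 * eta * be) * (P ix iu = be) *
  (P iu it = 0) * (P iu ix = be) * (P iu iu = 0).
Proof. by rewrite /= !mxE. Qed.

Lemma jet2_3_sym eta al b be : (jet2_3 eta al b be)^T = jet2_3 eta al b be.
Proof.
apply/matrixP => i j; rewrite !mxE.
by case: (I3P i) => ->; case: (I3P j) => ->.
Qed.

Variable V : vfield R 4.
Hypothesis V_alg : lie_algebra (eqDE0 A B C) D' V.

Notation T := (coordf V it). Notation X := (coordf V ix).
Notation U := (coordf V iu). Notation H := (coordf V ie).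

Lemma reduction_jets w al b be px pu : D' w ->
  let z := base (base w) in let eta := w 0 ie in
  let a := px + eta * pu in
  let pt := A z * b + pd ix A z * a + (pd ix B z * eta + B z * px)
    + C z * (eta - w 0 iu * pu) + pd ix C z * w 0 iu in
  vprol_app V (eqDE0 A B C) w (jet1_3 pt px pu) (jet2_3 eta al b be) = 0.
Proof.
move=> Dw z eta a pt; apply: V_alg.2 => //; first exact: jet2_3_sym.
by rewrite /eqDE0 !jet1_3E !jet2_3E -/z -/eta /pt /a; atomize; atomize_app A;
  atomize_app B; atomize_app C; ring.
Qed.

(** [Dv] is the total derivative along [v = (0, 1, eta)]. Neither [al] (for [eta_tx]) nor [be] (for
    [eta_xu], compensated in [eta_xx]) affects the equation, so their coefficients, proportional to
    [Dv T] and to [Dv U - eta Dv X - H], vanish separately. *)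
Lemma reduction_expand w al b be px pu : D' w ->
  let z := base (base w) in let eta := w 0 ie in
  let a := px + eta * pu in
  let pt := A z * b + pd ix A z * a + (pd ix B z * eta + B z * px)
    + C z * (eta - w 0 iu * pu) + pd ix C z * w 0 iu in
  let Dt f := pd it f w + pt * pd ie f w in
  let Dx f := pd ix f w + px * pd ie f w in
  let Du f := pd iu f w + pu * pd ie f w in
  let Dv f := Dx f + eta * Du f in
  let Dvv f := pd ix (pd ix f) w + 2 * eta * pd ix (pd iu f) w + eta ^+ 2 * pd iu (pd iu f) w
    + 2 * a * (pd ix (pd ie f) w + eta * pd iu (pd ie f) w)
    + a ^+ 2 * pd ie (pd ie f) w + b * pd ie f w in
  let dv f := T w * pd it f z + X w * pd ix f z in
  Dt H - (pt * Dt T + px * Dt X + pu * Dt U)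
  - (dv A * b
     + A z * (Dvv H - (pt * Dvv T + px * Dvv X + pu * Dvv U)
              - 2 * (al * Dv T + (b - eta * be) * Dv X + be * Dv U) + 2 * H w * be)
     + dv (pd ix A) * a
     + pd ix A z * (Dv H - (pt * Dv T + px * Dv X + pu * Dv U) + H w * pu)
     + dv (pd ix B) * eta + pd ix B z * H w + dv B * px
     + B z * (Dx H - (pt * Dx T + px * Dx X + pu * Dx U))
     + dv C * (eta - w 0 iu * pu)
     + C z * (H w - U w * pu - w 0 iu * (Du H - (pt * Du T + px * Du X + pu * Du U)))
     + dv (pd ix C) * w 0 iu + pd ix C z * U w) = 0.
Proof.
move=> Dw z eta a pt Dt Dx Du Dv Dvv dv.
have zOm := D'_Om Dw; have Van := V_alg.1.
have := reduction_jets al b be px pu Dw; cbv zeta.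
rewrite -/z -/eta -/a -/pt.
rewrite /vprol_app derive_eqDE0; [|exact: A_an|exact: B_an|exact: C_an].
rewrite !vprol1_3 !vprol2_3 !tot1_3 !tot2_3 !jet1_3E !jet2_3E.
have [Vt Vx Vu Ve] : [/\ V w 0 it = T w, V w 0 ix = X w, V w 0 iu = U w & V w 0 ie = H w] by [].
rewrite {}Vt {}Vx {}Vu {}Ve -/z -/eta.
have cT i j := pd_comm i j (Van it w Dw); have cX i j := pd_comm i j (Van ix w Dw).
have cU i j := pd_comm i j (Van iu w Dw); have cH i j := pd_comm i j (Van ie w Dw).
rewrite /Dvv /Dv /Dt /Dx /Du /dv.
move: (cT ie ix) (cT ie iu) (cX ie ix) (cX ie iu) (cU ie ix) (cU ie iu) (cH ie ix) (cH ie iu).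
rewrite /a; clearbody pt eta; clear.
atomize; atomize_app A; atomize_app B; atomize_app C.
atomize_app (coordf V it); atomize_app (coordf V ix); atomize_app (coordf V iu); atomize_app (coordf V ie).
subst_facts.
move=> E; rewrite -{}E; clear.
ring.
Qed.

(** The coefficient of [al] gives [Dv T = 0], an affine condition in [p_x], read at 0 and 1. *)
Lemma reduction_T w : D' w -> pd ie T w = 0 /\ pd ix T w + w 0 ie * pd iu T w = 0.
Proof.
move=> Dw; have A0 := A_neq0 (D'_Om Dw).
have := (reduction_expand 1 0 0 0 0 Dw, reduction_expand 0 0 0 0 0 Dw,
         reduction_expand 1 0 0 1 0 Dw, reduction_expand 0 0 0 1 0 Dw).
cbv zeta; move: (A (base (base w))) A0 => Aw A0; clear -A0.
atomize; atomize_app B; atomize_app C.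
atomize_app (coordf V it); atomize_app (coordf V ix); atomize_app (coordf V iu); atomize_app (coordf V ie).
move=> [[[h1 h2] h3] h4]; split; apply: (mulfI A0); lra.
Qed.

Lemma pd_eta_zero (f : 'rV[R]_4 -> R) i w : analytic_on D' f -> (forall y, D' y -> pd ie f y = 0) ->
  D' w -> pd ie (pd i f) w = 0.
Proof. by move=> fD f0 Dw; rewrite (pd_comm ie i (fD w Dw)); exact: pd_eq_cst D'_open f0 Dw. Qed.

(** [T_x + eta T_u = 0] with [T] free of [eta]: the [eta]-derivative of this identity is
    [T_u = 0]. *)
Lemma reduction_T0 w : D' w -> [/\ pd ie T w = 0, pd ix T w = 0 & pd iu T w = 0].
Proof.
move=> Dw; have [Te Tx] := reduction_T Dw.
have Tez y : D' y -> pd ie T y = 0 by move=> /reduction_T[].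
have Txz y : D' y -> pd ix T y + y 0 ie * pd iu T y = 0 by move=> /reduction_T[].
have TD := V_alg.1 it; have Tw := TD w Dw.
have := ider_zero (i := ie) D'_open Txz Dw (iderD (ider_fun ie (analytic_pd ix Tw))
  (iderM (ider_coord ie w ie) (ider_fun ie (analytic_pd iu Tw)))).
rewrite (pd_eta_zero ix TD Tez Dw) (pd_eta_zero iu TD Tez Dw) eqxx mulr0 mulr1 !add0r => E.
by split=> //; move: Tx; rewrite E mulr0 addr0.
Qed.

(** The coefficient of [be] gives [H = Dv U - eta Dv X], again affine in [p_x] and read at 0 and
    1. *)
Lemma reduction_H w : D' w -> pd ie U w = w 0 ie * pd ie X w /\
  H w = pd ix U w + w 0 ie * pd iu U w - w 0 ie * (pd ix X w + w 0 ie * pd iu X w).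
Proof.
move=> Dw; have A0 := A_neq0 (D'_Om Dw).
have := (reduction_expand 0 0 1 0 0 Dw, reduction_expand 0 0 0 0 0 Dw,
         reduction_expand 0 0 1 1 0 Dw, reduction_expand 0 0 0 1 0 Dw).
cbv zeta; move: (A (base (base w))) A0 => Aw A0; clear -A0.
atomize; atomize_app B; atomize_app C.
atomize_app (coordf V it); atomize_app (coordf V ix); atomize_app (coordf V iu); atomize_app (coordf V ie).
move=> [[[h1 h2] h3] h4].
split; apply: (mulfI A0); lra.
Qed.

Let dv f w := T w * pd it f (base (base w)) + X w * pd ix f (base (base w)).

(** The coefficient of [b] is [2 A Dv X - A T_t - dv A]; its dependence on [p_x] is [2 A X_eta]. *)
Lemma reduction_e0 w : D' w -> pd ie X w = 0 /\
  2 * A (base (base w)) * (pd ix X w + w 0 ie * pd iu X w)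
    - A (base (base w)) * pd it T w - dv A w = 0.
Proof.
move=> Dw; have A0 := A_neq0 (D'_Om Dw); have [Te Tx Tu] := reduction_T0 Dw.
have [Tez Txz Tuz] : [/\ forall y, D' y -> pd ie T y = 0, forall y, D' y -> pd ix T y = 0 &
  forall y, D' y -> pd iu T y = 0] by split=> y /reduction_T0[].
have := (reduction_expand 0 1 0 0 0 Dw, reduction_expand 0 0 0 0 0 Dw,
         reduction_expand 0 1 0 1 0 Dw, reduction_expand 0 0 0 1 0 Dw).
cbv zeta; rewrite /dv.
move: Te Tx Tu (pd_eq_cst ie D'_open Tez Dw) (pd_eq_cst ix D'_open Tez Dw)
  (pd_eq_cst iu D'_open Tez Dw) (pd_eq_cst ix D'_open Txz Dw) (pd_eq_cst ix D'_open Tuz Dw)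
  (pd_eq_cst iu D'_open Tuz Dw).
move: (A (base (base w))) A0 => Aw A0; clear -A0.
atomize; atomize_app B; atomize_app C.
atomize_app (coordf V it); atomize_app (coordf V ix); atomize_app (coordf V iu); atomize_app (coordf V ie).
subst_facts.
move=> [[[h1 h2] h3] h4]; split; last by lra.
by apply: (mulfI A0); lra.
Qed.

Lemma ider_base2_eta (f : 'rV[R]_2 -> R) (w : 'rV[R]_4) : analytic_at f (base (base w)) ->
  ider (fun y : 'rV[R]_4 => f (base (base y))) w ie 0.
Proof.
move=> fw; split; first exact: (analytic_base (f := fun y : 'rV[R]_3 => f (base y)) (analytic_base fw)).
exact: (congr1 (fun g => g w) (pd_base4 (f \o @base R 2)).2).
Qed.

Lemma eta1 : (ie == ie :> 'I_4)%:R = 1 :> R. Proof. by rewrite eqxx. Qed.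

Lemma reduction_struct w : D' w ->
  [/\ [/\ pd ie T w = 0, pd ix T w = 0 & pd iu T w = 0],
      pd ie X w = 0 /\ pd iu X w = 0, pd ie U w = 0 &
      H w = pd ix U w + w 0 ie * (pd iu U w - pd ix X w)].
Proof.
move=> Dw; have T0 := reduction_T0 Dw; have zOm := D'_Om Dw; have A0 := A_neq0 zOm.
have [Xe _] := reduction_e0 Dw; have [Ue Hw] := reduction_H Dw.
have Xez y : D' y -> pd ie X y = 0 by move=> /reduction_e0[].
have Tez y : D' y -> pd ie T y = 0 by move=> /reduction_T0[].
have e0z y : D' y -> 2 * A (base (base y)) * (pd ix X y + y 0 ie * pd iu X y)
    - A (base (base y)) * pd it T y -
    (T y * pd it A (base (base y)) + X y * pd ix A (base (base y))) = 0.
  by move=> /reduction_e0[].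
have TD := V_alg.1 it; have XD := V_alg.1 ix.
have hA := ider_base2_eta (A_an zOm); have hAd i := ider_base2_eta (analytic_pd i (A_an zOm)).
have hXi i := ider_fun ie (analytic_pd i (XD w Dw)).
have hTt := ider_fun ie (analytic_pd it (TD w Dw)).
(* In the relation from the coefficient of [b], only [eta X_u] still involves [eta], so its
   [eta]-derivative is [2 A X_u = 0]. *)
have := ider_zero D'_open e0z Dw (iderB (iderB (iderM (iderM (iderC 2 w ie) hA)
  (iderD (hXi ix) (iderM (ider_coord ie w ie) (hXi iu)))) (iderM hA hTt))
  (iderD (iderM (ider_fun ie (TD w Dw)) (hAd it)) (iderM (ider_fun ie (XD w Dw)) (hAd ix)))).
move=> E; rewrite (pd_eta_zero ix XD Xez Dw) (pd_eta_zero iu XD Xez Dw)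
  (pd_eta_zero it TD Tez Dw) Xe (Tez w Dw) eta1 in E.
have Xu : pd iu X w = 0.
  move: E; move: (A (base (base w))) A0 => Aw A0; clear -A0.
  atomize; atomize_app (coordf V it); atomize_app (coordf V ix) => E.
  by apply: (mulfI A0); lra.
split; [exact: T0|by []|by rewrite Ue Xe mulr0|].
by rewrite Hw Xu; ring.
Qed.

(** The condition at slope [(p_x, p_u) = (-eta, 1)] minus that at slope 0. Both have
    [p_x + eta p_u = 0], so the terms in that combination drop out and the coefficient of [p_u]
    remains. *)
Lemma reduction_pu w : D' w ->
  let z := base (base w) in let eta := w 0 ie in let u := w 0 iu in
  let e0 := 2 * A z * pd ix X w - A z * pd it T w - dv A w in
  let e1 := B z * (pd ix X w - pd it T w) - pd it X w
    - 2 * A z * pd ix (pd iu U) w + A z * pd ix (pd ix X) w - dv B w in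
  let e2 := pd it U w + C z * u * (pd iu U w - pd it T w) - A z * pd ix (pd ix U) w
    - dv C w * u - B z * pd ix U w - C z * U w in
  e0 = 0 /\ e2 + eta * e1 - eta ^+ 2 * (A z * pd iu (pd iu U) w) = 0.
Proof.
move=> Dw; cbv zeta.
have st y : D' y -> _ := fun Dy => reduction_struct Dy.
have [Tez Txz Tuz] : [/\ forall y, D' y -> pd ie T y = 0, forall y, D' y -> pd ix T y = 0 &
  forall y, D' y -> pd iu T y = 0] by split=> y /st[[]].
have [Xez Xuz] : (forall y, D' y -> pd ie X y = 0) /\ (forall y, D' y -> pd iu X y = 0).
  by split=> y /st[_ []].
have Uez y : D' y -> pd ie U y = 0 by move=> /st[].
have Hz y : D' y -> H y = pd ix U y + y 0 ie * (pd iu U y - pd ix X y) by move=> /st[].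
have XD := V_alg.1 ix; have UD := V_alg.1 iu; have HD := V_alg.1 ie.
have He : pd ie H w = pd iu U w - pd ix X w.
  have hU i := ider_fun ie (analytic_pd i (UD w Dw)).
  have hX := ider_fun ie (analytic_pd ix (XD w Dw)).
  have [_] := iderD (hU ix) (iderM (ider_coord ie w ie) (iderB (hU iu) hX)).
  rewrite -(pd_eq_on ie D'_open Hz Dw) => ->.
  rewrite (pd_eta_zero ix UD Uez Dw) (pd_eta_zero iu UD Uez Dw) (pd_eta_zero ix XD Xez Dw).
  by rewrite eta1; ring.
have [_ E0] := reduction_e0 Dw.
have := (reduction_expand 0 0 0 (- w 0 ie) 1 Dw, reduction_expand 0 0 0 0 0 Dw).
cbv zeta; move: E0; rewrite /dv.
move: (Tez w Dw) (Txz w Dw) (Tuz w Dw) (pd_eq_cst ie D'_open Tez Dw) (pd_eq_cst ix D'_open Tez Dw)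
  (pd_eq_cst iu D'_open Tez Dw) (pd_eq_cst ix D'_open Txz Dw) (pd_eq_cst ix D'_open Tuz Dw)
  (pd_eq_cst iu D'_open Tuz Dw)
  (Xez w Dw) (Xuz w Dw) (pd_eq_cst ie D'_open Xez Dw) (pd_eq_cst ix D'_open Xez Dw)
  (pd_eq_cst iu D'_open Xez Dw) (pd_eq_cst ix D'_open Xuz Dw) (pd_eq_cst iu D'_open Xuz Dw)
  (Uez w Dw) (pd_eq_cst ie D'_open Uez Dw) (pd_eq_cst ix D'_open Uez Dw)
  (pd_eq_cst iu D'_open Uez Dw) He (Hz w Dw).
atomize; atomize_app A; atomize_app B; atomize_app C.
atomize_app (coordf V it); atomize_app (coordf V ix); atomize_app (coordf V iu); atomize_app (coordf V ie).
subst_facts; clear.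
move=> E0 [h1 h2]; split; first by lra.
lra.
Qed.

End ReductionAlgebra.

(** * Functions with a vanishing partial derivative on boxes *)

Section Boxes.
Context {R : realType}.

Lemma box_open n (J : 'I_n -> set R) : (forall i, open (J i)) -> open (box J).
Proof.
move=> Jo; rewrite openE => w Jw.
have H i : exists r : R, 0 < r /\ forall s : R, `|s - w 0 i| < r -> J i s.
  have := open_nbhs_nbhs (conj (Jo i) (Jw i)) => /nbhs_ballP[r /= r0 rJ].
  by exists r; split=> // s sr; apply: rJ; rewrite /ball/= distrC.
have [r rP] := boolp.choice H.
apply/nbhs_rowP; exists (\big[Num.min/1]_i r i) => [|y yw i].
  by elim/big_ind: _ => // [x y x0 y0|i _]; [rewrite lt_min x0|have [] := rP i].
have [_] := rP i; apply; apply: lt_le_trans (yw i) _.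
exact: bigmin_le.
Qed.

Lemma is_derive_line_at n (f : 'rV[R]_n -> R) w k (s : R) :
  analytic_at f (w + s *: delta_mx 0 k) ->
  is_derive s 1 (fun t : R => f (w + t *: delta_mx 0 k)) (pd k f (w + s *: delta_mx 0 k)).
Proof.
move=> fw; have [fd fE] := analytic_is_derive k fw.
have E : (fun h : R => h^-1 *: (((fun t : R => f (w + t *: delta_mx 0 k)) \o shift s) (h *: (1 : R)) -
    f (w + s *: delta_mx 0 k))) =
  (fun h : R => h^-1 *: ((f \o shift (w + s *: delta_mx 0 k)) (h *: delta_mx 0 k) -
    f (w + s *: delta_mx 0 k))).
  apply/funext => h /=; congr (_ *: (f _ - _)).
  by rewrite -[h *: 1]/(h * 1) mulr1 scalerDl addrCA addrC [in RHS]addrC [RHS]addrC.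
by apply: DeriveDef; rewrite /derivable /derive /= E.
Qed.

(** Mean value theorem on the segment parallel to axis [k], which stays in the box because [J k] is
    an interval. *)
Lemma pd_zero_cst n (J : 'I_n -> set R) (f : 'rV[R]_n -> R) k w w' :
  (forall i, is_interval (J i)) -> analytic_on (box J) f ->
  (forall y, box J y -> pd k f y = 0) -> box J w -> box J w' ->
  (forall i, i != k -> w 0 i = w' 0 i) -> f w = f w'.
Proof.
move=> Ji fJ f0 + + ww'.
wlog le_ww' : w w' ww' / w 0 k <= w' 0 k.
  move=> IH Jw Jw'; have [h|/ltW h] := leP (w 0 k) (w' 0 k); first exact: IH.
  by apply/esym/IH => // i ik; rewrite ww'.
move=> Jw Jw'; pose d := w' 0 k - w 0 k.
have d0 : 0 <= d by rewrite subr_ge0.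
have Jl s : 0 <= s <= d -> box J (w + s *: delta_mx 0 k).
  move=> /andP[s0 sd] i; rewrite !mxE eqxx; have [->|ik] := eqVneq i k.
    by apply: Ji (Jw k) (Jw' k) _ _; rewrite mulr1 lerDl s0/= -lerBrDl.
  by rewrite mulr0 addr0.
have E' : w' = w + d *: delta_mx 0 k.
  apply/rowP => i; rewrite !mxE eqxx; have [->|ik] := eqVneq i k.
    by rewrite mulr1 /d; ring.
  by rewrite mulr0 addr0 ww'.
have der s : 0 <= s <= d -> is_derive s 1 (fun t : R => f (w + t *: delta_mx 0 k)) 0.
  by move=> /Jl h; rewrite -(f0 _ h); apply: is_derive_line_at; exact: fJ.
have [||c _] := @MVT_segment R (fun t : R => f (w + t *: delta_mx 0 k)) (fun=> 0) 0 d d0.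
- move=> x /[!in_itv]/= /andP[x0 xd]; apply: der.
  by rewrite !ltW.
- apply: derivable_within_continuous => x /[!in_itv]/= xd.
  by have [] := der x xd.
by rewrite mul0r scale0r addr0 -E' => /subr0_eq.
Qed.

End Boxes.

Section Fibers.
Context {R : realType}.
Variable n : nat.
Variable J : 'I_n.+1 -> set R.
Hypotheses (J_open : forall i, open (J i)) (J_itv : forall i, is_interval (J i)).

Let D' := box J.
Let D := box (fun i : 'I_n => J (ind i)).

Lemma box_base w : D' w -> D (base w).
Proof. by move=> Dw i; rewrite mxE; exact: Dw. Qed.

Lemma box_row_ext z e : D z -> J (dep n) e -> D' (row_ext z e).
Proof.
move=> Dz Je k; have [[i ->]|->] := indP k; first by rewrite row_ext_ind; exact: Dz.
by rewrite row_ext_dep.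
Qed.

Variables (f : 'rV[R]_n.+1 -> R) (e0 : R).
Hypotheses (fD : analytic_on D' f) (f0 : forall w, D' w -> pd (dep n) f w = 0).
Hypothesis Je0 : J (dep n) e0.

Lemma slice_base w : D' w -> f w = f (row_ext (base w) e0).
Proof.
move=> Dw; apply: (pd_zero_cst (k := dep n) J_itv fD f0 Dw).
  by apply: box_row_ext => //; exact: box_base.
move=> i idep; have [[j ->]|E] := indP i; last by rewrite E eqxx in idep.
by rewrite row_ext_ind mxE.
Qed.

Lemma pd_slice_base w i : D' w ->
  pd (ind i) f w = pd i (fun z => f (row_ext z e0)) (base w).
Proof.
move=> Dw; have D'o : open D' by exact: box_open.
rewrite (pd_eq_on (g := (fun z => f (row_ext z e0)) \o @base R n) (ind i) D'o _ Dw).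
  by rewrite pd_base.
by move=> y /slice_base.
Qed.

Lemma pd2_slice_base w i j : D' w ->
  pd (ind j) (pd (ind i) f) w = pd j (pd i (fun z => f (row_ext z e0))) (base w).
Proof.
move=> Dw; have D'o : open D' by exact: box_open.
rewrite (pd_eq_on (g := pd i (fun z => f (row_ext z e0)) \o @base R n) (ind j) D'o _ Dw).
  by rewrite pd_base.
by move=> y Dy; rewrite pd_slice_base.
Qed.

Lemma analytic_on_slice : analytic_on D (fun z => f (row_ext z e0)).
Proof. by move=> z Dz; apply: analytic_slice; apply: fD; exact: box_row_ext. Qed.

End Fibers.

(** * The isomorphism of Lie algebras on a box *)

Section LieIsomorphism.
Context {R : realType}.
Variables (Om : set 'rV[R]_2) (A B C : 'rV[R]_2 -> R).
Hypotheses (A_an : analytic_on Om A) (B_an : analytic_on Om B) (C_an : analytic_on Om C).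
Hypothesis A_neq0 : forall z, Om z -> A z != 0.
Variable J : 'I_4 -> set R.
Hypothesis J_itv : forall i, [/\ open (J i), is_interval (J i) & J i !=set0].

Let D' := box J.
Let D := box (fun i : 'I_3 => J (ind i)).
Hypothesis D'_Om : D' `<=` (@base R 2 \o @base R 3) @^-1` Om.

Local Opaque pd.

Let Jo i : open (J i). Proof. by have [] := J_itv i. Qed.
Let Ji i : is_interval (J i). Proof. by have [] := J_itv i. Qed.
Let D'_open : open D'. Proof. exact: box_open. Qed.
Let D_open : open D. Proof. exact: box_open. Qed.
Let D'D w : D' w -> D (base w). Proof. exact: box_base. Qed.

Lemma eta0 : exists e, J ie e.
Proof. by have [_ _ [e Je]] := J_itv ie; exists e. Qed.

Lemma box_ext z e : D z -> J ie e -> D' (row_ext z e).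
Proof. by move=> Dz Je; apply: box_row_ext => //; rewrite ind3. Qed.

Lemma D_Om w : D w -> Om (base w).
Proof.
by move=> Dw; have [e Je] := eta0; have := D'_Om (box_ext Dw Je); rewrite /= base_row_ext.
Qed.

Lemma lift_mem V : lie_algebra (eqL A B C) D V -> lie_algebra (eqDE0 A B C) D' (lift_field V).
Proof.
move=> VL; have Vs := lie_algebra_struct A_an B_an C_an A_neq0 D_open D_Om VL.
have [Van _] := VL; split; first exact (analytic_lift D'D Van).
move=> w p P Dw Ps F.
exact: (lift_invariant A_an B_an C_an D_open D'_open D'D D_Om Van Vs (D'D Dw) Dw erefl Ps F).
Qed.

Lemma row_extD (z z' : 'rV[R]_3) (a e e' : R) :
  row_ext (a *: z + z') (a * e + e') = a *: row_ext z e + row_ext z' e'.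
Proof.
apply/rowP => k; have [[i ->]|->] := indP k; first by rewrite !mxE liftK !mxE.
by rewrite !mxE unlift_none.
Qed.

Lemma lift_linear a V W : lie_algebra (eqL A B C) D V -> lie_algebra (eqL A B C) D W ->
  {in D', lift_field (fun w => a *: V w + W w) =1
     (fun w => a *: lift_field V w + lift_field W w)}.
Proof.
move=> [Van _] [Wan _] w; rewrite in_setE => /D'D Dw.
have E k i : pd i (coordf (fun w => a *: V w + W w) k) (base w) =
    a * pd i (coordf V k) (base w) + pd i (coordf W k) (base w).
  have hV := Van k _ Dw; rewrite -(pdZ a i hV) -(pdD i (analyticZ a hV) (Wan k _ Dw)).
  by congr pd; apply/funext => y; rewrite /coordf !mxE.
rewrite /lift_field -row_extD /afl !E; congr row_ext.
by atomize; ring.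
Qed.

Lemma lift_inj V W : lie_algebra (eqL A B C) D V -> lie_algebra (eqL A B C) D W ->
  {in D', lift_field V =1 lift_field W} <-> {in D, V =1 W}.
Proof.
move=> VL WL; split=> VW w; rewrite in_setE => Dw.
  have [e Je] := eta0; have := VW _ (mem_set (box_ext Dw Je)).
  by move=> /(congr1 (@base R 3)); rewrite !base_row_ext.
have VW' y : D y -> V y = W y by move=> Dy; apply: VW; rewrite in_setE.
have E k i : pd i (coordf V k) (base w) = pd i (coordf W k) (base w).
  by apply: (pd_eq_on i D_open) (D'D Dw) => y Dy; rewrite /coordf VW'.
by rewrite /lift_field /afl VW'// ?E//; exact: D'D.
Qed.

Lemma quadratic_zero (I : set R) (c0 c1 c2 : R) : open I -> I !=set0 ->
  (forall e, I e -> c0 + e * c1 + e ^+ 2 * c2 = 0) -> [/\ c0 = 0, c1 = 0 & c2 = 0].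
Proof.
move=> Io [e Ie] h.
have := open_nbhs_nbhs (conj Io Ie) => /nbhs_ballP[r /= r0 rI].
(* The values at [e] and [e + r / 2], [e - r / 2] determine the three coefficients; half the radius
   keeps the points inside the ball. *)
have d0 : 0 < r / 2 by lra.
have hp : I (e + r / 2) by apply: rI; rewrite /ball/= ltr_norml; apply/andP; split; lra.
have hm : I (e - r / 2) by apply: rI; rewrite /ball/= ltr_norml; apply/andP; split; lra.
have h0 := h _ Ie; have {}hp := h _ hp; have {}hm := h _ hm.
move: (r / 2) d0 hp hm => d d0 hp hm.
have dn : d != 0 by rewrite gt_eqF.
have c20 : c2 = 0.
  by apply: (mulfI dn); apply: (mulfI dn); lra.
subst c2.
have c10 : c1 = 0.
  by apply: (mulfI dn); lra.
by subst c1; split=> //; lra.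
Qed.

Lemma lift_surj V' : lie_algebra (eqDE0 A B C) D' V' ->
  exists2 V, lie_algebra (eqL A B C) D V & {in D', lift_field V =1 V'}.
Proof.
move=> VL; have [e0 Je0] := eta0; have [Van _] := VL.
have D'_Om2 w : D' w -> Om (base (base w)) by exact: D'_Om.
have st w Dw := @reduction_struct R Om A B C A_an B_an C_an A_neq0 D' D'_open D'_Om2 V' VL w Dw.
have pu w Dw := @reduction_pu R Om A B C A_an B_an C_an A_neq0 D' D'_open D'_Om2 V' VL w Dw.
have z0 (k : 'I_3) w : D' w -> pd (dep 3) (coordf V' (ind k)) w = 0.
  by move=> /st[[? _ _] [? _] ? _]; rewrite ind3; case: (I3P k) => ->; rewrite ind3.
(* The first three components of [V'] are constant along the [eta]-fibres, so any height [e0] gives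
   the projected field. *)
pose V z := base (V' (row_ext z e0)).
have VE k : coordf V k = fun z => coordf V' (ind k) (row_ext z e0).
  by apply/funext => z; rewrite /coordf !mxE.
have Je0' : J (dep 3) e0 by rewrite ind3.
have S0 k k' w : ind k = k' -> D' w -> coordf V' k' w = coordf V k (base w).
  by move=> <- Dw; rewrite VE; exact: (slice_base Ji (Van (ind k)) (z0 k) Je0' Dw).
have S1 k k' i i' w : ind k = k' -> ind i = i' -> D' w ->
    pd i' (coordf V' k') w = pd i (coordf V k) (base w).
  by move=> <- <- Dw; rewrite VE; exact: (pd_slice_base Jo Ji (Van (ind k)) (z0 k) Je0' i Dw).
have S2 k k' i i' j j' w : ind k = k' -> ind i = i' -> ind j = j' -> D' w ->
    pd j' (pd i' (coordf V' k')) w = pd j (pd i (coordf V k)) (base w).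
  by move=> <- <- <- Dw; rewrite VE; exact: (pd2_slice_base Jo Ji (Van (ind k)) (z0 k) Je0' i j Dw).
have Van3 : analytic_map_on D V.
  by move=> k; rewrite VE => z Dz; apply: (analytic_on_slice (Van (ind k)) Je0').
have [[[n1 n2] n3] n4] := ind3.
have Vs : lie_struct A B C D V.
  move=> z Dz; have Dw := box_ext Dz Je0.
  have [[_ tx tu] [_ xu] _ _] := st _ Dw.
  rewrite (S1 _ _ _ _ _ n1 n2 Dw) base_row_ext in tx.
  rewrite (S1 _ _ _ _ _ n1 n3 Dw) base_row_ext in tu.
  rewrite (S1 _ _ _ _ _ n2 n3 Dw) base_row_ext in xu.
  have [Jo4 _ Jn] := J_itv ie.
  (* At fixed [z] the three coefficients do not depend on [e], which ranges over a nonempty open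
     set; hence each of them vanishes. *)
  have h e : J ie e -> lie_e0 A V z = 0 /\ lie_e2 A B C V z + e * lie_e1 A B V z
      + e ^+ 2 * - (A (base z) * pd iu (pd iu (coordf V iu)) z) = 0.
    move=> Je; have De := box_ext Dz Je; have := pu _ De; cbv zeta.
    rewrite !(S0 _ _ _ n1 De) !(S0 _ _ _ n2 De) !(S0 _ _ _ n3 De).
    rewrite !(S1 _ _ _ _ _ n1 n1 De) !(S1 _ _ _ _ _ n2 n2 De) !(S1 _ _ _ _ _ n2 n1 De).
    rewrite !(S1 _ _ _ _ _ n3 n1 De) !(S1 _ _ _ _ _ n3 n2 De) !(S1 _ _ _ _ _ n3 n3 De).
    rewrite !(S2 _ _ _ _ _ _ _ n3 n3 n2 De) !(S2 _ _ _ _ _ _ _ n2 n2 n2 De).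
    rewrite !(S2 _ _ _ _ _ _ _ n3 n2 n2 De) !(S2 _ _ _ _ _ _ _ n3 n3 n3 De).
    have ee : row_ext z e 0 ie = e by rewrite -n4 row_ext_dep.
    have eu : row_ext z e 0 iu = z 0 iu by rewrite -n3 row_ext_ind.
    rewrite ee eu !base_row_ext mulrN => h; exact: h.
  have [c0 c1 /eqP] := quadratic_zero Jo4 Jn (fun e Je => (h e Je).2).
  rewrite oppr_eq0 mulf_eq0 (negbTE (A_neq0 (D_Om Dz))) /= => /eqP uu.
  by split=> //; split=> //; exact: (h e0 Je0).1.
exists V; first exact (struct_lie_algebra A_an B_an C_an D_open D_Om Van3 Vs).
move=> w; rewrite in_setE => Dw; rewrite -[RHS]row_ext_base; congr row_ext.
  by apply/rowP => k; rewrite [RHS]mxE; have := S0 k _ w erefl Dw; rewrite /coordf => ->.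
have [_ _ _] := st _ Dw; rewrite -n4 => Hw; rewrite [RHS]Hw /afl n4.
by rewrite (S1 _ _ _ _ _ n3 n2 Dw) (S1 _ _ _ _ _ n3 n3 Dw) (S1 _ _ _ _ _ n2 n2 Dw).
Qed.

Lemma coordf_bracket (V W : vfield R 3) k : coordf (bracket V W) k = fun y =>
  (V y 0 it * pd it (coordf W k) y - W y 0 it * pd it (coordf V k) y) +
  (V y 0 ix * pd ix (coordf W k) y - W y 0 ix * pd ix (coordf V k) y) +
  (V y 0 iu * pd iu (coordf W k) y - W y 0 iu * pd iu (coordf V k) y).
Proof. by apply/funext => y; rewrite /coordf mxE sum_I3. Qed.

Lemma pd_bracket (V W : vfield R 3) k i z : analytic_map_on D V -> analytic_map_on D W ->
  D z -> pd i (coordf (bracket V W) k) z =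
  let t j := V z 0 j * pd i (pd j (coordf W k)) z + pd j (coordf W k) z * pd i (coordf V j) z
    - (W z 0 j * pd i (pd j (coordf V k)) z + pd j (coordf V k) z * pd i (coordf W j) z) in
  t it + t ix + t iu.
Proof.
move=> Van Wan Dz; rewrite coordf_bracket.
have h j := iderB (iderM (ider_fun i (Van j z Dz)) (ider_fun i (analytic_pd j (Wan k z Dz))))
  (iderM (ider_fun i (Wan j z Dz)) (ider_fun i (analytic_pd j (Van k z Dz)))).
by have [_ ->] := iderD (iderD (h it) (h ix)) (h iu).
Qed.

(** The first three components are free of [eta], so their brackets agree at once. For the
    [eta]-component both sides are expanded and compared modulo [tau_x = tau_u = xi_u = 0] and
    symmetry of second derivatives. *)
Lemma lift_bracket V W : lie_algebra (eqL A B C) D V -> lie_algebra (eqL A B C) D W ->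
  {in D', lift_field (bracket V W) =1 bracket (lift_field V) (lift_field W)}.
Proof.
move=> VL WL w; rewrite in_setE => Dw; have Dz := D'D Dw.
have Vs := lie_algebra_struct A_an B_an C_an A_neq0 D_open D_Om VL.
have Ws := lie_algebra_struct A_an B_an C_an A_neq0 D_open D_Om WL.
have [Van _] := VL; have [Wan _] := WL.
have [[[n1 n2] n3] n4] := ind3.
have LE (Y : vfield R 3) k : coordf (lift_field Y) (ind k) = coordf Y k \o @base R 3.
  by apply/funext => y; rewrite /coordf row_ext_ind.
apply/rowP => k; have [[j ->]|->] := indP k.
  rewrite row_ext_ind [RHS]mxE sum_I4 -!n4 !LE !pd_base_dep !mulr0 subrr addr0.
  rewrite [LHS](congr1 (fun g => g (base w)) (coordf_bracket V W j)).
  rewrite -n1 -n2 -n3 !pd_base.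
  by have := (congr1 (fun g => g w) (LE V it)); rewrite /coordf/= !row_ext_ind.
have entries (Y : vfield R 3) : [/\ lift_field Y w 0 it = coordf Y it (base w),
    lift_field Y w 0 ix = coordf Y ix (base w), lift_field Y w 0 iu = coordf Y iu (base w) &
    lift_field Y w 0 ie = afl (pd ix (coordf Y iu))
      (fun y => pd iu (coordf Y iu) y - pd ix (coordf Y ix) y) w].
  by rewrite -[in ie]n4 -n1 -n2 -n3 !row_ext_ind row_ext_dep.
rewrite row_ext_dep [RHS]mxE sum_I4 n4.
have [v1 v2 v3 v4] := entries V; have [w1 w2 w3 w4] := entries W.
rewrite v1 v2 v3 v4 w1 w2 w3 w4 {v1 v2 v3 v4 w1 w2 w3 w4} !coordf_lift.
have bD (Y : vfield R 3) (Yan : analytic_map_on D Y) :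
    analytic_on D (pd ix (coordf Y iu)) /\
    analytic_on D (fun y => pd iu (coordf Y iu) y - pd ix (coordf Y ix) y).
  by split; [|apply: analytic_onB]; apply: analytic_on_pd; exact: Yan.
have b1 (Y : vfield R 3) (Yan : analytic_map_on D Y) i :
    pd i (fun y => pd iu (coordf Y iu) y - pd ix (coordf Y ix) y) (base w) =
    pd i (pd iu (coordf Y iu)) (base w) - pd i (pd ix (coordf Y ix)) (base w).
  by apply: pdB; apply: analytic_pd; exact: Yan.
have [V1 V2] := bD V Van; have [W1 W2] := bD W Wan.
have [[[[[[[[[[[[vg vt] vx] vu] ve] _] _] _] _] _] _] _] _] := pd_lift_afl D'_open D'D V1 V2 Dw erefl.
have [[[[[[[[[[[[wg wt] wx] wu] we] _] _] _] _] _] _] _] _] := pd_lift_afl D'_open D'D W1 W2 Dw erefl.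
have E i j : pd i (coordf (bracket V W) j) (base w) = _ := pd_bracket j i Van Wan Dz.
have zero (Y : vfield R 3) (Ys : lie_struct A B C D Y) :
  [/\ forall y, D y -> pd ix (coordf Y it) y = 0, forall y, D y -> pd iu (coordf Y it) y = 0,
      forall y, D y -> pd iu (coordf Y ix) y = 0 & forall y, D y -> pd iu (pd iu (coordf Y iu)) y = 0].
  by split=> y /Ys[[]].
have [v1 v2 v3 v4] := zero V Vs; have [w1 w2 w3 w4] := zero W Ws.
rewrite [LHS]/afl n4 (E ix iu) (E iu iu) (E ix ix); cbv zeta.
have ce (Y : vfield R 3) j : Y (base w) 0 j = coordf Y j (base w) by [].
rewrite !(ce V) !(ce W).
move: (v1 _ Dz) (v2 _ Dz) (v3 _ Dz) (v4 _ Dz) (w1 _ Dz) (w2 _ Dz) (w3 _ Dz) (w4 _ Dz)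
  (pd_eq_cst it D_open v3 Dz) (pd_eq_cst ix D_open v3 Dz) (pd_eq_cst iu D_open v3 Dz)
  (pd_eq_cst it D_open w3 Dz) (pd_eq_cst ix D_open w3 Dz) (pd_eq_cst iu D_open w3 Dz)
  (pd_comm iu ix (Van ix _ Dz)) (pd_comm iu ix (Wan ix _ Dz))
  (pd_comm iu ix (Van iu _ Dz)) (pd_comm iu ix (Wan iu _ Dz))
  (pd_comm it ix (Van iu _ Dz)) (pd_comm it ix (Wan iu _ Dz))
  (pd_comm it ix (Van ix _ Dz)) (pd_comm it ix (Wan ix _ Dz))
  (pd_comm it iu (Van iu _ Dz)) (pd_comm it iu (Wan iu _ Dz)).
move: (b1 V Van it) (b1 V Van ix) (b1 V Van iu) (b1 W Wan it) (b1 W Wan ix) (b1 W Wan iu).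
move: vg vt vx vu ve wg wt wx wu we; clear.
atomize; atomize_app (coordf V it); atomize_app (coordf V ix); atomize_app (coordf V iu).
atomize_app (coordf W it); atomize_app (coordf W ix); atomize_app (coordf W iu).
repeat match goal with |- context [afl ?a ?b ?w] => generalize (afl a b w); intro end.
subst_facts; clear; ring.
Qed.

Lemma lie_algebra_opQ Q : lie_algebra (eqL A B C) D Q ->
  exists tau xi zeta1 zeta0, {in D, Q =1 opQ tau xi zeta1 zeta0}.
Proof.
move=> QL; have Qs := lie_algebra_struct A_an B_an C_an A_neq0 D_open D_Om QL.
have [Qan _] := QL; pose J3 (i : 'I_3) := J (ind i).
have J3i i : is_interval (J3 i) by exact: Ji.
have [x0 Jx0] : J3 ix !=set0 by have [] := J_itv (ind ix).
have [u0 Ju0] : J3 (dep 2) !=set0 by have [] := J_itv (ind (dep 2)).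
have [[n1 n2] n3] := ind2.
have tx y : D y -> pd ix (coordf Q it) y = 0 by move=> /Qs[[]].
have tu y : D y -> pd (dep 2) (coordf Q it) y = 0 by rewrite n3 => /Qs[[]].
have xu y : D y -> pd (dep 2) (coordf Q ix) y = 0 by rewrite n3 => /Qs[].
have uu y : D y -> pd (dep 2) (pd iu (coordf Q iu)) y = 0 by rewrite n3 => /Qs[].
(* The future [zeta0]: since the [u]-component has zero second [u]-derivative, [U - u U_u] is free
   of [u]. *)
pose lin (y : 'rV[R]_3) := coordf Q iu y - y 0 iu * pd iu (coordf Q iu) y.
have linD : analytic_on D lin.
  move=> y Dy; apply: analyticB; first exact: Qan.
  by apply: analyticM; [exact: analytic_coord|exact/analytic_pd/Qan].
have lu y : D y -> pd (dep 2) lin y = 0.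
  move=> Dy; have Uy := Qan iu y Dy; rewrite n3.
  have [_ ->] := iderB (ider_fun iu Uy)
    (iderM (ider_coord iu y iu) (ider_fun iu (analytic_pd iu Uy))).
  have := uu y Dy; rewrite n3 => ->; rewrite eqxx mulr0 add0r mulr1 subrr//.
(* [tau] is read at a reference point [(x0, u0)], reached by moving first along [u] and then along
   [x]. *)
pose m (t : R) : 'rV[R]_3 := \row_i (if i == it then t else if i == ix then x0 else u0).
have mD w : D w -> D (m (w 0 it)).
  move=> Dw i; rewrite mxE; case: (I3P i) => ->//=; rewrite -n3; exact: Ju0.
have J3r w : D w -> D (row_ext (base w) u0).
  by move=> Dw; apply: (box_row_ext (J := J3)) => //; exact: (box_base (J := J3)).
exists (fun t => Q (m t) 0 it), (fun z => Q (row_ext z u0) 0 ix),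
  (fun z => pd iu (coordf Q iu) (row_ext z u0)),
  (fun z => lin (row_ext z u0)).
move=> w; rewrite in_setE => Dw; apply/rowP => k; rewrite [RHS]mxE.
case: (I3P k) => ->.
- transitivity (coordf Q it (row_ext (base w) u0)).
    exact: (slice_base (J := J3) J3i (Qan it) tu Ju0 Dw).
  apply: (pd_zero_cst (k := ix) J3i (Qan it) tx (J3r w Dw) (mD w Dw)) => i iix.
  case: (I3P i) iix => -> // _; rewrite ![in RHS]mxE.
    by rewrite -n1 row_ext_ind mxE.
  by rewrite -n3 row_ext_dep.
- exact: (slice_base (J := J3) J3i (Qan ix) xu Ju0 Dw).
- rewrite /= -(slice_base (J := J3) J3i (analytic_on_pd iu (Qan iu)) uu Ju0 Dw).
  rewrite -(slice_base (J := J3) J3i linD lu Ju0 Dw) /lin.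
  by rewrite mulrC addrCA subrr addr0.
Qed.

(** The given coefficients come without regularity. Their analyticity is recovered from slices of
    [Q]: [zeta1] is a difference quotient between two heights [u0] and [u1], and [zeta0] follows by
    subtraction. *)
Lemma lift_opQ Q tau xi zeta1 zeta0 : lie_algebra (eqL A B C) D Q ->
  {in D, Q =1 opQ tau xi zeta1 zeta0} ->
  {in D', lift_field Q =1 opQ0 tau xi zeta1 zeta0}.
Proof.
move=> [Qan _] QE w; rewrite in_setE => Dw; have Dz := D'D Dw.
pose J3 (i : 'I_3) := J (ind i); have J3i i : is_interval (J3 i) by exact: Ji.
have J3o i : open (J3 i) by exact: Jo.
have [[[n1 n2] n3] n4] := ind3; have [[m1 m2] m3] := ind2.
have QE' y k : D y -> coordf Q k y = opQ tau xi zeta1 zeta0 y 0 k.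
  by move=> Dy; rewrite /coordf QE// in_setE.
pose D2 := box (fun i : 'I_2 => J3 (ind i)).
have D2o : open D2 by apply: box_open => i; exact: J3o.
have D2z : D2 (base (base w)) by exact: (box_base (J := J3)).
have [u0 Ju0] : J3 (dep 2) !=set0 by have [] := J_itv (ind (dep 2)).
have [u1 [Ju1 u01]] : exists u1, J3 (dep 2) u1 /\ u1 - u0 != 0.
  have := open_nbhs_nbhs (conj (J3o (dep 2)) Ju0) => /nbhs_ballP[r /= r0 rI].
  exists (u0 + r / 2); split; last by rewrite addrC addKr gt_eqF// divr_gt0.
  by apply: rI; rewrite /ball/= ltr_norml; apply/andP; split; lra.
have De z u : J3 (dep 2) u -> D2 z -> D (row_ext z u).
  by move=> Ju D2z'; apply: (box_row_ext (J := J3)).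
have ev z u : J3 (dep 2) u -> D2 z -> coordf Q ix (row_ext z u) = xi z /\
    coordf Q iu (row_ext z u) = zeta1 z * u + zeta0 z.
  move=> Ju D2z'; rewrite !QE' ?mxE/=; [|exact: De..].
  by rewrite base_row_ext -m3 unlift_none.
have sl k u z : J3 (dep 2) u -> D2 z -> analytic_at (fun z => coordf Q k (row_ext z u)) z.
  by move=> Ju D2z'; apply: analytic_slice; apply: Qan; exact: De.
have near2 (f g : 'rV[R]_2 -> R) : (forall z, D2 z -> f z = g z) ->
    analytic_at f (base (base w)) -> analytic_at g (base (base w)).
  move=> fg; apply: analytic_near; near=> z; apply: fg; near: z.
  exact: open_nbhs_nbhs.
have xi_an : analytic_at xi (base (base w)).
  by apply: near2 (sl ix _ _ Ju0 D2z) => z /(ev z u0 Ju0)[].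
have z1_an : analytic_at zeta1 (base (base w)).
  apply: near2 (analyticZ (u1 - u0)^-1 (analyticB (sl iu _ _ Ju1 D2z) (sl iu _ _ Ju0 D2z))).
  move=> z D2z'; rewrite (ev z u1 Ju1 D2z').2 (ev z u0 Ju0 D2z').2.
  by rewrite -[RHS](mulKf u01); congr (_ * _); ring.
have z0_an : analytic_at zeta0 (base (base w)).
  apply: near2 (analyticB (sl iu _ _ Ju0 D2z) (analyticM z1_an (analytic_cst u0 _))).
  by move=> z D2z'; rewrite (ev z u0 Ju0 D2z').2; ring.
have [[_ bx] _] := ider_base xi_an.
have [[_ b1x] b1u] := ider_base z1_an; have [[_ b0x] b0u] := ider_base z0_an.
have Ueq y : D y -> coordf Q iu y = zeta1 (base y) * y 0 iu + zeta0 (base y).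
  by move=> Dy; rewrite QE'// mxE.
have Xeq y : D y -> coordf Q ix y = xi (base y) by move=> Dy; rewrite QE'// mxE.
have Xx : pd ix (coordf Q ix) (base w) = pd ix xi (base (base w)).
  by rewrite (pd_eq_on ix D_open Xeq Dz); case: bx.
have Ux : pd ix (coordf Q iu) (base w) =
    pd ix zeta1 (base (base w)) * w 0 iu + pd ix zeta0 (base (base w)).
  rewrite (pd_eq_on ix D_open Ueq Dz).
  have [_ ->] := iderD (iderM b1x (ider_coord iu (base w) ix)) b0x.
  by rewrite -[ix == iu]/false mulr0 add0r base4 mulrC.
have Uu : pd iu (coordf Q iu) (base w) = zeta1 (base (base w)).
  rewrite (pd_eq_on iu D_open Ueq Dz).
  have [_ ->] := iderD (iderM b1u (ider_coord iu (base w) iu)) b0u.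
  by rewrite eqxx mulr0 addr0 mulr1 addr0.
apply/rowP => k; rewrite [RHS]mxE; case: (I4P k) => ->.
- rewrite -{1}n1 row_ext_ind; have := QE' _ it Dz; rewrite /coordf => ->.
  by rewrite mxE /= base4.
- rewrite -{1}n2 row_ext_ind; have := QE' _ ix Dz; rewrite /coordf => ->.
  by rewrite mxE.
- rewrite -{1}n3 row_ext_ind; have := QE' _ iu Dz; rewrite /coordf => ->.
  by rewrite mxE /= base4.
- rewrite -{1}n4 row_ext_dep /afl n4 Ux Uu Xx /=.
  by move: (zeta1 _) => z1; atomize; ring.
Unshelve. all: by end_near. Qed.

Lemma lie_part : exists Lam : vfield R 3 -> vfield R 4,
  [/\ lie_isomorphism D (lie_algebra (eqL A B C) D) D' (lie_algebra (eqDE0 A B C) D') Lam,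
      forall Q, lie_algebra (eqL A B C) D Q ->
        exists (tau : R -> R) (xi zeta1 zeta0 : 'rV[R]_2 -> R),
          {in D, Q =1 opQ tau xi zeta1 zeta0}
    & forall Q (tau : R -> R) (xi zeta1 zeta0 : 'rV[R]_2 -> R),
        lie_algebra (eqL A B C) D Q -> {in D, Q =1 opQ tau xi zeta1 zeta0} ->
        {in D', Lam Q =1 opQ0 tau xi zeta1 zeta0}].
Proof.
exists (@lift_field R); split; [split| |].
- exact: lift_mem.
- exact: lift_linear.
- exact: lift_bracket.
- exact: lift_inj.
- exact: lift_surj.
- exact: lie_algebra_opQ.
- exact: lift_opQ.
Qed.

End LieIsomorphism.

(** * Point symmetries *)

Section JetTransformations.
Context {R : realType}.
Variable n : nat.
Implicit Types (f : 'rV[R]_n.+1 -> 'rV[R]_n.+1) (w : 'rV[R]_n.+1) (p : 'rV[R]_n).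

Lemma sum_ind_dep (F : 'I_n.+1 -> R) : \sum_m F m = F (dep n) + \sum_k F (ind k).
Proof.
rewrite (bigD1 (dep n))//=; congr (_ + _).
rewrite (reindex_omap (@ind n) (unlift ord_max)) => [|k kd]; last first.
  by have [[i ->]|E] := indP k; [rewrite /ind liftK|rewrite E eqxx in kd].
by apply: eq_bigl => i; rewrite ind_neq_dep/= /ind liftK eqxx.
Qed.


Local Opaque pd ind dep.

(** Transposed with respect to the usual convention: rows are variables, as in [tot_jacobian], and
    the chain rule multiplies from left to right. *)
Definition jacobian f w : 'M[R]_n.+1 := \matrix_(j, m) pd j (coordf f m) w.

Definition tot_jacobian f w p : 'M[R]_n :=
  \matrix_(i, k) tot1 p (coordf f (ind k)) i w.

Definition new_slope f w p : 'rV[R]_n :=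
  (invmx (tot_jacobian f w p) *m \col_i tot1 p (coordf f (dep n)) i w)^T.

(** The second-order prolongation equations read [Q + kap P = J P' J^T]: this is [kap], the
    coefficient of the old second derivatives, and [hess_rest] is [Q]. *)
Definition hess_factor f w (p' : 'rV[R]_n) : R :=
  pd (dep n) (coordf f (dep n)) w - \sum_k p' 0 k * pd (dep n) (coordf f (ind k)) w.

Definition hess_rest f w p (p' : 'rV[R]_n) : 'M[R]_n :=
  \matrix_(i, j) (tot2 p 0 (coordf f (dep n)) i j w
    - \sum_k p' 0 k * tot2 p 0 (coordf f (ind k)) i j w).

Lemma tot2_split p P (F : 'rV[R]_n.+1 -> R) i j w :
  tot2 p P F i j w = tot2 p 0 F i j w + P i j * pd (dep n) F w.
Proof.
have z : (0 : 'M[R]_n) i j = 0 by rewrite mxE.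
unfold tot2; rewrite z; clear z; atomize; ring.
Qed.

Lemma new_slopeP f w p i : tot_jacobian f w p \in unitmx ->
  tot1 p (coordf f (dep n)) i w =
  \sum_k new_slope f w p 0 k * tot1 p (coordf f (ind k)) i w.
Proof.
move=> Ju; have := mulKVmx Ju (\col_i tot1 p (coordf f (dep n)) i w).
move=> /matrixP/(_ i 0); rewrite !mxE => <-; apply: eq_bigr => k _.
by rewrite /new_slope !mxE mulrC.
Qed.

Lemma prolongsP f w p P p' P' : prolongs f w p P p' P' <->
  [/\ tot_jacobian f w p \in unitmx, p' = new_slope f w p &
   hess_rest f w p p' + hess_factor f w p' *: P =
   tot_jacobian f w p *m P' *m (tot_jacobian f w p)^T].
Proof.
have det0 : (\det (tot_jacobian f w p) != 0) = (tot_jacobian f w p \in unitmx).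
  by rewrite unitmxE unitfE.
have H p1 i j : tot2 p P (coordf f (dep n)) i j w
    - \sum_k p1 0 k * tot2 p P (coordf f (ind k)) i j w =
    hess_rest f w p p1 i j + hess_factor f w p1 * P i j.
  rewrite mxE tot2_split /hess_factor mulrBl mulr_suml.
  under eq_bigr do rewrite tot2_split mulrDr.
  rewrite big_split/= opprD addrACA [P i j * _]mulrC; congr (_ + (_ - _)).
  by apply: eq_bigr => k _; rewrite mulrCA mulrC.
have K i j : (tot_jacobian f w p *m P' *m (tot_jacobian f w p)^T) i j =
    \sum_k \sum_l P' k l * tot1 p (coordf f (ind k)) i w * tot1 p (coordf f (ind l)) j w.
  rewrite mxE exchange_big/=; apply: eq_bigr => l _; rewrite !mxE mulr_suml.
  by apply: eq_bigr => k _; rewrite !mxE; ring.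
split=> [[]|[Ju -> E]].
  rewrite det0 => Ju h1 h2; have p'E : p' = new_slope f w p.
    apply/rowP => k; rewrite /new_slope !mxE.
    have E : \col_i tot1 p (coordf f (dep n)) i w = tot_jacobian f w p *m p'^T.
      apply/colP => i; rewrite !mxE h1; apply: eq_bigr => l _.
      by rewrite !mxE mulrC.
    have -> : p' 0 k = (invmx (tot_jacobian f w p) *m (tot_jacobian f w p *m p'^T)) k 0.
      by rewrite mulKmx// mxE.
    by rewrite -E mxE.
  split=> //; apply/matrixP => i j; rewrite K lineE -H h2.
  by rewrite addrAC subrr add0r.
split; first by rewrite det0.
  by move=> i; exact: new_slopeP.
move=> i j; rewrite -K -E lineE -H.
by rewrite addrC subrK.
Qed.

Lemma jacobian_unit f (h : 'rV[R]_n.+1 -> 'rV[R]_n.+1) w :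
  (forall k, analytic_at (coordf f k) w) -> (forall k, analytic_at (coordf h k) (f w)) ->
  (\forall y \near w, h (f y) = y) -> jacobian f w *m jacobian h (f w) = 1%:M.
Proof.
move=> fa ha hf; apply/matrixP => i k; rewrite !mxE.
have E : pd i (coordf h k \o f) w = (i == k)%:R.
  rewrite -(pd_coord i k w); apply: pd_near.
  by move: hf; apply: filterS => y; rewrite /coordf /= => ->.
rewrite -E (pd_comp i fa (ha k)); apply: eq_bigr => m _.
by rewrite !mxE.
Qed.

Section Point.
Variables (f : 'rV[R]_n.+1 -> 'rV[R]_n.+1) (w : 'rV[R]_n.+1).
Hypothesis Jf : jacobian f w \in unitmx.

(** If the factor vanished, the column [(-p', 1)] would lie in the kernel of the full Jacobian. *)
Lemma hess_factor_neq0 p : tot_jacobian f w p \in unitmx ->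
  hess_factor f w (new_slope f w p) != 0.
Proof.
move=> Ju; apply/eqP => k0; set p' := new_slope f w p in k0 *.
pose c : 'cV[R]_n.+1 := \col_m (if unlift ord_max m is Some k then - p' 0 k else 1).
have cind k : c (ind k) 0 = - p' 0 k by rewrite mxE liftK.
have cdep : c (dep n) 0 = 1 by rewrite mxE unlift_none.
have Udep : pd (dep n) (coordf f (dep n)) w =
    \sum_k p' 0 k * pd (dep n) (coordf f (ind k)) w by exact: subr0_eq k0.
have E : jacobian f w *m c = 0.
  apply/colP => j; rewrite mxE sum_ind_dep cdep mulr1 mxE.
  under eq_bigr do rewrite cind mulrN mxE mulrC.
  rewrite sumrN; have [[i ->]|->] := indP j; last by rewrite Udep subrr mxE.
  have := new_slopeP i Ju; rewrite /tot1 -/p'.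
  under [in X in _ = X -> _]eq_bigr do rewrite mulrDr.
  rewrite big_split/= Udep => h; rewrite mxE; apply/eqP; rewrite subr_eq0; apply/eqP.
  apply: (addIr (p 0 i * \sum_k p' 0 k * pd (dep n) (coordf f (ind k)) w)).
  rewrite h; congr (_ + _); rewrite mulr_sumr; apply: eq_bigr => k _.
  by rewrite mulrCA.
have : c = 0 by rewrite -(mulKmx Jf c) E mulmx0.
by move/colP/(_ (dep n)); rewrite cdep mxE => /eqP; rewrite oner_eq0.
Qed.

(* Vanishes exactly on the slopes at which the total Jacobian is singular. *)
Definition slope_test p : R :=
  invmx (jacobian f w) (dep n) (dep n) - \sum_i invmx (jacobian f w) (dep n) (ind i) * p 0 i.

Lemma slope_test_unit p : slope_test p != 0 -> tot_jacobian f w p \in unitmx.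
Proof.
apply: contraR; rewrite -row_free_unit -kermx_eq0 => /rowV0Pn[v /sub_kermxP vJ v0].
(* A left null vector of the total Jacobian extends to a row that the full Jacobian maps to a
   multiple of the last unit row, hence to a multiple of the last row of the inverse; the extension
   rule then says that the test vanishes. *)
apply/eqP; pose u : 'rV[R]_n.+1 := row_ext v (\sum_i v 0 i * p 0 i).
pose c := (u *m jacobian f w) 0 (dep n).
have uJ : u *m jacobian f w = c *: delta_mx 0 (dep n).
  apply/rowP => m; rewrite [RHS]mxE [delta_mx _ _ _ _]mxE eqxx/=.
  have [[k ->]|->] := indP m; last by rewrite eqxx mulr1.
  rewrite ind_neq_dep mulr0; transitivity ((v *m tot_jacobian f w p) 0 k);
    last by rewrite vJ mxE.
  rewrite !mxE.
  rewrite [LHS]sum_ind_dep row_ext_dep mxE mulr_suml -big_split/=.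
  apply: eq_bigr => i _; rewrite row_ext_ind !mxE /tot1.
  by rewrite mulrDr addrC mulrA.
have uE : u = c *: row (dep n) (invmx (jacobian f w)).
  by rewrite -(mulmxK Jf u) uJ -scalemxAl rowE.
have c0 : c != 0.
  apply: contraNneq v0 => c0; apply/eqP/rowP => i.
  by rewrite -(row_ext_ind v (\sum_i v 0 i * p 0 i)) -/u uE c0 scale0r !mxE.
have ui i : v 0 i = c * invmx (jacobian f w) (dep n) (ind i).
  by rewrite -(row_ext_ind v (\sum_i v 0 i * p 0 i)) -/u uE !mxE.
have ud : \sum_i v 0 i * p 0 i = c * invmx (jacobian f w) (dep n) (dep n).
  by rewrite -(row_ext_dep v (\sum_i v 0 i * p 0 i)) -/u uE !mxE.
apply: (mulfI c0); rewrite mulr0 mulrBr -ud mulr_sumr; apply/eqP; rewrite subr_eq0.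
by apply/eqP/eq_bigr => i _; rewrite ui mulrA.
Qed.

(** The test is affine in [p], with the last row of an invertible matrix as coefficients. If the
    constant term is 0, the coefficient vector [k] itself gives minus its sum of squares. *)
Lemma slope_test_nonzero : exists p, slope_test p != 0.
Proof.
have [k0|k0] := eqVneq (invmx (jacobian f w) (dep n) (dep n)) 0; last first.
  exists 0; rewrite /slope_test big1 ?subr0// => i _.
  by rewrite [X in _ * X]mxE mulr0.
pose k : 'rV[R]_n := \row_i invmx (jacobian f w) (dep n) (ind i).
exists k; rewrite /slope_test k0 sub0r oppr_eq0; apply/eqP => s0.
have ki i : invmx (jacobian f w) (dep n) (ind i) = 0.
  have sq j : 0 <= invmx (jacobian f w) (dep n) (ind j) * k 0 j.
    by rewrite mxE -expr2 sqr_ge0.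
  have /eqP := psumr_eq0P (fun j _ => sq j) s0 (i := i) isT.
  by rewrite mxE mulf_eq0 orbb => /eqP.
have r0 : row (dep n) (invmx (jacobian f w)) = 0.
  by apply/rowP => m; rewrite !mxE; have [[i ->]|->] := indP m.
have : row (dep n) (invmx (jacobian f w) *m jacobian f w) 0 (dep n) = 0.
  by rewrite row_mul r0 mul0mx mxE.
by rewrite mulVmx// !mxE eqxx => /eqP; rewrite oner_eq0.
Qed.

(** Along the line the test is its value at [p0] minus [s * k], so it cannot vanish while [|s|] is
    below that value's modulus divided by [|k| + 1]. *)
Lemma generic_slopes i0 : exists p0 (e : R), 0 < e /\
  forall s : R, `|s| < e -> tot_jacobian f w (p0 + s *: delta_mx 0 i0) \in unitmx.
Proof.
have [p0 q0] := slope_test_nonzero; exists p0.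
pose k := invmx (jacobian f w) (dep n) (ind i0).
have E s : slope_test (p0 + s *: delta_mx 0 i0) = slope_test p0 - s * k.
  rewrite /slope_test -addrA -opprD; congr (_ - _).
  under eq_bigr do rewrite lineE mulrDr.
  rewrite big_split/=; congr (_ + _); rewrite (bigD1 i0)//= big1 => [|i ii0].
    by rewrite mxE !eqxx mulr1 addr0 mulrC.
  by rewrite mxE (negbTE ii0) andbF !mulr0.
exists (`|slope_test p0| / (`|k| + 1)).
have k1 : 0 < `|k| + 1 by rewrite ltr_wpDl.
split=> [|s se]; first by rewrite divr_gt0 ?normr_gt0.
apply: slope_test_unit; rewrite E subr_eq0; apply/eqP => qs.
have : `|s| * (`|k| + 1) < `|slope_test p0| by rewrite -ltr_pdivlMr.
by rewrite qs normrM mulrDr mulr1 ltNge lerDl normr_ge0.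
Qed.

Definition quad (v : 'rV[R]_n) (P : 'M[R]_n) : R := (v *m P *m v^T) 0 0.

Lemma quadZ v (s : R) P : quad v (s *: P) = s * quad v P.
Proof. by rewrite /quad -scalemxAr -scalemxAl mxE. Qed.

Lemma quadB v P Q : quad v (P - Q) = quad v P - quad v Q.
Proof. by rewrite /quad mulmxBr mulmxBl !mxE. Qed.

Lemma quadD v P Q : quad v (P + Q) = quad v P + quad v Q.
Proof. by rewrite /quad mulmxDr mulmxDl mxE. Qed.

Lemma quad_congr v M P : quad v (M *m P *m M^T) = quad (v *m M) P.
Proof. by rewrite /quad trmx_mul !mulmxA. Qed.

Lemma quad_square v (u : 'rV[R]_n) : quad v (u^T *m u) = (\sum_k v 0 k * u 0 k) ^+ 2.
Proof.
rewrite /quad mulmxA -mulmxA -[v *m u^T]trmxK trmx_mul trmxK.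
have E : (u *m v^T) 0 0 = \sum_k v 0 k * u 0 k.
  by rewrite mxE; apply: eq_bigr => k _; rewrite mxE mulrC.
by rewrite mxE big_ord1 [_^T _ _]mxE E.
Qed.

Hypothesis f_an : forall k, analytic_at (coordf f k) w.

Lemma hess_rest_sym p p' : (hess_rest f w p p')^T = hess_rest f w p p'.
Proof.
have tot2C F i j : analytic_at F w -> tot2 p 0 F i j w = tot2 p 0 F j i w.
  move=> Fw; unfold tot2; rewrite (pd_comm (ind i) (ind j) Fw).
  rewrite (pd_comm (dep n) (ind j) Fw) (pd_comm (ind i) (dep n) Fw).
  have z k l : (0 : 'M[R]_n) k l = 0 by rewrite mxE.
  by rewrite !z; atomize; ring.
apply/matrixP => i j; rewrite !mxE tot2C//; congr (_ - _).
by apply: eq_bigr => k _; rewrite tot2C.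
Qed.

(** Common abstraction of both equations at fixed points: lower-order part [l], leading part [a]
    times the square of the direction [v], and primed data at the image point. [k0] will be [ix],
    where [v'] has entry 1. *)
Variables (v v' : 'rV[R]_n) (a a' : R) (l l' : 'rV[R]_n -> R) (k0 : 'I_n).
Hypotheses (a0 : a != 0) (a'0 : a' != 0) (v'k0 : v' 0 k0 = 1).
Hypothesis f_sym : forall p P p' P', P^T = P -> P'^T = P' -> prolongs f w p P p' P' ->
  (l p - a * quad v P = 0 <-> l' p' - a' * quad v' P' = 0).
Variable p : 'rV[R]_n.
Hypothesis Ju : tot_jacobian f w p \in unitmx.
Notation J := (tot_jacobian f w p).
Notation p' := (new_slope f w p).
Notation kap := (hess_factor f w p').
Notation Q := (hess_rest f w p p').

(* The new jet [(p', P')] may be prescribed: the old [P] is then recovered from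
   [kap P + Q = J P' J^T]. *)
Lemma symmetry_transfer P' : P'^T = P' -> l' p' = a' * quad v' P' ->
  kap * l p = a * (quad (v *m J) P' - quad v Q).
Proof.
move=> P's F'; have kn := hess_factor_neq0 Ju.
pose P := kap^-1 *: (J *m P' *m J^T - Q).
have Ps : P^T = P.
  by rewrite /P linearZ/= linearB/= hess_rest_sym !trmx_mul trmxK P's mulmxA.
have pr : prolongs f w p P p' P'.
  apply/prolongsP; split=> //.
  by rewrite /P scalerA mulfV// scale1r addrC subrK.
have := (f_sym Ps P's pr).2; rewrite F' subrr => /(_ erefl)/subr0_eq ->.
by rewrite /P quadZ quadB quad_congr mulrCA mulVKf.
Qed.

(** Adding [u^T u] to [P'] with [u] orthogonal to [v'] keeps the new equation, hence must keep the
    old one, which changes by a multiple of the square of [(v J) . u]. So [v J] is parallel to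
    [v']. *)
Lemma symmetry_direction (u : 'rV[R]_n) : \sum_k v' 0 k * u 0 k = 0 -> \sum_k (v *m J) 0 k * u 0 k = 0.
Proof.
move=> vu; pose P0 : 'M[R]_n := (l' p' / a') *: ((delta_mx 0 k0 : 'rV[R]_n)^T *m delta_mx 0 k0).
have P0s : P0^T = P0 by rewrite /P0 linearZ/= trmx_mul trmxK.
have q1 : quad v' P0 = l' p' / a'.
  rewrite /P0 quadZ quad_square (bigD1 k0)//= big1 => [|k kk]; last first.
    by rewrite mxE (negbTE kk) andbF mulr0.
  by rewrite mxE !eqxx v'k0 mulr1 addr0 expr1n mulr1.
have h0 := symmetry_transfer P0s; have h1 := @symmetry_transfer (P0 + u^T *m u).
rewrite quadD quad_square vu expr0n addr0 q1 mulrCA mulfV// mulr1 in h1.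
rewrite q1 mulrCA mulfV// mulr1 in h0.
have s1 : (P0 + u^T *m u)^T = P0 + u^T *m u by rewrite linearD/= P0s trmx_mul trmxK.
have := etrans (esym (h0 erefl)) (h1 s1 erefl).
move=> /(mulfI a0); rewrite quadD quad_square addrAC -[X in X = _]addr0 => /addrI/esym/eqP.
by rewrite sqrf_eq0 => /eqP.
Qed.

(** Both equations solved for their leading parts at [P' = P0]: a relation between slopes alone,
    free of second-order jet variables. *)
Lemma symmetry_relation :
  a' * (kap * l p + a * quad v Q) = a * (l' p' * (v *m J) 0 k0 ^+ 2).
Proof.
(* Because [v'] has entry 1 at [k0], a single diagonal entry of [P'] is enough to satisfy the new
   equation. *)
pose P0 : 'M[R]_n := (l' p' / a') *: ((delta_mx 0 k0 : 'rV[R]_n)^T *m delta_mx 0 k0).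
have P0s : P0^T = P0 by rewrite /P0 linearZ/= trmx_mul trmxK.
have q1 (y : 'rV[R]_n) : quad y P0 = l' p' / a' * y 0 k0 ^+ 2.
  rewrite /P0 quadZ quad_square (bigD1 k0)//= big1 => [|k kk]; last first.
    by rewrite mxE (negbTE kk) andbF mulr0.
  by rewrite mxE !eqxx mulr1 addr0.
have h0 := symmetry_transfer P0s; rewrite !q1 v'k0 expr1n mulr1 mulrCA mulfV// mulr1 in h0.
rewrite (h0 erefl) mulrBr subrK mulrCA; congr (_ * _).
by rewrite mulrA (mulrCA a' _ a'^-1) mulfV// mulr1.
Qed.

End Point.
End JetTransformations.

(** * Point symmetries of the linear equation: sufficiency of the determining equations *)

Section LinearEquationGroup.
Context {R : realType}.
Variables (Om : set 'rV[R]_2) (A B C : 'rV[R]_2 -> R).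
Hypothesis A_neq0 : forall z, Om z -> A z != 0.

Local Opaque pd ind dep.

Lemma unitmx_ker n (J : 'M[R]_n) : (forall v : 'rV[R]_n, v *m J = 0 -> v = 0) -> J \in unitmx.
Proof.
move=> h; rewrite -row_free_unit -kermx_eq0; apply/negPn/negP => /rowV0Pn[v /sub_kermxP /h ->].
by rewrite eqxx.
Qed.

Lemma unitmx_row n (J : 'M[R]_n) i : J \in unitmx -> (forall k, J i k = 0) -> False.
Proof.
move=> Ju h; have r0 : row i J = 0 by apply/rowP => k; rewrite !mxE h.
have : (row i J *m invmx J) 0 i = 0 by rewrite r0 mul0mx mxE.
by rewrite -row_mul mulmxV// !mxE eqxx => /eqP; rewrite oner_eq0.
Qed.

Lemma unitmx_col n (J : 'M[R]_n) k : J \in unitmx -> (forall i, J i k = 0) -> False.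
Proof.
rewrite -unitmx_tr => Ju h; apply: (unitmx_row (i := k) Ju) => i.
by rewrite mxE.
Qed.

(* With [u_x = s] and [u_xx] eliminated, invariance of the equation is polynomial in
   [s]; [grp_e2] and [grp_e1] are its coefficients of degree 0 and 1. *)
Definition grp_e0 (g : 'rV[R]_3 -> 'rV[R]_3) w :=
  pd it (coordf g it) w * A (base (g w)) - pd ix (coordf g ix) w ^+ 2 * A (base w).

Definition grp_e1 (g : 'rV[R]_3 -> 'rV[R]_3) w :=
  let Uu := pd iu (coordf g iu) w in let Xx := pd ix (coordf g ix) w in
  Uu * (B (base w) * Xx - pd it (coordf g ix) w - pd it (coordf g it) w * B (base (g w)))
  - A (base w) * (2 * pd ix (pd iu (coordf g iu)) w * Xx - Uu * pd ix (pd ix (coordf g ix)) w).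

Definition grp_e2 (g : 'rV[R]_3 -> 'rV[R]_3) w :=
  let Uu := pd iu (coordf g iu) w in let Xx := pd ix (coordf g ix) w in
  let Ux := pd ix (coordf g iu) w in
  Xx * (pd it (coordf g iu) w + Uu * C (base w) * w 0 iu
        - pd it (coordf g it) w * C (base (g w)) * coordf g iu w)
  - Ux * (pd it (coordf g ix) w + pd it (coordf g it) w * B (base (g w)))
  - A (base w) * (pd ix (pd ix (coordf g iu)) w * Xx - Ux * pd ix (pd ix (coordf g ix)) w).

Definition grp_struct (D : set 'rV[R]_3) (g : 'rV[R]_3 -> 'rV[R]_3) := forall w, D w ->
  [/\ pd ix (coordf g it) w = 0 /\ pd iu (coordf g it) w = 0,
      pd iu (coordf g ix) w = 0, pd iu (pd iu (coordf g iu)) w = 0,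
      [/\ pd it (coordf g it) w != 0, pd ix (coordf g ix) w != 0 & pd iu (coordf g iu) w != 0]
    & [/\ grp_e0 g w = 0, grp_e1 g w = 0 & grp_e2 g w = 0]].

Variables (D : set 'rV[R]_3) (g : 'rV[R]_3 -> 'rV[R]_3).
Hypotheses (D_open : open D) (g_an : analytic_map_on D g).
Hypotheses (D_Om : forall w, D w -> Om (base w)) (gD_Om : forall w, D w -> Om (base (g w))).

Lemma grp_struct_symmetry : grp_struct D g -> forall w p P p' P', D w -> P^T = P -> P'^T = P' ->
  prolongs g w p P p' P' -> (eqL A B C w p P = 0 <-> eqL A B C (g w) p' P' = 0).
Proof.
move=> gs w p P p' P' Dw _ _ [_ h1 h2].
have tx y : D y -> pd ix (coordf g it) y = 0 by move=> /gs[[]].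
have tu y : D y -> pd iu (coordf g it) y = 0 by move=> /gs[[]].
have xu y : D y -> pd iu (coordf g ix) y = 0 by move=> /gs[].
have [_ _ uu [Tt Xx Uu] [e0 e1 e2]] := gs w Dw.
have := (h2 ix ix, h1 ix, h1 it).
rewrite !sum_I2 !ind2 !tot1_2 !tot2_2 /eqL.
have gu : g w 0 iu = coordf g iu w by [].
rewrite gu; move: e0 e1 e2; rewrite /grp_e0 /grp_e1 /grp_e2; cbv zeta.
move: (tx w Dw) (tu w Dw) (pd_eq_cst ix D_open tx Dw) (pd_eq_cst iu D_open tx Dw)
  (pd_eq_cst ix D_open tu Dw) (pd_eq_cst iu D_open tu Dw)
  (xu w Dw) (pd_eq_cst ix D_open xu Dw) (pd_eq_cst iu D_open xu Dw)
  (pd_comm iu ix (g_an ix Dw)) (pd_comm iu ix (g_an iu Dw)) uu.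
move: (pd it (coordf g it) w) Tt (pd ix (coordf g ix) w) Xx (pd iu (coordf g iu) w) Uu
  (A (base w)) (A (base (g w))) (p 0 it) (p 0 ix) (P ix ix) (p' 0 it) (p' 0 ix) (P' ix ix)
  (pd it (coordf g ix) w) (pd ix (pd ix (coordf g ix)) w) (B (base (g w)))
  => Tt Tt0 Xx Xx0 Uu Uu0 a a' pt px b pt' px' b' Xt Xxx B'.
atomize_app B; atomize_app C; clear -Tt0 Xx0 Uu0; atomize; atomize_app (coordf g iu).
subst_facts; move=> e0 e1 e2 [[h3 h2] h1].
(* The two equations are proportional on prolonged jets, [T_t F' = U_u F], with both factors
   nonzero; the common factor [X_x] clears denominators. The combination below uses the prolongation
   equations for [D_t], [D_x] and [D_x D_x]. *)
match goal with |- ?F = 0 <-> ?F' = 0 =>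
  have key : Xx * (Tt * F') = Xx * (Uu * F) end.
  apply/eqP; rewrite -subr_eq0; apply/eqP.
  match type of e0 with ?t0 = 0 => match type of e1 with ?t1 = 0 =>
  match type of e2 with ?t2 = 0 => match type of h1 with ?l1 = ?r1 =>
  match type of h2 with ?l2 = ?r2 => match type of h3 with ?l3 = ?r3 =>
  transitivity (t2 + px * t1 - Xx * b' * t0 - Xx * (l1 - r1) + a * Xx * (l3 - r3)
    - (a * Xxx - Xt - Tt * B') * (l2 - r2)) end end end end end end.
    by clear; ring.
  by rewrite e0 e1 e2 h1 h2 h3 !subrr !mulr0 !addr0 !subr0.
move: key => /(mulfI Xx0) key; split=> h; rewrite h mulr0 in key.
  by apply: (mulfI Tt0); rewrite key mulr0.
by apply: (mulfI Uu0); rewrite -key mulr0.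
Qed.

End LinearEquationGroup.

(** * Point symmetries of the linear equation: necessity *)

Section LinearEquationConverse.
Context {R : realType}.
Variables (Om : set 'rV[R]_2) (A B C : 'rV[R]_2 -> R).
Hypothesis A_neq0 : forall z, Om z -> A z != 0.

Local Opaque pd ind dep.

Lemma quad_delta n (i : 'I_n) (P : 'M[R]_n) : quad (delta_mx 0 i) P = P i i.
Proof. by rewrite /quad -rowE trmx_delta -colE !mxE. Qed.

Lemma quadratic_zero_ball (e a b c : R) : 0 < e ->
  (forall s, `|s| < e -> a + s * b + s ^+ 2 * c = 0) -> [/\ a = 0, b = 0 & c = 0].
Proof.
move=> e0 h; apply: (@quadratic_zero _ (ball (0 : R) e)); first exact: ball_open.
  by exists 0; exact: ballxx.
by move=> s; rewrite /ball/= sub0r normrN; exact: h.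
Qed.

Lemma affine_zero_ball (e a b : R) : 0 < e ->
  (forall s, `|s| < e -> a + s * b = 0) -> a = 0 /\ b = 0.
Proof.
move=> e0 h; have [|//] := @quadratic_zero_ball e a b 0 e0.
by move=> s /h; rewrite mulr0 addr0.
Qed.

Lemma sum_delta n (x : 'rV[R]_n) j : \sum_k x 0 k * (delta_mx 0 j : 'rV[R]_n) 0 k = x 0 j.
Proof.
rewrite (bigD1 j)//= big1 => [|k kj]; first by rewrite mxE !eqxx mulr1 addr0.
by rewrite mxE (negbTE kj) andbF mulr0.
Qed.

Variables (D : set 'rV[R]_3) (g : 'rV[R]_3 -> 'rV[R]_3).
Hypotheses (D_open : open D) (g_an : analytic_map_on D g).
Hypotheses (D_Om : forall w, D w -> Om (base w)) (gD_Om : forall w, D w -> Om (base (g w))).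
Hypothesis g_unit : forall w, D w -> jacobian g w \in unitmx.
Hypothesis g_sym : forall w p P p' P', D w -> P^T = P -> P'^T = P' ->
  prolongs g w p P p' P' -> (eqL A B C w p P = 0 <-> eqL A B C (g w) p' P' = 0).

Let lin (w : 'rV[R]_3) (p : 'rV[R]_2) := p 0 it - (B (base w) * p 0 ix + C (base w) * w 0 iu).

Let sym_lin w : D w -> forall p P p' P', P^T = P -> P'^T = P' -> prolongs g w p P p' P' ->
  (lin w p - A (base w) * quad (delta_mx 0 ix) P = 0 <->
   lin (g w) p' - A (base (g w)) * quad (delta_mx 0 ix) P' = 0).
Proof.
move=> Dw p P p' P' Ps P's pr; have := g_sym Dw Ps P's pr.
by rewrite !quad_delta /lin -!addrA -!opprD !(addrC (B _ * _ + _)) !addrA.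
Qed.

Let an w : D w -> forall k, analytic_at (coordf g k) w.
Proof. by move=> Dw k; apply: g_an. Qed.

Let one_ix : (delta_mx 0 ix : 'rV[R]_2) 0 ix = 1.
Proof. by rewrite mxE !eqxx. Qed.

(** The [t]-axis is orthogonal to [v' = (0, 1)], so the [t]-entry of [v J], which is [D_x T],
    vanishes. *)
Let direction w p : D w -> tot_jacobian g w p \in unitmx ->
  pd ix (coordf g it) w + p 0 ix * pd iu (coordf g it) w = 0.
Proof.
move=> Dw Ju.
have := symmetry_direction (g_unit Dw) (an Dw) (A_neq0 (D_Om Dw)) (A_neq0 (gD_Om Dw))
  one_ix (sym_lin Dw) Ju (u := delta_mx 0 it).
rewrite !sum_delta mxE/= => /(_ erefl); rewrite -rowE mxE [tot_jacobian _ _ _ _ _]mxE !ind2 tot1_2; apply.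
Qed.

Let line_ix (p0 : 'rV[R]_2) (s : R) :
  ((p0 + s *: delta_mx 0 ix) 0 it = p0 0 it) * ((p0 + s *: delta_mx 0 ix) 0 ix = p0 0 ix + s).
Proof. by rewrite !lineE !mxE !eqxx/= mulr0 mulr1 addr0. Qed.

(** [T_x + u_x T_u] is affine in [u_x] and vanishes on a whole interval of admissible slopes. *)
Let T0 w : D w -> pd ix (coordf g it) w = 0 /\ pd iu (coordf g it) w = 0.
Proof.
move=> Dw; have [p0 [e [e0 h]]] := generic_slopes (g_unit Dw) ix.
have [E tu] : pd ix (coordf g it) w + p0 0 ix * pd iu (coordf g it) w = 0 /\
    pd iu (coordf g it) w = 0.
  apply: (affine_zero_ball e0) => s /h /(direction Dw).
  by rewrite !line_ix mulrDl addrA.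
by move: E; rewrite tu mulr0 addr0.
Qed.

Let slope w p : D w -> tot_jacobian g w p \in unitmx ->
  [/\ pd it (coordf g it) w != 0, pd ix (coordf g ix) w + p 0 ix * pd iu (coordf g ix) w != 0,
      new_slope g w p 0 ix * (pd ix (coordf g ix) w + p 0 ix * pd iu (coordf g ix) w)
        = pd ix (coordf g iu) w + p 0 ix * pd iu (coordf g iu) w &
      new_slope g w p 0 it * pd it (coordf g it) w
        = pd it (coordf g iu) w + p 0 it * pd iu (coordf g iu) w
          - new_slope g w p 0 ix * (pd it (coordf g ix) w + p 0 it * pd iu (coordf g ix) w)].
Proof.
move=> Dw Ju; have [tx tu] := T0 Dw.
have [h1 h2] := (new_slopeP it Ju, new_slopeP ix Ju).
move: h1 h2; rewrite !sum_I2 !ind2 !tot1_2 tx tu => h1 h2; split.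
- apply/eqP => tt; apply: (unitmx_col (k := it) Ju) => i.
  by rewrite mxE ind2; have [->|->] := I2P i; rewrite tot1_2 ?tt ?tx tu mulr0 addr0.
- apply/eqP => xx; apply: (unitmx_row (i := ix) Ju) => i.
  by rewrite mxE; have [->|->] := I2P i; rewrite ind2 tot1_2 ?tx ?tu ?mulr0 ?addr0.
- by rewrite h2 mulr0 addr0 mulr0 add0r.
- by rewrite h1 mulr0 addr0 addrK.
Qed.

Let slopeE w (p : 'rV[R]_2) : D w -> pd it (coordf g it) w != 0 ->
  pd ix (coordf g ix) w + p 0 ix * pd iu (coordf g ix) w != 0 ->
  tot_jacobian g w p \in unitmx.
Proof.
move=> Dw tt xx; have [tx tu] := T0 Dw; apply: unitmx_ker => v /rowP vJ.
have := (vJ it, vJ ix); rewrite !mxE !sum_I2 ![tot_jacobian _ _ _ _ _]mxE !ind2 !tot1_2 tx tu.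
rewrite !mulr0 !addr0 mulr0 addr0 => -[/eqP].
rewrite mulf_eq0 (negbTE tt) orbF => /eqP v0; rewrite v0 mul0r add0r => /eqP.
rewrite mulf_eq0 (negbTE xx) orbF => /eqP v1.
by apply/rowP => k; rewrite mxE; have [->|->] := I2P k.
Qed.

Let relation w p : D w -> tot_jacobian g w p \in unitmx ->
  let p' := new_slope g w p in
  let Qx f := pd ix (pd ix f) w + 2 * (p 0 ix * pd ix (pd iu f) w)
    + p 0 ix ^+ 2 * pd iu (pd iu f) w in
  A (base (g w)) * ((pd iu (coordf g iu) w - p' 0 ix * pd iu (coordf g ix) w) * lin w p
     + A (base w) * (Qx (coordf g iu) - p' 0 ix * Qx (coordf g ix)))
  = A (base w) * (lin (g w) p' * (pd ix (coordf g ix) w + p 0 ix * pd iu (coordf g ix) w) ^+ 2).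
Proof.
move=> Dw Ju p' Qx; have [tx tu] := T0 Dw.
have txx : pd ix (pd ix (coordf g it)) w = 0 by apply: (pd_eq_cst ix D_open (fun y Dy => (T0 Dy).1)).
have txu : pd ix (pd iu (coordf g it)) w = 0 by apply: (pd_eq_cst ix D_open (fun y Dy => (T0 Dy).2)).
have tux : pd iu (pd ix (coordf g it)) w = 0 by apply: (pd_eq_cst iu D_open (fun y Dy => (T0 Dy).1)).
have tuu : pd iu (pd iu (coordf g it)) w = 0 by apply: (pd_eq_cst iu D_open (fun y Dy => (T0 Dy).2)).
have := symmetry_relation (g_unit Dw) (an Dw) (A_neq0 (gD_Om Dw))
  one_ix (sym_lin Dw) Ju.
rewrite quad_delta -rowE [row _ _ _ _]mxE [tot_jacobian _ _ _ _ _]mxE !ind2 !tot1_2.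
rewrite [hess_rest _ _ _ _ _ _]mxE /hess_factor !sum_I2 !ind2 !tot2_2 -/p' tu txx txu tux tuu.
rewrite (pd_comm iu ix (an Dw iu)) (pd_comm iu ix (an Dw ix)) ![(0 : 'M[R]_2) _ _]mxE /Qx.
move: (lin w p) (lin (g w) p') (A (base w)) (A (base (g w))) => l l' a a'.
atomize; move=> h; rewrite -[RHS]h; ring.
Qed.

(** Raising [u_t] by 1 keeps [D_x X], the new [x]-slope and the second-order remainder, so
    subtracting the two relations leaves only the change of the [t]-slopes. *)
Let leading w p : D w -> tot_jacobian g w p \in unitmx ->
  A (base (g w)) * pd it (coordf g it) w =
  A (base w) * (pd ix (coordf g ix) w + p 0 ix * pd iu (coordf g ix) w) ^+ 2.
Proof.
move=> Dw Ju; have [tt xx qx qt] := slope Dw Ju.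
pose p1 := p + delta_mx 0 it; have p1x : p1 0 ix = p 0 ix by rewrite !mxE addr0.
have p1t : p1 0 it = p 0 it + 1 by rewrite !mxE.
have Ju1 : tot_jacobian g w p1 \in unitmx by apply: slopeE => //; rewrite p1x.
have [_ _ qx1 qt1] := slope Dw Ju1; have := (relation Dw Ju, relation Dw Ju1).
have k0 := hess_factor_neq0 (g_unit Dw) Ju.
move: k0 qx1 qt1; rewrite /lin /hess_factor sum_I2 !ind2 (T0 Dw).2 p1x p1t -{}qx => k0.
move=> /(mulIf xx) qx1; rewrite {}qx1; move: k0; rewrite mulr0 add0r.
move: (new_slope g w p1 0 it) (new_slope g w p 0 it) (new_slope g w p 0 ix) qt tt xx => q1 q qx.
cbv zeta; clear; move: (A (base w)) (A (base (g w))) => a a'.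
atomize_app B; atomize_app C; move: (p 0 it) (pd it (coordf g it) w) => pt Tt.
move: (pd ix (coordf g ix) w + _) => r; atomize_app (pd iu (coordf g iu)).
atomize_app (pd iu (coordf g ix)); atomize; move=> qt tt r0 k0 qt1 [R0 R1].
apply: (mulfI k0).
match type of R0 with ?m0 = ?n0 => match type of R1 with ?m1 = ?n1 =>
match type of qt with ?m2 = ?n2 => match type of qt1 with ?m3 = ?n3 =>
match goal with |- ?m = ?k =>
have E : m - k = (m1 - n1 - (m0 - n0)) * Tt + a * r ^+ 2 * (m3 - n3 - (m2 - n2)) by clear; ring
end end end end end.
by apply/subr0_eq; rewrite E R0 R1 qt qt1 !subrr !(mulr0, mul0r) addr0.
Qed.

(** The left side of [leading] does not involve [u_x]; the quadratic coefficient [A X_u^2] of the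
    right side must vanish. *)
Let leading0 w : D w ->
  [/\ pd it (coordf g it) w != 0, pd ix (coordf g ix) w != 0, pd iu (coordf g ix) w = 0 &
      grp_e0 A g w = 0].
Proof.
move=> Dw; have [p0 [e [e0 h]]] := generic_slopes (g_unit Dw) ix.
have Ju0 : tot_jacobian g w (p0 + 0 *: delta_mx 0 ix) \in unitmx by apply: h; rewrite normr0.
have [tt xx _ _] := slope Dw Ju0; have a0 := A_neq0 (D_Om Dw).
have := leading Dw Ju0; move: xx; rewrite line_ix addr0 /grp_e0.
set Xx := pd ix (coordf g ix) w; set Xu := pd iu (coordf g ix) w => xx E0.
have [_ _ X0] : [/\ A (base (g w)) * pd it (coordf g it) w
      - A (base w) * (Xx + p0 0 ix * Xu) ^+ 2 = 0,
    - (2 * A (base w) * (Xx + p0 0 ix * Xu) * Xu) = 0 & - (A (base w) * Xu ^+ 2) = 0].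
  apply: (quadratic_zero_ball e0) => s /h /(leading Dw).
  rewrite line_ix -/Xx -/Xu => E; apply/eqP; rewrite E -subr_eq0; apply/eqP.
  clear; generalize (p0 0 ix); move=> q; ring.
have {}X0 : Xu = 0.
  by move/eqP: X0; rewrite oppr_eq0 mulf_eq0 (negbTE a0) sqrf_eq0 => /eqP.
move: xx E0; rewrite X0 mulr0 addr0 => xx E0; split=> //.
by rewrite mulrC E0 mulrC subrr.
Qed.

Lemma symmetry_grp_struct : grp_struct A B C D g.
Proof.
move=> w Dw; have [tt xx xu e0] := leading0 Dw; have [tx tu] := T0 Dw.
have xu0 y : D y -> pd iu (coordf g ix) y = 0 by case/leading0.
have xuu : pd iu (pd iu (coordf g ix)) w = 0 by exact: (pd_eq_cst iu D_open xu0 Dw).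
have xxu : pd ix (pd iu (coordf g ix)) w = 0 by exact: (pd_eq_cst ix D_open xu0 Dw).
have Ju p : tot_jacobian g w p \in unitmx by apply: slopeE => //; rewrite xu mulr0 addr0.
have uu : pd iu (coordf g iu) w != 0.
  have := hess_factor_neq0 (g_unit Dw) (Ju 0).
  by rewrite /hess_factor sum_I2 !ind2 tu xu !mulr0 addr0 subr0.
have a0 := A_neq0 (D_Om Dw); have a'0 := A_neq0 (gD_Om Dw).
have [e2 e1 uuu] : [/\ - grp_e2 A B C g w = 0, - grp_e1 A B g w = 0 &
    A (base w) * pd ix (coordf g ix) w * pd iu (pd iu (coordf g iu)) w = 0].
  apply: (quadratic_zero_ball (ltr01 : 0 < 1)) => s _.
  (* With [X_u = 0] every slope is admissible. The coefficient of [u_t] is already settled by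
     [grp_e0], so [u_t = 0] is chosen and the relation becomes quadratic in [s]. *)
  have [p [pt px]] : exists p : 'rV[R]_2, p 0 it = 0 /\ p 0 ix = s.
    by exists (0 + s *: delta_mx 0 ix); rewrite !line_ix !mxE add0r.
  have := relation Dw (Ju p); have [_ _] := slope Dw (Ju p).
  move: e0; rewrite /grp_e0 /grp_e1 /grp_e2 /lin pt px xu xuu xxu; cbv zeta.
  have gu : g w 0 iu = coordf g iu w by [].
  rewrite gu; move: (new_slope g w _ 0 it) (new_slope g w _ 0 ix) (coordf g iu w) => qt qx U.
  move: (A (base w)) (A (base (g w))) a0 a'0 => a a' _ a'0.
  move: (pd it (coordf g it) w) (pd ix (coordf g ix) w) (pd it (coordf g ix) w)
    (pd ix (pd ix (coordf g ix)) w) (B (base (g w))) (C (base (g w))) => T X Xt Xxx B' C'.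
  clear -a'0; atomize; atomize_app B; atomize_app C; atomize.
  move=> e0 qxE qtE rel; apply: (mulfI a'0).
  match type of rel with ?m0 = ?n0 => match type of e0 with ?m1 = _ =>
  match type of qxE with ?m2 = ?n2 => match type of qtE with ?m3 = ?n3 =>
  match goal with |- ?m = _ => have E : m = X * (m0 - n0) - X * (qt - B' * qx - C' * U) * m1
    + a' * (m2 - n2) * (a * Xxx - Xt - T * B') + a' * X * (m3 - n3)
  end end end end end.
    by clear; ring.
  by rewrite E e0 rel qxE qtE !subrr !(mulr0, mul0r) subr0 !addr0.
have uuu0 : pd iu (pd iu (coordf g iu)) w = 0.
  by move/eqP: uuu; rewrite mulf_eq0 (mulf_eq0 (A _)) (negbTE a0) (negbTE xx) => /eqP.
move/eqP: e1; rewrite oppr_eq0 => /eqP e1; move/eqP: e2; rewrite oppr_eq0 => /eqP e2.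
exact: And5 (conj tx tu) xu uuu0 (And3 tt xx uu) (And3 e0 e1 e2).
Qed.

End LinearEquationConverse.

(** * Lifted transformations preserve the reduction equation *)

Section GroupLift.
Context {R : realType}.
(* [z0 + eta z1] is the invariance condition of the linear equation at
   [u_x = eta] divided by [X_x]; the multiplier of the reduction equation is its
   total derivative along [d_x + eta d_u + al d_eta], up to the equations of the
   prolongation. *)
Lemma lift_identity (A Ax Bw Bx Cw Cx A' Ax' B' Bx' C' Cx' u eta pt px pu Pxx Pxu Puu
  qt qx qu Qxx Qxu Quu T X Xt Xx2 Xtx U Ut a aT ax au axx axu b bt bx bxx : R) :
  let H := a + eta * b in
  let F := pt - (A * (Pxx + 2 * eta * Pxu + eta ^+ 2 * Puu) + Ax * (px + eta * pu)
    + (Bx * eta + Bw * px) + Cw * (eta - u * pu) + Cx * u) in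
  let F' := qt - (A' * (Qxx + 2 * H * Qxu + H ^+ 2 * Quu) + Ax' * (qx + H * qu)
    + (Bx' * H + B' * qx) + C' * (H - U * qu) + Cx' * U) in
  let al := px + eta * pu in
  let Ux := a * X in let Uu := b * X in
  let Uxx := ax * X + a * Xx2 in let Uxu := au * X in
  let Y := ax + eta * bx + eta * au + al * b in
  let e_u := au + pu * b - qu * Uu in
  let e_x := ax + eta * bx + px * b - (qx * X + qu * Ux) in
  let e_t := aT + eta * bt + pt * b - (qt * T + qx * Xt + qu * Ut) in
  let s_uu := Puu * b - Quu * Uu ^+ 2 in
  let s_xu := axu + pu * bx + Pxu * b - (qu * Uxu + Qxu * X * Uu + Quu * Ux * Uu) in
  let s_xx := axx + eta * bxx + 2 * px * bx + Pxx * b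
    - (qx * Xx2 + qu * Uxx + Qxx * X ^+ 2 + 2 * Qxu * X * Ux + Quu * Ux ^+ 2) in
  let e0 := T * A' - X ^+ 2 * A in
  let e0x := T * Ax' - 2 * Xx2 * A - X * Ax in
  let c := au * X - bx * X - b * Xx2 in
  let z0 := - (b * X * Cw * u) + A * X * ax - Ut + a * (Xt + T * B') + T * C' * U in
  let z1 := - (b * X * Bw) + A * X * (bx + au) + b * (Xt + T * B') in
  let z0x := - ((bx * X + b * Xx2) * Cw * u) - b * X * Cx * u + Ax * X * ax + A * Xx2 * ax
    + A * X * axx - (aT * X + a * Xtx) + ax * (Xt + T * B') + a * (Xtx + T * (Bx' * X))
    + T * (Cx' * X) * U + T * C' * Ux in
  let z0u := - (b * X * Cw) + A * X * axu - (bt * X + b * Xtx) + au * (Xt + T * B') + T * C' * Uu in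
  let z1x := - ((bx * X + b * Xx2) * Bw) - b * X * Bx + Ax * X * (bx + au) + A * Xx2 * (bx + au)
    + A * X * (bxx + axu) + bx * (Xt + T * B') + b * (Xtx + T * (Bx' * X)) in
  e_u = 0 -> e_x = 0 -> e_t = 0 -> s_uu = 0 -> s_xu = 0 -> s_xx = 0 -> e0 = 0 -> e0x = 0 ->
  c = 0 -> z0 = 0 -> z1 = 0 -> z0x = 0 -> z0u = 0 -> z1x = 0 -> X * (T * F' - b * F) = 0.
Proof.
move=> H F F' al Ux Uu Uxx Uxu Y e_u e_x e_t s_uu s_xu s_xx e0 e0x c z0 z1 z0x z0u z1x.
have -> : X * (T * F' - b * F) = - X * e_t - X * (Qxx + 2 * H * Qxu + H ^+ 2 * Quu) * e0
    + A * X * (s_xx + 2 * eta * s_xu + eta ^+ 2 * s_uu)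
    - e_x * (- Xt + A * Xx2 - T * Ax' - T * B') - X * e_u * (Bw * eta + Cw * u)
    + X * qu * (z0 + eta * z1) + X * qu * A * eta * c
    - (z0x + eta * z1x + eta * z0u + al * z1) - Y * e0x + A * al * c
    - eta * e_u * (- Xt + A * Xx2 - T * Ax' - T * B') + c * (Bw * eta + Cw * u).
  by rewrite /z0 /z1 /z0x /z0u /z1x /c /e0 /e0x /s_uu /s_xu /s_xx /e_u /e_x /e_t /Y /Uxx /Uxu
    /Ux /Uu /al /F /F' /H; ring.
do 14 move=> ->; ring.
Qed.


(* Unlike [ider], this also covers composites with [g], which are differentiable
   by the chain rule but not shown to be analytic. *)
Definition dder n (f : 'rV[R]_n -> R) w i d := is_derive w (delta_mx 0 i : 'rV[R]_n) f d.

Section Rules.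
Variable n : nat.
Implicit Types (f : 'rV[R]_n -> R) (w : 'rV[R]_n).

Lemma dderD f h w i d e : dder f w i d -> dder h w i e -> dder (fun y => f y + h y) w i (d + e).
Proof. exact: is_deriveD. Qed.

Lemma dderN f w i d : dder f w i d -> dder (fun y => - f y) w i (- d).
Proof. exact: is_deriveN. Qed.

Lemma dderM f h w i d e : dder f w i d -> dder h w i e ->
  dder (fun y => f y * h y) w i (f w * e + h w * d).
Proof. exact: is_deriveM. Qed.

Lemma dder_fun f w i : analytic_at f w -> dder f w i (pd i f w).
Proof. exact: analytic_is_derive. Qed.

Lemma dder_eq (D : set 'rV[R]_n) f h w i d e : open D -> (forall y, D y -> f y = h y) ->
  D w -> dder f w i d -> dder h w i e -> d = e.
Proof.
move=> Do fh Dw [_ <-] [_ <-]; exact: (pd_eq_on i Do fh Dw).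
Qed.

Lemma dder_comp m (g : 'rV[R]_m -> 'rV[R]_n) f b i :
  (forall k, analytic_at (coordf g k) b) -> analytic_at f (g b) ->
  dder (fun y => f (g y)) b i (\sum_k pd i (coordf g k) b * pd k f (g b)).
Proof.
move=> gb fb; apply: (@chain_rule R n _ g f b (delta_mx 0 i)).
  by move=> k; apply: (@analytic_differentiable R m (coordf g k) b); exact: gb.
exact: analytic_differentiable.
Qed.

End Rules.

Variables (Om : set 'rV[R]_2) (A B C : 'rV[R]_2 -> R).
Hypotheses (A_an : analytic_on Om A) (B_an : analytic_on Om B) (C_an : analytic_on Om C).
Variables (D : set 'rV[R]_3) (g : 'rV[R]_3 -> 'rV[R]_3) (a b : 'rV[R]_3 -> R).
Hypotheses (D_open : open D) (D_Om : forall w, D w -> Om (base w)).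
Hypotheses (g_an : analytic_map_on D g) (gD_Om : forall w, D w -> Om (base (g w))).
Hypothesis gs : grp_struct A B C D g.
Hypotheses (a_an : analytic_on D a) (b_an : analytic_on D b).
Notation T := (coordf g it).
Notation X := (coordf g ix).
Notation U := (coordf g iu).
(** [a = U_x / X_x] and [b = U_u / X_x], stated as products so that differentiating them needs no
    quotient rule. *)
Hypothesis aE : forall w, D w -> a w * pd ix X w = pd ix U w.
Hypothesis bE : forall w, D w -> b w * pd ix X w = pd iu U w.

Local Opaque pd ind dep.

Let tx w : D w -> pd ix T w = 0. Proof. by case/gs => -[]. Qed.
Let tu w : D w -> pd iu T w = 0. Proof. by case/gs => -[]. Qed.
Let xu w : D w -> pd iu X w = 0. Proof. by case/gs. Qed.
Let uu w : D w -> pd iu (pd iu U) w = 0. Proof. by case/gs. Qed.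
Let xx0 w : D w -> pd ix X w != 0. Proof. by case/gs => _ _ _ []. Qed.

Let dg k w i : D w -> dder (coordf g k) w i (pd i (coordf g k) w).
Proof. by move=> Dw; exact/dder_fun/g_an. Qed.
Let dpg k j w i : D w -> dder (pd j (coordf g k)) w i (pd i (pd j (coordf g k)) w).
Proof. by move=> Dw; exact/dder_fun/analytic_pd/g_an. Qed.

Lemma slope_coef_der w i : D w ->
  a w * pd i (pd ix X) w + pd ix X w * pd i a w = pd i (pd ix U) w /\
  b w * pd i (pd ix X) w + pd ix X w * pd i b w = pd i (pd iu U) w.
Proof.
move=> Dw; split.
  exact: (dder_eq D_open aE Dw (dderM (dder_fun i (a_an Dw)) (dpg ix ix i Dw)) (dpg iu ix i Dw)).
exact: (dder_eq D_open bE Dw (dderM (dder_fun i (b_an Dw)) (dpg ix ix i Dw)) (dpg iu iu i Dw)).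
Qed.

Let xxu w : D w -> pd iu (pd ix X) w = 0.
Proof.
move=> Dw; rewrite (pd_comm iu ix (g_an ix Dw)); exact: (pd_eq_cst ix D_open xu Dw).
Qed.

Let bu w : D w -> pd iu b w = 0.
Proof.
move=> Dw; have [_] := slope_coef_der iu Dw.
move: (xxu Dw) (uu Dw) (xx0 Dw); atomize; clear; move=> -> -> y0.
by rewrite mulr0 add0r => /eqP; rewrite mulf_eq0 (negbTE y0) => /eqP.
Qed.

Let au w : D w -> pd ix X w * pd iu a w = pd iu (pd ix U) w.
Proof. by move=> Dw; have [<- _] := slope_coef_der iu Dw; rewrite xxu// mulr0 add0r. Qed.

Let auu w : D w -> pd iu (pd iu a) w = 0.
Proof.
move=> Dw; have := dder_eq D_open au Dw
  (dderM (dpg ix ix iu Dw) (dder_fun iu (analytic_pd iu (a_an Dw))))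
  (dder_fun iu (analytic_pd iu (analytic_pd ix (g_an iu Dw)))).
have E : pd iu (pd iu (pd ix U)) w = 0.
  rewrite (pd_eq_on iu D_open (fun y Dy => pd_comm iu ix (g_an iu Dy)) Dw).
  rewrite (pd_comm iu ix (analytic_pd iu (g_an iu Dw))).
  exact: (pd_eq_cst ix D_open uu Dw).
move: E (xxu Dw) (xx0 Dw); atomize; clear; move=> -> -> y0.
by rewrite mulr0 addr0 => /eqP; rewrite mulf_eq0 (negbTE y0) => /eqP.
Qed.

Definition lift_map (y : 'rV[R]_4) : 'rV[R]_4 := row_ext (g (base y)) (afl a b y).

Lemma coordf_lift_map : (coordf lift_map it = T \o @base R 3) *
  (coordf lift_map ix = X \o @base R 3) * (coordf lift_map iu = U \o @base R 3) *
  (coordf lift_map ie = afl a b).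
Proof.
have [[[e1 e2] e3] e4] := ind3.
have E i j : ind i = j -> coordf lift_map j = coordf g i \o @base R 3.
  by move=> <-; apply/funext => y; rewrite /coordf /lift_map row_ext_ind.
split; [split; [split|]|]; [exact: E|exact: E|exact: E|].
by apply/funext => y; rewrite /coordf -e4 row_ext_dep.
Qed.

(** [drift0] and [drift1] are [grp_e2] and [grp_e1] divided by [- X_x], with [U_x], [U_u] expressed
    by [a], [b]. The second [x]-derivatives are absorbed into [a_x] and [b_x], since
    [U_xx X_x - U_x X_xx = X_x^2 a_x]. *)
Definition drift0 w := - (b w * pd ix X w * C (base w) * w 0 iu)
  + A (base w) * pd ix X w * pd ix a w - pd it U w
  + a w * (pd it X w + pd it T w * B (base (g w))) + pd it T w * C (base (g w)) * U w.

Definition drift1 w := - (b w * pd ix X w * B (base w))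
  + A (base w) * pd ix X w * (pd ix b w + pd iu a w)
  + b w * (pd it X w + pd it T w * B (base (g w))).

Lemma drift_eq0 w : D w -> drift0 w = 0 /\ drift1 w = 0.
Proof.
move=> Dw; have [_ _ _ _ [_]] := gs Dw; rewrite /grp_e1 /grp_e2 /drift0 /drift1; cbv zeta.
move: (xx0 Dw) (aE Dw) (bE Dw) (au Dw) (slope_coef_der ix Dw).
rewrite (pd_comm iu ix (g_an iu Dw)).
move: (pd ix X w) => x; atomize_app A; atomize_app B; atomize_app C; atomize_app a; atomize_app b.
move: (U w) => u'; atomize; clear; move=> x0 + + + [].
move=> <- <- <- <- h5 e1 e2; split; apply: (mulfI x0); rewrite mulr0 -[RHS]oppr0.
  by rewrite -e2; ring.
match type of e1 with ?m = 0 => match type of h5 with ?l = ?r =>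
  transitivity (- m + s * x * (l - r)); first by clear; ring end end.
by rewrite e1 h5 subrr mulr0 addr0 oppr0.
Qed.

Section At.
Variables (w : 'rV[R]_3) (Dw : D w).

Let dpull f : analytic_on Om f ->
  (dder (fun y => f (base y)) w ix (pd ix f (base w)) *
   dder (fun y => f (base y)) w iu 0)%type.
Proof.
move=> fO; have E := pd_base3 f; have fw := analytic_base (fO _ (D_Om Dw)).
split.
  have := dder_fun ix fw; rewrite (congr1 (fun h => h w) E.1.2); exact.
have := dder_fun iu fw; rewrite (congr1 (fun h => h w) E.2); exact.
Qed.

Let dpull' f : analytic_on Om f ->
  (dder (fun y => f (base (g y))) w ix (pd ix f (base (g w)) * pd ix X w)%R *
   dder (fun y => f (base (g y))) w iu 0)%type.
Proof.
move=> fO; have fw := analytic_base (fO _ (gD_Om Dw)).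
have gw k : analytic_at (coordf g k) w by exact: g_an.
have E := pd_base3 f.
have E1 := congr1 (fun h => h (g w)) E.1.1; have E2 := congr1 (fun h => h (g w)) E.1.2.
have E3 := congr1 (fun h => h (g w)) E.2.
have h i := dder_comp i gw fw; split.
  have := h ix; rewrite sum_I3 E1 E2 E3 (tx Dw) mul0r add0r mulr0 addr0 mulrC; exact.
have := h iu; rewrite sum_I3 E1 E2 E3 (tu Dw) (xu Dw) !mul0r !add0r mulr0; exact.
Qed.

Let dA := dpull A_an. Let dB := dpull B_an. Let dC := dpull C_an.
Let dB' := dpull' B_an. Let dC' := dpull' C_an. Let dA' := dpull' A_an.

Let du i : dder (fun y : 'rV[R]_3 => y 0 iu : R) w i (i == iu)%:R.
Proof. by rewrite -(pd_coord i iu w); exact/dder_fun/analytic_coord. Qed.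

Ltac prove_dder := repeat lazymatch goal with
  | |- dder (fun y => @Algebra.add _ (@?f y) (@?h y)) _ _ _ =>
      refine (@dderD _ f h _ _ _ _ _ _)
  | |- dder (fun y => @Algebra.opp _ (@?f y)) _ _ _ => refine (@dderN _ f _ _ _ _)
  | |- dder (fun y => @GRing.mul _ (@?f y) (@?h y)) _ _ _ =>
      refine (@dderM _ f h _ _ _ _ _ _)
  | |- dder (fun y => fun_of_matrix y _ iu) _ ?i _ => refine (du i)
  | |- dder (fun y => coordf g ?k y) _ ?i _ => refine (dg k i Dw)
  | |- dder (fun y => a y) _ ?i _ => refine (dder_fun i (a_an Dw))
  | |- dder (fun y => b y) _ ?i _ => refine (dder_fun i (b_an Dw))
  | |- dder (fun y => pd ?j (coordf g ?k) y) _ ?i _ => refine (dpg k j i Dw)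
  | |- dder (fun y => pd ?j a y) _ ?i _ => refine (dder_fun i (analytic_pd j (a_an Dw)))
  | |- dder (fun y => pd ?j b y) _ ?i _ => refine (dder_fun i (analytic_pd j (b_an Dw)))
  | |- dder (fun y => A (base y)) _ ix _ => refine dA.1
  | |- dder (fun y => A (base y)) _ iu _ => refine dA.2
  | |- dder (fun y => B (base y)) _ ix _ => refine dB.1
  | |- dder (fun y => B (base y)) _ iu _ => refine dB.2
  | |- dder (fun y => C (base y)) _ ix _ => refine dC.1
  | |- dder (fun y => C (base y)) _ iu _ => refine dC.2
  | |- dder (fun y => A (base (g y))) _ ix _ => refine dA'.1
  | |- dder (fun y => B (base (g y))) _ ix _ => refine dB'.1
  | |- dder (fun y => B (base (g y))) _ iu _ => refine dB'.2
  | |- dder (fun y => C (base (g y))) _ ix _ => refine dC'.1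
  | |- dder (fun y => C (base (g y))) _ iu _ => refine dC'.2
  end.

Let dzero f i d : (forall y, D y -> f y = 0) -> dder f w i d -> d = 0.
Proof. by move=> f0 [_ <-]; exact: (pd_eq_cst i D_open f0 Dw). Qed.

Lemma lift_equivalence (y : 'rV[R]_4) p P p' P' :
  base y = w -> P^T = P -> P'^T = P' -> prolongs lift_map y p P p' P' ->
  (eqDE0 A B C y p P = 0 <-> eqDE0 A B C (lift_map y) p' P' = 0).
Proof.
move=> yw Ps P's [_ h1 h2].
have e0 x : D x -> pd it T x * A (base (g x)) - pd ix X x * pd ix X x * A (base x) = 0.
  by move=> /gs[_ _ _ _ []]; rewrite -expr2.
have z0 x : D x -> drift0 x = 0 by move=> /drift_eq0[].
have z1 x : D x -> drift1 x = 0 by move=> /drift_eq0[].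
(* The identities for [grp_e0], [drift0] and [drift1] hold on all of [D] and may be differentiated;
   the derivatives are synthesized by [prove_dder]. *)
eassert (e0x : _ = 0 :> R).
  apply: (dzero (i := ix) e0); prove_dder.
eassert (z0x : _ = 0 :> R).
  apply: (dzero (i := ix) z0); rewrite /drift0; prove_dder.
eassert (z0u : _ = 0 :> R).
  apply: (dzero (i := iu) z0); rewrite /drift0; prove_dder.
eassert (z1x : _ = 0 :> R).
  apply: (dzero (i := ix) z1); rewrite /drift1; prove_dder.
have D'_open : open (@base R 3 @^-1` D) by exact: open_base.
have D'D x : (@base R 3 @^-1` D) x -> D (base x) by [].
have D'y : (@base R 3 @^-1` D) y by rewrite /= yw.
have LT := pd_lift_base T yw; have LX := pd_lift_base X yw; have LU := pd_lift_base U yw.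
have LH := pd_lift_afl D'_open D'D a_an b_an D'y yw.
cbv zeta in LT, LX, LU, LH.
have gy : base (lift_map y) = g w by rewrite base_row_ext yw.
have uy : w 0 iu = y 0 iu by rewrite -yw base4.
have lu : lift_map y 0 iu = U w by rewrite -LU -coordf_lift_map.
have lh := etrans (congr1 (fun f => f y) coordf_lift_map.2) LH.1.1.1.1.1.1.1.1.1.1.1.1.
rewrite {1}/coordf in lh.
have iuE : (iu == iu :> 'I_3)%:R = 1 :> R by []. have ixE : (ix == iu :> 'I_3)%:R = 0 :> R by [].
rewrite uy ixE in z0x z1x; rewrite uy iuE in z0u.
have [d1 d2] := drift_eq0 Dw; rewrite /drift0 /drift1 uy in d1 d2.
have := (h1 it, h1 ix, h1 iu, (h2 ix ix, h2 ix iu, h2 iu iu)).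
rewrite !sum_I3 !ind3 !tot1_3 !tot2_3 !coordf_lift_map.
rewrite /eqDE0 gy yw lu lh.
move: (P's); move=> /matrixP/(_ ix iu); rewrite mxE.
move: (e0 w Dw) e0x z0x z0u z1x d1 d2; clear e0 z0 z1.
have [_ _ _ [t0 x0 u0] _] := gs Dw.
have [a_t b_t] := slope_coef_der it Dw; have [a_x b_x] := slope_coef_der ix Dw.
have UtE : pd ix (pd it U) w = a w * pd ix (pd it X) w + pd ix X w * pd it a w.
  by rewrite (pd_comm ix it (g_an iu Dw)) -a_t (pd_comm ix it (g_an ix Dw)).
have UtuE : pd iu (pd it U) w = b w * pd ix (pd it X) w + pd ix X w * pd it b w.
  by rewrite (pd_comm iu it (g_an iu Dw)) -b_t (pd_comm ix it (g_an ix Dw)).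
have UxuE := esym (au Dw); rewrite (pd_comm iu ix (g_an iu Dw)) in UxuE; rewrite UxuE in b_x.
have xut : pd iu (pd it X) w = 0.
  by rewrite (pd_comm iu it (g_an ix Dw)); exact: (pd_eq_cst it D_open xu Dw).
have txt : pd ix (pd it T) w = 0.
  by rewrite (pd_comm ix it (g_an it Dw)); exact: (pd_eq_cst it D_open tx Dw).
have tut : pd iu (pd it T) w = 0.
  by rewrite (pd_comm iu it (g_an it Dw)); exact: (pd_eq_cst it D_open tu Dw).
have bxu : pd iu (pd ix b) w = 0.
  by rewrite (pd_comm iu ix (b_an Dw)); exact: (pd_eq_cst ix D_open bu Dw).
have [[[[[[[[[[[[_ t1] t2] t3] t4] t5] t6] t7] t8] t9] t10] t11] t12] := LT;
  move: t1 t2 t3 t4 t5 t6 t7 t8 t9 t10 t11 t12.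
have [[[[[[[[[[[[_ t1] t2] t3] t4] t5] t6] t7] t8] t9] t10] t11] t12] := LX;
  move: t1 t2 t3 t4 t5 t6 t7 t8 t9 t10 t11 t12.
have [[[[[[[[[[[[_ t1] t2] t3] t4] t5] t6] t7] t8] t9] t10] t11] t12] := LU;
  move: t1 t2 t3 t4 t5 t6 t7 t8 t9 t10 t11 t12.
have [[[[[[[[[[[[_ t1] t2] t3] t4] t5] t6] t7] t8] t9] t10] t11] t12] := LH;
  move: t1 t2 t3 t4 t5 t6 t7 t8 t9 t10 t11 t12.
move: b_x (esym a_x) UtE UtuE UxuE xut txt tut bxu (bu Dw) (auu Dw) (pd_comm iu ix (a_an Dw)).
move: (pd_eq_cst ix D_open bu Dw) (pd_eq_cst iu D_open bu Dw).
move: (esym (aE Dw)) (esym (bE Dw)) (tx Dw) (tu Dw) (xu Dw) (uu Dw) (xxu Dw).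
move: (pd_eq_cst ix D_open tx Dw) (pd_eq_cst iu D_open tx Dw) (pd_eq_cst ix D_open tu Dw)
  (pd_eq_cst iu D_open tu Dw) (pd_eq_cst ix D_open xu Dw) (pd_eq_cst iu D_open xu Dw).
have b0 : b w != 0 by apply: contraNneq u0 => b0; rewrite -bE// b0 mul0r.
move: (pd it T w) t0 (pd ix X w) x0 (b w) b0; clear.
move=> Tt Tt0 Xx Xx0 b0 b00.
generalize (A (base w)) (pd ix A (base w)) (B (base w)) (pd ix B (base w)) (C (base w)) (pd ix C
  (base w)) (A (base (g w))) (pd ix A (base (g w))) (B (base (g w))) (pd ix B (base (g w))) (C
  (base (g w))) (pd ix C (base (g w))) (y 0 iu) (y 0 ie);
  intros a0 a1 b1 b2 c1 c2 a0' a1' b1' b2' c1' c2' u eta.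
generalize (p 0 it) (p 0 ix) (p 0 iu) (P ix ix) (P ix iu) (P iu iu) (p' 0 it) (p' 0 ix) (p' 0
  iu) (P' ix ix) (P' ix iu) (P' iu iu);
  intros pt px pu Pxx Pxu Puu qt qx qu Qxx Qxu Quu.
generalize (pd it X w) (pd ix (pd ix X) w) (pd ix (pd it X) w) (U w) (pd it U w) (a w) (pd it a
  w) (pd ix a w) (pd iu a w) (pd ix (pd ix a) w) (pd ix (pd iu a) w) (pd it b w) (pd ix b w) (pd
  ix (pd ix b) w);
  intros Xt Xxx Xtx U0 Ut f ft fx fu fxx fxu ht hx hxx.
atomize; subst_facts; intro cE; subst_facts.
move=> e0 e0x z0x z0u z1x d1 d2 Ps [[[h1 h2] h3] [[h4 h5] h6]]; rewrite Ps in h4 h5 h6.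
(* As for [L], the equations are proportional on prolonged jets, now with factors [T_t] and
   [b = U_u / X_x], neither of which vanishes. *)
match goal with |- ?F = 0 <-> ?F' = 0 => have key : Xx * (Tt * F' - b0 * F) = 0 end.
  refine (@lift_identity a0 a1 b1 b2 c1 c2 a0' a1' b1' b2' c1' c2' u eta pt px pu Pxx Pxu Puu
    qt qx qu Qxx Qxu Quu Tt Xx Xt Xxx Xtx U0 Ut f ft fx fu fxx fxu b0 ht hx hxx
    _ _ _ _ _ _ _ _ _ _ _ _ _ _); clear -Xx0 e0 e0x z0x z0u z1x d1 d2 h1 h2 h3 h4 h5 h6 cE.
  - by lra.
  - by lra.
  - by lra.
  - by lra.
  - by lra.
  - by lra.
  - by lra.
  (* The [x]-derivative of the leading relation carries a factor [X_x], absent from the form that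
     [lift_identity] expects. *)
  - by apply: (mulfI Xx0); lra.
  - by lra.
  - by lra.
  - by lra.
  - by lra.
  - by lra.
  - by lra.
move/eqP: key; rewrite mulf_eq0 (negbTE Xx0)/= subr_eq0 => /eqP key; split=> h.
  by apply: (mulfI Tt0); rewrite key h !mulr0.
by apply: (mulfI b00); rewrite -key h !mulr0.
Qed.

End At.
End GroupLift.

(** * Structure of the point symmetries of the reduction equation *)

Section ReductionGroup.
Context {R : realType}.
Variables (Om : set 'rV[R]_2) (A B C : 'rV[R]_2 -> R).
Hypotheses (A_an : analytic_on Om A) (A_neq0 : forall z, Om z -> A z != 0).

Local Opaque pd ind dep.

Lemma pair_diff (m m' a b c d : R) : a * m + b * m' = c * m + d * m' ->
  m * (c - a) + m' * (d - b) = 0.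
Proof. by move=> E; lra. Qed.

Lemma sub_shift (a b c : R) : a - c = b - c + (a - b).
Proof. ring. Qed.

(** Difference of the symmetry relations at [p] and at [p] with [p_t] raised by 1. The first-order
    equations turn the change [q1 - q] of the new [t]-slope, times [t], into the nonzero factor [K],
    which cancels. *)
Lemma leading_cancel (t q q1 qx qu r l l' k x0 x1 x2 y0 y1 y2 a a' : R) :
  x0 = q * t + qx * x1 + qu * x2 ->
  x0 + y0 = q1 * t + qx * (x1 + y1) + qu * (x2 + y2) ->
  y0 - (qx * y1 + qu * y2) != 0 ->
  a' * ((y0 - (qx * y1 + qu * y2)) * l + a * k) = a * (l' * r ^+ 2) ->
  a' * ((y0 - (qx * y1 + qu * y2)) * (l + 1) + a * k) = a * ((l' + (q1 - q)) * r ^+ 2) ->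
  a' * t = a * r ^+ 2.
Proof.
move=> rt rt1 k0 R0 R1; apply: (mulfI k0).
set K := y0 - _ in R0 R1 *; have KE : K = (q1 - q) * t by rewrite /K; lra.
have RE : a' * K = a * (q1 - q) * r ^+ 2 by lra.
by rewrite mulrCA mulrA RE [in RHS]KE; ring.
Qed.

(** Difference of the symmetry relations at two slopes, index 0 for slope 0 and index 1 for
    [(p_x, p_u) = (-eta, 1)]. All derivatives of [H] cancel except [H_eta], written [k]. *)
Lemma reduction_cancel (a a' b b' c c' ax' bx' cx' l u eta T X Xt Xxx U Ux Ut Uu M N
    H Hx Hu Ht k x0 u0 t0 x1 u1 t1 : R) :
  a != 0 -> X != 0 -> Uu != 0 -> H * X = Ux + eta * Uu -> k * X = Uu -> a' * T = a * X ^+ 2 ->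
  Hx = x0 * X + u0 * Ux -> Hu = u0 * Uu -> Ht = t0 * T + x0 * Xt + u0 * Ut ->
  Hx - eta * k = x1 * X + u1 * Ux -> Hu + k = u1 * Uu -> Ht = t1 * T + x1 * Xt + u1 * Ut ->
  a' * (k * l + a * (N - (x0 * Xxx + u0 * M))) =
    a * ((t0 - (ax' * (x0 + H * u0) + (bx' * H + b' * x0) + c' * (H - U * u0) + cx' * U)) * X ^+ 2) ->
  a' * (k * (l + (b * eta + c * u)) + a * (N - (x1 * Xxx + u1 * M))) =
    a * ((t1 - (ax' * (x1 + H * u1) + (bx' * H + b' * x1) + c' * (H - U * u1) + cx' * U)) * X ^+ 2) ->
  X * Uu * (b * eta + c * u) + X * Ut - T * c' * U * X - (Ux + eta * Uu) * (Xt + T * b')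
    - a * (X * M - (Ux + eta * Uu) * Xxx) = 0.
Proof.
move=> a0 X0 Uu0 HX kX lead rx ru rt rx1 ru1 rt1 R0 R1.
have du : (u1 - u0) * X = 1.
  apply: (mulfI Uu0); rewrite mulr1 mulrA -{2}kX; congr (_ * _).
  by rewrite mulrBr !(mulrC Uu) -ru1 -ru; ring.
have dx : (x1 - x0) * X = - H.
  apply: (mulfI X0); have -> : X * - H = - (Ux + eta * Uu) by rewrite -HX; ring.
  have E : (x1 - x0) * X = - eta * k - (u1 - u0) * Ux by lra.
  have -> : X * ((x1 - x0) * X) = - eta * (k * X) - (u1 - u0) * X * Ux by rewrite E; ring.
  by rewrite kX du; ring.
have dt : (t1 - t0) * T * X = H * Xt - Ut.
  have E : (t1 - t0) * T = - ((x1 - x0) * Xt) - (u1 - u0) * Ut by lra.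
  transitivity (- ((x1 - x0) * X * Xt) - (u1 - u0) * X * Ut); first by rewrite E; ring.
  by rewrite dx du; ring.
(* The change of the new slope also has no component along the new direction [(0, 1, H)], which
   removes the derivative [ax'] of [A] at the image. *)
have dH : (x1 - x0) + H * (u1 - u0) = 0.
  by apply: (mulIf X0); rewrite mul0r mulrDl dx -mulrA du mulr1 addNr.
have K : k * (b * eta + c * u) - a * ((x1 - x0) * Xxx + (u1 - u0) * M)
    = T * ((t1 - t0) - (b' * (x1 - x0) - c' * U * (u1 - u0))).
  have aX0 : a * X ^+ 2 != 0 by rewrite mulf_neq0// expf_neq0.
  apply: (mulfI aX0); rewrite -{1}lead.
  have E : a' * (k * (b * eta + c * u) - a * ((x1 - x0) * Xxx + (u1 - u0) * M)) =
      a * X ^+ 2 * ((t1 - t0) - (b' * (x1 - x0) - c' * U * (u1 - u0)))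
      - a * X ^+ 2 * ax' * ((x1 - x0) + H * (u1 - u0)) by lra.
  by rewrite mulrAC E dH; ring.
rewrite -HX -kX; transitivity (X ^+ 2 * (k * (b * eta + c * u))
  + X * ((u1 - u0) * X * X * Ut) * 0 + X * Ut - T * c' * U * X - H * X * (Xt + T * b')
    - a * (X * M - H * X * Xxx)); first by ring.
have -> : k * (b * eta + c * u) = a * ((x1 - x0) * Xxx + (u1 - u0) * M)
  + T * ((t1 - t0) - (b' * (x1 - x0) - c' * U * (u1 - u0))) by rewrite -K; ring.
transitivity (a * X * ((x1 - x0) * X + H) * Xxx + a * X * ((u1 - u0) * X - 1) * M
  + X * ((t1 - t0) * T * X - H * Xt + Ut) - X * T * b' * ((x1 - x0) * X + H)
  + X * T * c' * U * ((u1 - u0) * X - 1)); first by ring.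
by rewrite dx du dt; ring.
Qed.

(* The second-order part of the reduction equation is [A v^T P v] with [v] the
   row [vrow eta]. *)
Definition vrow (e : R) : 'rV[R]_3 := \row_i [:: 0; 1; e]`_i.

Lemma vrowE e : (vrow e 0 it = 0) * (vrow e 0 ix = 1) * (vrow e 0 iu = e).
Proof. by rewrite !mxE. Qed.

Lemma mul_vrow m e (M : 'M[R]_(3, m)) k : (vrow e *m M) 0 k = M ix k + e * M iu k.
Proof. by rewrite mxE sum_I3 !vrowE mul0r add0r mul1r. Qed.

Lemma mul_row3 m (v : 'rV[R]_3) (M : 'M[R]_(3, m)) k :
  (v *m M) 0 k = v 0 it * M it k + v 0 ix * M ix k + v 0 iu * M iu k.
Proof. by rewrite mxE sum_I3. Qed.

Lemma mul_col3 m (M : 'M[R]_(m, 3)) (v : 'cV[R]_3) k :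
  (M *m v) k 0 = M k it * v it 0 + M k ix * v ix 0 + M k iu * v iu 0.
Proof. by rewrite mxE sum_I3. Qed.

Lemma quad_vrow e P : quad (vrow e) P = P ix ix + e * P iu ix + e * (P ix iu + e * P iu iu).
Proof.
rewrite /quad mxE sum_I3 !mul_vrow ![_^T _ _]mxE !vrowE; ring.
Qed.

Variables (D : set 'rV[R]_4) (h : 'rV[R]_4 -> 'rV[R]_4).
Hypotheses (D_open : open D) (h_an : analytic_map_on D h).
Hypotheses (D_Om : forall w, D w -> Om (base (base w))).
Hypothesis hD_Om : forall w, D w -> Om (base (base (h w))).
Hypothesis h_unit : forall w, D w -> jacobian h w \in unitmx.
Hypothesis h_sym : forall w p P p' P', D w -> P^T = P -> P'^T = P' ->
  prolongs h w p P p' P' -> (eqDE0 A B C w p P = 0 <-> eqDE0 A B C (h w) p' P' = 0).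
Notation T := (coordf h it).
Notation X := (coordf h ix).
Notation U := (coordf h iu).
Notation H := (coordf h ie).

Let lin (w : 'rV[R]_4) (p : 'rV[R]_3) : R := let z := base (base w) in
  p 0 it - (pd ix A z * (p 0 ix + w 0 ie * p 0 iu) + (pd ix B z * w 0 ie + B z * p 0 ix)
  + C z * (w 0 ie - w 0 iu * p 0 iu) + pd ix C z * w 0 iu).

Let sym_lin w : D w -> forall p P p' P', P^T = P -> P'^T = P' -> prolongs h w p P p' P' ->
  (lin w p - A (base (base w)) * quad (vrow (w 0 ie)) P = 0 <->
   lin (h w) p' - A (base (base (h w))) * quad (vrow (h w 0 ie)) P' = 0).
Proof.
move=> Dw p P p' P' Ps P's pr; have := h_sym Dw Ps P's pr.
have E y q (Q : 'M[R]_3) : Q^T = Q -> eqDE0 A B C y q Q =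
    lin y q - A (base (base y)) * quad (vrow (y 0 ie)) Q.
  move=> /matrixP/(_ ix iu); rewrite mxE quad_vrow => ->; rewrite /eqDE0 /lin; cbv zeta.
  by atomize_app A; atomize_app B; atomize_app C; atomize; ring.
by rewrite !E.
Qed.

Let an w : D w -> forall k, analytic_at (coordf h k) w.
Proof. by move=> Dw k; apply: h_an. Qed.

(** The total derivative of [f] along [v = (0, 1, eta)] at slope [p]. *)
Let along (w : 'rV[R]_4) (p : 'rV[R]_3) (f : 'rV[R]_4 -> R) : R :=
  pd ix f w + w 0 ie * pd iu f w + (p 0 ix + w 0 ie * p 0 iu) * pd ie f w.

Let alongE (w : 'rV[R]_4) (p : 'rV[R]_3) k : (vrow (w 0 ie) *m tot_jacobian h w p) 0 k =
  along w p (coordf h (ind k)).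
Proof.
rewrite mul_vrow ![tot_jacobian _ _ _ _ _]mxE !tot1_3 /along.
by atomize; ring.
Qed.

(** The orthogonal complement of [v' = (0, 1, H)] is spanned by the [t]-axis and [(0, -H, 1)]; each
    gives one equation. *)
Let direction w p : D w -> tot_jacobian h w p \in unitmx ->
  along w p T = 0 /\ along w p U = H w * along w p X.
Proof.
move=> Dw Ju.
have hyp := symmetry_direction (h_unit Dw) (an Dw) (A_neq0 (D_Om Dw)) (A_neq0 (hD_Om Dw))
  (vrowE _).1.2 (sym_lin Dw) Ju.
have := hyp (delta_mx 0 it); rewrite !sum_delta vrowE alongE !ind3 => /(_ erefl) ->; split=> //.
pose u : 'rV[R]_3 := \row_i [:: 0; - H w; 1]`_i.
have uE : (u 0 it = 0) * (u 0 ix = - H w) * (u 0 iu = 1) by rewrite !mxE.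
have := hyp u; rewrite !sum_I3 !uE !alongE !ind3 !vrowE !mulr0 !add0r !mulr1 mul1r addNr.
by move=> /(_ erefl)/eqP; rewrite mulrN addrC subr_eq0 mulrC => /eqP.
Qed.

Let line_ix (p0 : 'rV[R]_3) (s : R) :
  ((p0 + s *: delta_mx 0 ix) 0 it = p0 0 it) * ((p0 + s *: delta_mx 0 ix) 0 ix = p0 0 ix + s) *
  ((p0 + s *: delta_mx 0 ix) 0 iu = p0 0 iu).
Proof. by rewrite !lineE !mxE !eqxx/= !mulr0 mulr1 !addr0. Qed.

Let along_line (w : 'rV[R]_4) (p : 'rV[R]_3) (s : R) f :
  along w (p + s *: delta_mx 0 ix) f = along w p f + s * pd ie f w.
Proof. by rewrite /along !line_ix; atomize; ring. Qed.

Let T1 w : D w -> pd ie T w = 0 /\ pd ix T w + w 0 ie * pd iu T w = 0.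
Proof.
move=> Dw; have [p0 [e [e0 hu]]] := generic_slopes (h_unit Dw) ix.
have [E te] : along w p0 T = 0 /\ pd ie T w = 0.
  apply: (affine_zero_ball e0) => s /hu /(direction Dw)[].
  by rewrite along_line.
split; first exact: te.
move: E te; rewrite /along; atomize; clear.
by move=> E te; rewrite te mulr0 addr0 in E.
Qed.

(** [T_x + eta T_u = 0] with [T] free of [eta]; differentiation in [eta] separates the two terms. *)
Let T0 w : D w -> [/\ pd ix T w = 0, pd iu T w = 0 & pd ie T w = 0].
Proof.
move=> Dw; have [te txu] := T1 Dw.
have tex i : pd ie (pd i T) w = 0.
  rewrite (pd_comm ie i (an Dw it)); exact: (pd_eq_cst i D_open (fun y Dy => (T1 Dy).1) Dw).
have := dder_eq D_open (fun y Dy => (T1 Dy).2) Dw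
  (dderD (dder_fun ie (analytic_pd ix (an Dw it)))
    (dderM (dder_fun ie (analytic_coord ie w)) (dder_fun ie (analytic_pd iu (an Dw it)))))
  (is_derive_cst (0 : R) w (delta_mx 0 ie)).
rewrite pd_coord eqxx.
move: (tex ix) (tex iu) te txu; atomize; clear; move=> -> -> te + E.
move: E; rewrite mulr0 !add0r mulr1 => ->; rewrite mulr0 addr0 => ->.
by rewrite te.
Qed.

Let Tz i w : i != it -> D w -> pd i T w = 0.
Proof.
move=> ii /T0[t1 t2 t3].
have [E|E|E|E] := I4P i; first by exfalso; move/eqP: ii; exact.
- rewrite E; exact t1.
- rewrite E; exact t2.
- rewrite E; exact t3.
Qed.

Let TT i j w : D w -> i != it -> pd j (pd i T) w = 0.
Proof. by move=> Dw ii; exact: (pd_eq_cst j D_open (fun y Dy => Tz ii Dy) Dw). Qed.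

Let slope w (p : 'rV[R]_3) : D w -> tot_jacobian h w p \in unitmx ->
  pd it T w != 0 /\ along w p X != 0.
Proof.
move=> Dw Ju; have [tx tu te] := T0 Dw; split; apply/eqP => E.
  apply: (unitmx_col (k := it) Ju) => i; rewrite mxE ind3.
  case: (I3P i) => ->; rewrite tot1_3; move: tx tu te E; atomize; clear;
    by move=> tx tu te E; rewrite ?tx ?tu ?E te mulr0 addr0.
(* If [X] had zero derivative along [v], so would [T] and [U], making the nonzero row [v] a null
   vector of an invertible matrix. *)
have [dt du] := direction Dw Ju.
have v0 : vrow (w 0 ie) *m tot_jacobian h w p = 0.
  apply/rowP => k; rewrite alongE [RHS]mxE; case: (I3P k) => ->; rewrite ind3 ?dt ?E//.
  by rewrite du E mulr0.
have : vrow (w 0 ie) = 0 by rewrite -(mulmxK Ju (vrow _)) v0 mul0mx.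
by move/rowP/(_ ix); rewrite vrowE mxE => /eqP; rewrite oner_eq0.
Qed.

Let slopeE w (p : 'rV[R]_3) : D w -> tot_jacobian h w p \in unitmx ->
  tot_jacobian h w (p + delta_mx 0 it) \in unitmx.
Proof.
move=> Dw Ju; have [tt _] := slope Dw Ju; have [tx tu te] := T0 Dw.
apply: unitmx_ker => v /rowP vJ.
have v0 : v 0 it = 0.
  have := vJ it; rewrite mul_row3 [(0 : 'rV[R]_3) _ _]mxE ![tot_jacobian _ _ _ _ _]mxE !ind3 !tot1_3.
  generalize (p + delta_mx 0 it : 'rV[R]_3); intro p1.
  move: tx tu te tt; atomize; clear; move=> -> -> -> tt /eqP.
  by rewrite !mulr0 !addr0 !mulr0 !addr0 mulf_eq0 (negbTE tt) orbF => /eqP.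
have : v *m tot_jacobian h w p = 0.
  apply/rowP => k; rewrite -(vJ k) !mul_row3 v0 !mul0r !add0r.
  rewrite ![tot_jacobian _ _ _ _ _]mxE !tot1_3.
  have e1 : (p + delta_mx 0 it) 0 ix = p 0 ix by rewrite !mxE addr0.
  have e2 : (p + delta_mx 0 it) 0 iu = p 0 iu by rewrite !mxE addr0.
  by rewrite e1 e2.
by move=> E; rewrite -(mulmxK Ju v) E mul0mx.
Qed.

Let rowE w (p : 'rV[R]_3) i : D w -> tot_jacobian h w p \in unitmx ->
  tot1 p H i w = new_slope h w p 0 it * tot1 p T i w + new_slope h w p 0 ix * tot1 p X i w
    + new_slope h w p 0 iu * tot1 p U i w.
Proof. by move=> Dw Ju; have := new_slopeP i Ju; rewrite sum_I3 !ind3. Qed.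

Let tot1T w (p : 'rV[R]_3) : D w ->
  [/\ tot1 p T it w = pd it T w, tot1 p T ix w = 0 & tot1 p T iu w = 0].
Proof.
move=> Dw; have [tx tu te] := T0 Dw; rewrite !tot1_3; move: tx tu te; atomize; clear.
by move=> -> -> ->; rewrite !mulr0 !addr0.
Qed.

Let shift_ne (p : 'rV[R]_3) i : i != it -> (p + delta_mx 0 it) 0 i = p 0 i.
Proof. by move=> ii; rewrite !mxE (negbTE ii) addr0. Qed.

Let slope_shift w (p : 'rV[R]_3) : D w -> tot_jacobian h w p \in unitmx ->
  new_slope h w (p + delta_mx 0 it) 0 ix = new_slope h w p 0 ix /\
  new_slope h w (p + delta_mx 0 it) 0 iu = new_slope h w p 0 iu.
Proof.
move=> Dw Ju; have Ju1 := slopeE Dw Ju; have [tt _] := slope Dw Ju.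
set q := new_slope h w p; set q1 := new_slope h w _.
have [Tt Tx Tu] := tot1T p Dw; have [_ Tx1 Tu1] := tot1T (p + delta_mx 0 it) Dw.
have rx := rowE ix Dw Ju; have rx1 := rowE ix Dw Ju1.
have ru := rowE iu Dw Ju; have ru1 := rowE iu Dw Ju1.
have sE f i : i != it -> tot1 (p + delta_mx 0 it) f i w = tot1 p f i w.
  by move=> ii; rewrite /tot1 shift_ne.
rewrite !sE// Tx mulr0 add0r in rx1; rewrite Tx mulr0 add0r in rx.
rewrite !sE// Tu mulr0 add0r in ru1; rewrite Tu mulr0 add0r in ru.
pose dx := q1 0 ix - q 0 ix; pose du := q1 0 iu - q 0 iu.
(* The first entry is chosen to kill the [t]-row; the [x]- and [u]-rows vanish because their
   equations do not involve [p_t]. Invertibility then forces [dx = du = 0]. *)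
pose c : 'cV[R]_3 := \col_i [:: - (tot1 p X it w * dx + tot1 p U it w * du) / pd it T w; dx; du]`_i.
have c0 : (c it 0 = - (tot1 p X it w * dx + tot1 p U it w * du) / pd it T w) *
  (c ix 0 = dx) * (c iu 0 = du) by rewrite !mxE.
have Jc : tot_jacobian h w p *m c = 0.
  apply/colP => i; rewrite mul_col3 [RHS]mxE !c0 ![tot_jacobian _ _ _ _ _]mxE !ind3.
  case: (I3P i) => ->.
  - by rewrite Tt mulrCA mulfV// mulr1 -addrA addNr.
  - by rewrite Tx mul0r add0r; apply: pair_diff; rewrite -rx -rx1.
  - by rewrite Tu mul0r add0r; apply: pair_diff; rewrite -ru -ru1.
have c00 : c = 0 by rewrite -(mulKmx Ju c) Jc mulmx0.
have [dx0 du0] : dx = 0 /\ du = 0 by rewrite -!c0 c00 !mxE.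
by split; apply/subr0_eq.
Qed.

Let tot2T w (p : 'rV[R]_3) i j : D w -> i != it -> j != it -> tot2 p 0 T i j w = 0.
Proof.
move=> Dw ii jj.
have ind_it k : k != it -> @ind 3 k != it.
  by move=> kk; apply: contraNneq kk => E; apply/eqP/ind_inj; rewrite E ind3.
have dd : dep 3 != it by rewrite ind3.
rewrite /tot2 ![pd _ (pd _ _) _]TT ?ind_it// !mulr0 !addr0.
by rewrite (Tz dd Dw) mulr0 addr0.
Qed.

Let hess_restE w (p q : 'rV[R]_3) i j : D w -> i != it -> j != it ->
  hess_rest h w p q i j =
  tot2 p 0 H i j w - (q 0 ix * tot2 p 0 X i j w + q 0 iu * tot2 p 0 U i j w).
Proof. by move=> Dw ii jj; rewrite mxE sum_I3 !ind3 tot2T// mulr0 add0r. Qed.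

Let hess_factorE w (q : 'rV[R]_3) : D w ->
  hess_factor h w q = pd ie H w - (q 0 ix * pd ie X w + q 0 iu * pd ie U w).
Proof. by move=> Dw; rewrite /hess_factor sum_I3 !ind3; have [_ _ ->] := T0 Dw; rewrite mulr0 add0r. Qed.

Let relation w (p : 'rV[R]_3) (Dw : D w) (Ju : tot_jacobian h w p \in unitmx) :=
  symmetry_relation (h_unit Dw) (an Dw) (A_neq0 (hD_Om Dw)) (vrowE _).1.2 (sym_lin Dw) Ju.

Let leading w (p : 'rV[R]_3) : D w -> tot_jacobian h w p \in unitmx ->
  A (base (base (h w))) * pd it T w = A (base (base w)) * along w p X ^+ 2.
Proof.
move=> Dw Ju; have Ju1 := slopeE Dw Ju; have [tt _] := slope Dw Ju.
have [qx qu] := slope_shift Dw Ju.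
have [p1 [p1E p1t p1x p1u]] : exists p1 : 'rV[R]_3, [/\ p + delta_mx 0 it = p1,
    p1 0 it = p 0 it + 1, p1 0 ix = p 0 ix & p1 0 iu = p 0 iu].
  by exists (p + delta_mx 0 it); rewrite !mxE !addr0.
rewrite p1E in Ju1 qx qu.
have k0 := hess_factor_neq0 (h_unit Dw) Ju.
have := relation Dw Ju1; have := relation Dw Ju; rewrite !alongE !ind3.
have -> : along w p1 X = along w p X by rewrite /along p1x p1u.
have -> : hess_factor h w (new_slope h w p1) = hess_factor h w (new_slope h w p).
  by rewrite !hess_factorE// qx qu.
have -> : quad (vrow (w 0 ie)) (hess_rest h w p1 (new_slope h w p1))
    = quad (vrow (w 0 ie)) (hess_rest h w p (new_slope h w p)).
  by rewrite !quad_vrow !hess_restE// qx qu /tot2 p1x p1u.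
have -> : lin w p1 = lin w p + 1.
  rewrite /lin p1x p1u p1t.
  by rewrite -!addrA; congr (_ + _); rewrite addrC.
have -> : lin (h w) (new_slope h w p1) = lin (h w) (new_slope h w p)
    + (new_slope h w p1 0 it - new_slope h w p 0 it).
  by rewrite /lin qx qu; exact: sub_shift.
have rt := rowE it Dw Ju; have rt1 := rowE it Dw Ju1.
have tE f : tot1 p1 f it w = tot1 p f it w + pd ie f w.
  have -> : tot1 p1 f it w = pd it f w + (p 0 it + 1) * pd ie f w.
    by rewrite tot1_3 p1t.
  by rewrite tot1_3 mulrDl mul1r addrA.
have [Tt _ _] := tot1T p Dw; have [Tt1 _ _] := tot1T p1 Dw.
rewrite Tt1 qx qu !tE in rt1; rewrite Tt in rt; rewrite hess_factorE// in k0 *.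
exact: (leading_cancel rt rt1 k0).
Qed.

(** Moving [p_x] along admissible slopes, the [p_x^2]-term of [leading] gives [X_eta = 0], and then
    the [p_x]-term of [direction] gives [U_eta = 0]. *)
Let leading0 w : D w -> let nf f := pd ix f w + w 0 ie * pd iu f w in
  [/\ pd it T w != 0, nf X != 0, pd ie X w = 0 /\ pd ie U w = 0, nf U = H w * nf X &
      A (base (base (h w))) * pd it T w = A (base (base w)) * nf X ^+ 2].
Proof.
move=> Dw nf; have [p0 [e [e0 hu]]] := generic_slopes (h_unit Dw) ix.
have Ju0 : tot_jacobian h w (p0 + 0 *: delta_mx 0 ix) \in unitmx by apply: hu; rewrite normr0.
have [tt xx] := slope Dw Ju0; have a0 := A_neq0 (D_Om Dw).
have [_ dU] := direction Dw Ju0; have lead := leading Dw Ju0.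
rewrite !along_line !mul0r !addr0 in xx dU lead.
have [_ _ X0] : [/\ A (base (base (h w))) * pd it T w - A (base (base w)) * along w p0 X ^+ 2 = 0,
    - (2 * A (base (base w)) * along w p0 X * pd ie X w) = 0 & - (A (base (base w)) * pd ie X w ^+ 2) = 0].
  apply: (quadratic_zero_ball e0) => s /hu /(leading Dw).
  rewrite along_line => ->; clear; generalize (along w p0 X) (A (base (base w))); atomize; move=> *; ring.
have {}X0 : pd ie X w = 0.
  by move/eqP: X0; rewrite oppr_eq0 mulf_eq0 (negbTE a0) sqrf_eq0 => /eqP.
have [_ U0] : along w p0 U - H w * along w p0 X = 0 /\ pd ie U w = 0.
  apply: (affine_zero_ball e0) => s /hu /(direction Dw)[_].
  by rewrite !along_line X0 mulr0 addr0 => E; apply/eqP; rewrite addrAC subr_eq0; apply/eqP.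
have nE f : pd ie f w = 0 -> along w p0 f = nf f by rewrite /along => ->; rewrite mulr0 addr0.
rewrite !nE// in xx dU lead; exact: And5.
Qed.

(** The leading relation is differentiated in [eta]: [T_t] and [A] at both points are free of [eta],
    so only the square of [X_x + eta X_u] contributes, and its base is nonzero. *)
Let Xu0 w : D w -> pd iu X w = 0.
Proof.
move=> Dw; have gw := an Dw; have [tt xx [xe ue] _ _] := leading0 Dw.
have pA : (pd iu ((A \o @base R 2) \o @base R 3) = fun=> 0) *
    (pd ie ((A \o @base R 2) \o @base R 3) = fun=> 0).
  by rewrite !pd_base4 pd_base3; split; apply/funext.
have dA' : dder (fun y => A (base (base (h y)))) w ie 0.
  have Ah : analytic_at ((A \o @base R 2) \o @base R 3) (h w).
    exact/analytic_base/analytic_base/A_an/hD_Om.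
  have := dder_comp ie gw Ah; rewrite sum_I4 !pA; have [_ _ te] := T0 Dw.
  by rewrite te xe !mul0r mulr0 !add0r mulr0.
have dA : dder (fun y => A (base (base y))) w ie 0.
  have Ah : analytic_at ((A \o @base R 2) \o @base R 3) w.
    exact/analytic_base/analytic_base/A_an/D_Om.
  by have := dder_fun ie Ah; rewrite pA.
have dn : dder (fun y => pd ix X y + y 0 ie * pd iu X y) w ie
    (pd ie (pd ix X) w + (w 0 ie * pd ie (pd iu X) w + pd iu X w * (ie == ie :> 'I_4)%:R)).
  apply: dderD; first exact/dder_fun/analytic_pd.
  apply: dderM; last exact/dder_fun/analytic_pd.
  by rewrite -(pd_coord ie ie w); exact/dder_fun/analytic_coord.
have dT : dder (pd it T) w ie 0.
  have -> : 0 = pd ie (pd it T) w.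
    rewrite (pd_comm ie it (gw it)); apply/esym.
    by exact: (pd_eq_cst it D_open (fun y Dy => let: And3 _ _ e := T0 Dy in e) Dw).
  exact/dder_fun/analytic_pd.
have lead y : D y -> A (base (base (h y))) * pd it T y = A (base (base y)) *
    ((pd ix X y + y 0 ie * pd iu X y) * (pd ix X y + y 0 ie * pd iu X y)).
  by case/leading0 => _ _ _ _; rewrite expr2.
have Xe i : pd ie (pd i X) w = 0.
  rewrite (pd_comm ie i (gw ix)).
  by exact: (pd_eq_cst i D_open (fun y Dy => let: And5 _ _ (conj e _) _ _ := leading0 Dy in e) Dw).
have := dder_eq D_open lead Dw (dderM dA' dT) (dderM dA (dderM dn dn)).
move: (Xe ix) (Xe iu) xx; rewrite eqxx; move: (A_neq0 (D_Om Dw)).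
generalize (A (base (base w))) (A (base (base (h w)))); atomize; clear.
move=> a a' a0 -> -> x0; rewrite !mulr0 !addr0 !add0r mulr1 => /esym/eqP.
by rewrite -mulr2n mulf_eq0 (negbTE a0) mulrn_eq0/= mulf_eq0 (negbTE x0) => /eqP.
Qed.

Lemma reduction_grp w : D w ->
  [/\ [/\ pd ix T w = 0, pd iu T w = 0 & pd ie T w = 0],
      [/\ pd iu X w = 0, pd ie X w = 0 & pd ie U w = 0],
      [/\ pd it T w != 0, pd ix X w != 0 & pd iu U w != 0],
      H w * pd ix X w = pd ix U w + w 0 ie * pd iu U w /\ pd ie H w * pd ix X w = pd iu U w &
      A (base (base (h w))) * pd it T w = A (base (base w)) * pd ix X w ^+ 2].
Proof.
move=> Dw; have [tt xx [xe ue] hx lead] := leading0 Dw; have xu := Xu0 Dw.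
rewrite xu mulr0 addr0 in xx hx lead; have gw := an Dw.
have hX y : D y -> H y * pd ix X y = pd ix U y + y 0 ie * pd iu U y.
  by move=> Dy; have [_ _ _ -> _] := leading0 Dy; rewrite (Xu0 Dy) mulr0 addr0.
have He : pd ie H w * pd ix X w = pd iu U w.
  have := dder_eq D_open hX Dw
    (dderM (dder_fun ie (gw ie)) (dder_fun ie (analytic_pd ix (gw ix))))
    (dderD (dder_fun ie (analytic_pd ix (gw iu)))
      (dderM (dder_fun ie (analytic_coord ie w)) (dder_fun ie (analytic_pd iu (gw iu))))).
  rewrite pd_coord eqxx (pd_comm ie ix (gw ix)) (pd_comm ie ix (gw iu)) (pd_comm ie iu (gw iu)).
  move: (pd_eq_cst ix D_open (fun y Dy => let: And5 _ _ (conj e _) _ _ := leading0 Dy in e) Dw)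
    (pd_eq_cst ix D_open (fun y Dy => let: And5 _ _ (conj _ e) _ _ := leading0 Dy in e) Dw)
    (pd_eq_cst iu D_open (fun y Dy => let: And5 _ _ (conj _ e) _ _ := leading0 Dy in e) Dw).
  generalize (H w); atomize; clear; move=> ? -> -> ->.
  by rewrite !mulr0 !add0r mulr1 mulrC.
have [tx tu te] := T0 Dw.
(* Otherwise [H_eta = 0] too, and the whole [eta]-row of the Jacobian would vanish. *)
have uu : pd iu U w != 0.
  apply/eqP => U0; have := He; rewrite U0 => /eqP; rewrite mulf_eq0 (negbTE xx) orbF => /eqP H0.
  apply: (unitmx_row (i := ie) (h_unit Dw)) => k; rewrite mxE.
  by have [E|E|E|E] := I4P k; rewrite E.
exact: And5 (And3 tx tu te) (And3 xu xe ue) (And3 tt xx uu) (conj (hX w Dw) He) lead.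
Qed.

Let unit_all w (p : 'rV[R]_3) : D w -> tot_jacobian h w p \in unitmx.
Proof.
move=> Dw; have [[tx tu te] [xu xe ue] [tt xx uu] _ _] := reduction_grp Dw.
apply: unitmx_ker => v /rowP vJ; have := (vJ it, vJ ix, vJ iu).
rewrite !mul_row3 [(0 : 'rV[R]_3) 0 it]mxE [(0 : 'rV[R]_3) 0 ix]mxE [(0 : 'rV[R]_3) 0 iu]mxE.
rewrite ![tot_jacobian _ _ _ _ _]mxE !ind3 !tot1_3.
have vE : v 0 it = 0 -> v 0 ix = 0 -> v 0 iu = 0 -> v = 0.
  by move=> v0 v1 v2; apply/rowP => k; rewrite mxE; have [->|->|->] := I3P k.
move: vE tt xx uu tx tu te xu xe ue; generalize (v = 0); atomize; clear.
move=> V vE tt xx uu -> -> -> -> -> ->; rewrite !(mulr0, addr0) => -[[/eqP]].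
rewrite mulf_eq0 (negbTE tt) orbF => /eqP v0; rewrite v0 !(mul0r, add0r) in vE *.
move=> /eqP; rewrite mulf_eq0 (negbTE xx) orbF => /eqP v1; rewrite v1 !(mul0r, add0r) in vE *.
move=> /eqP; rewrite mulf_eq0 (negbTE uu) orbF => /eqP v2; exact: vE.
Qed.

(** The finite counterpart of [reduction_pu]: comparing two slopes with [p_x + eta p_u = 0] leaves a
    quadratic in [eta] whose lower coefficients have the form of [grp_e2] and [grp_e1]. *)
Lemma reduction_poly w : D w -> let z := base (base w) in let z' := base (base (h w)) in
  let Tt := pd it T w in let Xx := pd ix X w in let Uu := pd iu U w in let Ux := pd ix U w in
  Xx * (pd it U w + Uu * C z * w 0 iu - Tt * C z' * U w) - Ux * (pd it X w + Tt * B z')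
      - A z * (pd ix (pd ix U) w * Xx - Ux * pd ix (pd ix X) w)
    + w 0 ie * (Uu * (B z * Xx - pd it X w - Tt * B z')
      - A z * (2 * pd ix (pd iu U) w * Xx - Uu * pd ix (pd ix X) w))
    + w 0 ie ^+ 2 * - (A z * Xx * pd iu (pd iu U) w) = 0.
Proof.
move=> Dw z z'; have gw := an Dw.
have [[tx tu te] [xu xe ue] [tt xx uu] [hX He] lead] := reduction_grp Dw.
have z0 i j : (0 : 'M[R]_3) i j = 0 by rewrite mxE.
have [ixt iut] : (ix != it :> 'I_3) /\ (iu != it :> 'I_3) by [].
have XuD y : D y -> pd iu X y = 0 by exact: Xu0.
have XeD y : D y -> pd ie X y = 0 by case/leading0 => _ _ [].
have UeD y : D y -> pd ie U y = 0 by case/leading0 => _ _ [].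
have main p (q := new_slope h w p) : p 0 ix + w 0 ie * p 0 iu = 0 ->
  [/\ pd ix H w + p 0 ix * pd ie H w = q 0 ix * pd ix X w + q 0 iu * pd ix U w,
      pd iu H w + p 0 iu * pd ie H w = q 0 iu * pd iu U w,
      pd it H w + p 0 it * pd ie H w = q 0 it * pd it T w + q 0 ix * pd it X w + q 0 iu * pd it U w &
  A z' * (pd ie H w * lin w p + A z * (pd ix (pd ix H) w + 2 * w 0 ie * pd ix (pd iu H) w
      + w 0 ie ^+ 2 * pd iu (pd iu H) w - (q 0 ix * pd ix (pd ix X) w + q 0 iu *
     (pd ix (pd ix U) w + 2 * w 0 ie * pd ix (pd iu U) w + w 0 ie ^+ 2 * pd iu (pd iu U) w))))
   = A z * (lin (h w) q * pd ix X w ^+ 2)].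
  unfold q; clear q; move=> pv; have Ju := unit_all p Dw.
  have := (rowE ix Dw Ju, rowE iu Dw Ju, rowE it Dw Ju, relation Dw Ju).
  have sQ : hess_rest h w p (new_slope h w p) iu ix = hess_rest h w p (new_slope h w p) ix iu.
    by rewrite -[in LHS](hess_rest_sym gw p (new_slope h w p)) mxE.
  rewrite quad_vrow sQ (hess_restE p (new_slope h w p) Dw ixt ixt).
  rewrite (hess_restE p (new_slope h w p) Dw ixt iut).
  rewrite (hess_restE p (new_slope h w p) Dw iut iut) alongE ind3 (hess_factorE (new_slope h w p) Dw).
  rewrite !tot1_3 !tot2_3 !z0 /along pv.
  move: tx tu te xu xe ue.
  move: (pd_eq_cst ix D_open XuD Dw) (pd_eq_cst iu D_open XuD Dw) (pd_eq_cst ix D_open XeD Dw)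
    (pd_eq_cst iu D_open XeD Dw) (pd_eq_cst ie D_open XeD Dw) (pd_eq_cst ix D_open UeD Dw)
    (pd_eq_cst iu D_open UeD Dw) (pd_eq_cst ie D_open UeD Dw) (pd_comm ie ix (gw ix))
    (pd_comm ie iu (gw ix)) (pd_comm ie ix (gw iu)) (pd_comm ie iu (gw iu))
    (pd_comm ie ix (gw ie)) (pd_comm ie iu (gw ie)).
  have pvE : p 0 ix = - (w 0 ie * p 0 iu) by apply/eqP; rewrite -addr_eq0 pv.
  move: pvE; rewrite -/z -/z'; generalize (A z) (A z') (lin w p) (lin (h w) (new_slope h w p)); clear.
  intros a a' l l'; atomize; subst_facts.
  move=> [[[h1 h2] h3] h4]; split.
  - by rewrite h1; ring.
  - by rewrite h2; ring.
  - by rewrite h3; ring.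
  - by clear h1 h2 h3; lra.
have [p1 [p1t p1x p1u]] : exists p1 : 'rV[R]_3, [/\ p1 0 it = 0, p1 0 ix = - w 0 ie & p1 0 iu = 1].
  by exists (\row_i [:: 0; - w 0 ie; 1]`_i); rewrite !mxE.
have [p0 [p0t p0x p0u]] : exists p0 : 'rV[R]_3, [/\ p0 0 it = 0, p0 0 ix = 0 & p0 0 iu = 0].
  by exists 0; rewrite !mxE.
have [|rx ru rt R0] := main p0; first by rewrite p0x p0u mulr0 addr0.
have [|rx1 ru1 rt1 R1] := main p1; first by rewrite p1x p1u mulr1 addNr.
move: rx ru rt R0 rx1 ru1 rt1 R1; rewrite /lin p0t p0x p0u p1t p1x p1u; cbv zeta; rewrite -/z -/z'.
have hu : h w 0 iu = U w by []. have he : h w 0 ie = H w by [].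
rewrite {}hu {}he; move: hX He lead tt xx uu (A_neq0 (D_Om Dw)); rewrite -/z -/z'.
generalize (new_slope h w p0 0 it) (new_slope h w p0 0 ix) (new_slope h w p0 0 iu)
  (new_slope h w p1 0 it) (new_slope h w p1 0 ix) (new_slope h w p1 0 iu)
  (A z) (A z') (B z) (B z') (C z) (C z') (pd ix A z) (pd ix B z) (pd ix C z)
  (pd ix A z') (pd ix B z') (pd ix C z') (w 0 iu) (w 0 ie) (U w) (H w)
  (pd it T w) (pd ix X w) (pd it X w) (pd ix (pd ix X) w) (pd ix U w) (pd it U w) (pd iu U w)
  (pd ix H w) (pd iu H w) (pd it H w) (pd ie H w)
  (pd ix (pd ix U) w) (pd ix (pd iu U) w) (pd iu (pd iu U) w)
  (pd ix (pd ix H) w) (pd ix (pd iu H) w) (pd iu (pd iu H) w).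
clear; intros t0 x0 u0 t1 x1 u1 a a' b b' c c' a1 b1 c1 a1' b1' c1' u eta U0 H0 Tt Xx Xt Xxx Ux Ut Uu
  Hx Hu Ht k Uxx Uxu Uuu Hxx Hxu Huu hX He lead tt xx uu a0 rx ru rt R0 rx1 ru1 rt1 R1.
(* The argument [l] is the first-order part at the zero slope; at the other slope this part is
   larger by [b * eta + c * u]. *)
have := @reduction_cancel a a' b b' c c' a1' b1' c1' (- (b1 * eta + c * eta + c1 * u)) u eta
  Tt Xx Xt Xxx U0 Ux Ut Uu (Uxx + 2 * eta * Uxu + eta ^+ 2 * Uuu)
  (Hxx + 2 * eta * Hxu + eta ^+ 2 * Huu) H0 Hx Hu Ht k x0 u0 t0 x1 u1 t1 a0 xx uu hX He lead.
move=> K; apply: etrans (K _ _ _ _ _ _ _ _).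
- by ring.
- by rewrite -rx mul0r addr0.
- by rewrite -ru mul0r addr0.
- by rewrite -rt mul0r addr0.
- by rewrite -rx1 mulNr.
- by rewrite -ru1 mul1r.
- by rewrite -rt1 mul0r addr0.
- match type of R0 with ?m = _ => transitivity m end; first by ring.
  by rewrite R0; ring.
- match type of R1 with ?m = _ => transitivity m end; first by ring.
  by rewrite R1; ring.
Qed.

End ReductionGroup.

(** * The lifting of transformations, its functoriality and its inverse *)

Section SymmetryLift.
Context {R : realType}.

Local Opaque pd ind dep.

(** The new [u_x] is [D_x U / D_x X]; since [X_u = 0], at [u_x = eta] it is affine in [eta] with
    these two coefficients. *)
Definition lift_coef (f : 'rV[R]_3 -> 'rV[R]_3) i (z : 'rV[R]_3) : R :=
  pd i (coordf f iu) z / pd ix (coordf f ix) z.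

Definition lift (f : 'rV[R]_3 -> 'rV[R]_3) := lift_map f (lift_coef f ix) (lift_coef f iu).

(* What is needed of a symmetry for the lifting to be functorial. *)
Definition fibered (f : 'rV[R]_3 -> 'rV[R]_3) (z : 'rV[R]_3) :=
  [/\ pd ix (coordf f it) z = 0, pd iu (coordf f it) z = 0, pd iu (coordf f ix) z = 0
    & pd ix (coordf f ix) z != 0].

Lemma base_lift f y : base (lift f y) = f (base y).
Proof. by rewrite base_row_ext. Qed.

Lemma lift_dep f y : lift f y 0 (dep 3) = afl (lift_coef f ix) (lift_coef f iu) y.
Proof. by rewrite row_ext_dep. Qed.

Lemma lift_near f g y : (\forall z \near base y, f z = g z) -> lift f y = lift g y.
Proof.
move=> fg; have E k i : pd i (coordf f k) (base y) = pd i (coordf g k) (base y).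
  by apply: pd_near; move: fg; apply: filterS => z; rewrite /coordf => ->.
by rewrite /lift /lift_map (nbhs_singleton fg) /afl /lift_coef !E.
Qed.

Lemma lift_id y : lift id y = y.
Proof.
have E k i : pd i (coordf id k) (base y) = (i == k)%:R :> R by exact: pd_coord.
rewrite -[RHS]row_ext_base /lift /lift_map; congr row_ext.
have [e1 e2] : (ix == iu :> 'I_3)%:R = 0 :> R /\ (ix == ix :> 'I_3)%:R = 1 :> R by [].
have e3 : (iu == iu :> 'I_3)%:R = 1 :> R by [].
by rewrite /afl /lift_coef !E e1 e2 ?e3 mul0r add0r divr1 mulr1.
Qed.

(** The chain rule for slopes; [fibered] removes the cross terms that would spoil affinity in
    [eta]. *)
Lemma lift_comp f g y : (forall k, analytic_at (coordf f k) (base y)) ->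
  (forall k, analytic_at (coordf g k) (f (base y))) ->
  fibered f (base y) -> fibered g (f (base y)) -> lift (g \o f) y = lift g (lift f y).
Proof.
move=> fa ga [ftx ftu fxu fxx] [_ _ gxu gxx].
rewrite [RHS]/lift /lift_map base_lift; congr row_ext.
have E k i : pd i (coordf (g \o f) k) (base y) =
    \sum_m pd i (coordf f m) (base y) * pd m (coordf g k) (f (base y)).
  by rewrite -(pd_comp i fa (ga k)).
rewrite /afl lift_dep /afl /lift_coef base_lift !E !sum_I3.
move: ftx ftu fxu gxu fxx gxx; atomize; clear; move=> -> -> -> -> fx gx.
rewrite !(mul0r, mulr0, add0r, addr0); field.
by rewrite fx gx.
Qed.

Lemma analytic_lift_coef D f i : analytic_map_on D f -> (forall z, D z -> fibered f z) ->
  analytic_on D (lift_coef f i).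
Proof.
move=> fD ff z Dz; have [_ _ _ fx] := ff z Dz.
apply: analyticM; first exact/analytic_pd/fD.
exact/analyticV/analytic_pd/fD.
Qed.

Lemma analytic_lift_map D f : analytic_map_on D f -> (forall z, D z -> fibered f z) ->
  analytic_map_on (@base R 3 @^-1` D) (lift f).
Proof.
move=> fD ff k; have D'D y : (@base R 3 @^-1` D) y -> D (base y) by [].
have [->|->|->|->] := I4P k; rewrite coordf_lift_map.
- by move=> y Dy; apply: analytic_base; exact: fD.
- by move=> y Dy; apply: analytic_base; exact: fD.
- by move=> y Dy; apply: analytic_base; exact: fD.
- by apply: (analytic_on_afl D'D); exact: analytic_lift_coef.
Qed.

(** The Jacobian of [f] is triangular up to its [t]-row, so the [u]-row and then the [x]-row of the
    product with the inverse Jacobian give the required entries. *)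
Lemma fibered_inverse f k z : fibered f z -> pd iu (coordf f iu) z != 0 ->
  jacobian f z *m jacobian k (f z) = 1%:M -> fibered k (f z).
Proof.
move=> [tx tu xu xx] uu /matrixP J.
have := (J iu it, J iu ix, (J ix it, J ix ix)); rewrite ![(jacobian _ _ *m _) _ _]mxE !sum_I3.
rewrite ![jacobian _ _ _ _]mxE ![(1%:M : 'M[R]_3) _ _]mxE.
have [e1 e2 e3 e4] : [/\ (iu == it :> 'I_3)%:R = 0 :> R, (iu == ix :> 'I_3)%:R = 0 :> R,
  (ix == it :> 'I_3)%:R = 0 :> R & (ix == ix :> 'I_3)%:R = 1 :> R] by [].
rewrite ?e1 ?e2 ?e3 ?e4; clear e1 e2 e3 e4.
move: tx tu xu xx uu; rewrite /fibered; atomize; clear; move=> -> -> -> xx uu.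
rewrite !mul0r !add0r => -[[/eqP + /eqP +] [+ +]].
rewrite !mulf_eq0 (negbTE uu) => /eqP -> /eqP ->; rewrite !mulr0 !addr0 => /eqP.
rewrite mulf_eq0 (negbTE xx) => /eqP -> E; split=> //.
by apply: contraTneq (oner_neq0 R) => sE; rewrite -E sE mulr0 eqxx.
Qed.

End SymmetryLift.

Lemma transformation_inverse (R : realType) n (f : lmap R n.+1) : point_transformation f ->
  exists k, [/\ analytic_map_on (f.2 @` f.1) k, forall w, f.1 w -> k (f.2 w) = w
    & forall w, f.1 w -> jacobian f.2 w *m jacobian k (f.2 w) = 1%:M].
Proof.
move=> [fo _ fa [k ka kf]]; exists k; split=> // w fw; apply: jacobian_unit.
- by move=> i; exact: fa.
- by move=> i; apply: ka; exists w.
- by near=> y; apply: kf; near: y; exact: open_nbhs_nbhs.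
Unshelve. all: by end_near. Qed.

(** * The lifting as a map of pseudogroups *)

Section PseudogroupLift.
Context {R : realType}.
Variables (Om : set 'rV[R]_2) (A B C : 'rV[R]_2 -> R).
Hypotheses (A_an : analytic_on Om A) (B_an : analytic_on Om B) (C_an : analytic_on Om C).
Hypothesis A_neq0 : forall z, Om z -> A z != 0.

Local Opaque pd ind dep.

Notation symL := (point_symmetries (@base R 2 @^-1` Om) (eqL A B C)).
Notation symDE := (point_symmetries ((@base R 2 \o @base R 3) @^-1` Om) (eqDE0 A B C)).

Lemma symL_struct g : symL g -> grp_struct A B C g.1 g.2.
Proof.
move=> [gp gO g'O gs]; have [k [_ _ J]] := transformation_inverse gp; have [go _ ga _] := gp.
apply: (symmetry_grp_struct A_neq0 go ga) => //.
- by move=> w gw; apply: g'O; exists w.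
- by move=> w gw; have [] := mulmx1_unit (J w gw).
Qed.

Lemma struct_fibered D f z : grp_struct A B C D f -> D z -> fibered f z.
Proof. by move=> fs /fs[[tx tu] xu _ [_ xx _] _]. Qed.

Definition lam (g : lmap R 3) : lmap R 4 := (@base R 3 @^-1` g.1, lift g.2).

Lemma lam_mem g : symL g -> symDE (lam g).
Proof.
move=> gL; have gs := symL_struct gL; have [gp gO g'O _] := gL.
have [go g'o ga _] := gp; have [k [ka kg J]] := transformation_inverse gp.
have gf z : g.1 z -> fibered g.2 z by exact: struct_fibered gs.
have kf z : (g.2 @` g.1) z -> fibered k z.
  move=> [y gy <-]; apply: fibered_inverse (gf y gy) _ (J y gy).
  by have [_ _ _ []] := gs y gy.
have kgz z : g.1 z -> \forall y \near z, (k \o g.2) y = id y.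
  by move=> gz; near=> y; apply: kg; near: y; exact: open_nbhs_nbhs.
have gkz z : (g.2 @` g.1) z -> \forall y \near z, (g.2 \o k) y = id y.
  move=> gz; have : \forall y \near z, (g.2 @` g.1) y by exact: open_nbhs_nbhs.
  by apply: filterS => y [x gx <-] /=; rewrite kg.
(* By functoriality the lift of the inverse inverts the lift; only germs matter, so local identities
   suffice. *)
have kl y : g.1 (base y) -> lift k (lift g.2 y) = y.
  move=> gy; rewrite -lift_comp ?(lift_near (kgz _ gy)) ?lift_id//.
  - by move=> i; exact: ga.
  - by move=> i; apply: ka; exists (base y).
  - exact: gf.
  - by apply: kf; exists (base y).
have kD z : (g.2 @` g.1) z -> g.1 (k z) by move=> [x gx <-]; rewrite kg.
have lk y : (g.2 @` g.1) (base y) -> lift g.2 (lift k y) = y.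
  move=> gy; rewrite -lift_comp ?(lift_near (gkz _ gy)) ?lift_id//.
  - by move=> i; exact: ka.
  - by move=> i; apply/ga/kD.
  - exact: kf.
  - exact/gf/kD.
(* The lift is onto the whole preimage of the image, whose openness and position over [Om] are then
   inherited from [g]. *)
have im : lift g.2 @` (@base R 3 @^-1` g.1) = @base R 3 @^-1` (g.2 @` g.1).
  apply/seteqP; split=> [_ [y gy <-]|y gy]; first by exists (base y); rewrite ?base_lift.
  by exists (lift k y); [rewrite /= base_lift; exact: kD|exact: lk].
split.
- split; rewrite /lam/= ?im; [exact: open_base|exact: open_base|exact: analytic_lift_map|].
  by exists (lift k); [exact: analytic_lift_map|move=> y gy; exact: kl].
- by move=> y gy; exact: gO gy.
- by rewrite im => y gy; exact: g'O gy.
move=> y p P p' P' gy Ps P's pr.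
have sE i z : g.1 z -> lift_coef g.2 i z * pd ix (coordf g.2 ix) z = pd i (coordf g.2 iu) z.
  by move=> gz; have [_ _ _ x0] := gf z gz; rewrite /lift_coef mulfVK.
have cD i : analytic_on g.1 (lift_coef g.2 i) by exact: analytic_lift_coef.
have g'Om w : g.1 w -> Om (base (g.2 w)) by move=> gw; apply: g'O; exists w.
exact: (lift_equivalence A_an B_an C_an go gO ga g'Om gs (cD ix) (cD iu) (sE ix) (sE iu) gy
  (erefl _) Ps P's pr).
Unshelve. all: by end_near. Qed.

Lemma lam_germ q g1 g2 : germ_eq q (lam g1) (lam g2) <-> germ_eq (base q) g1 g2.
Proof.
split=> -[q1 q2 E]; split=> //.
  have [r r0 rE] := (nbhs_rowP _ _).1 E.
  apply/nbhs_rowP; exists r => // z zr; have := rE (row_ext z (q 0 (dep 3))).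
  rewrite /lam/= => /(_ _)/(congr1 (@base R 3)); rewrite !base_lift base_row_ext; apply.
  move=> k; have [[i ->]|->] := indP k; last by rewrite row_ext_dep subrr normr0.
  by have := zr i; rewrite row_ext_ind mxE.
(* The lift involves derivatives, so near [q] it is not enough that the maps agree at a point: they
   must agree around each nearby point. *)
have : \forall z \near base q, \forall y \near z, g1.2 y = g2.2 y by exact: nbhs_interior.
move=> /nbhs_rowP[r r0 rE]; apply/nbhs_rowP; exists r => // y yr.
apply: lift_near; apply: rE => i; rewrite !mxE; exact: yr.
Qed.

End PseudogroupLift.

(** * Every germ of a symmetry of the reduction equation is a lift *)

Section Surjectivity.
Context {R : realType}.
Variables (Om : set 'rV[R]_2) (A B C : 'rV[R]_2 -> R).
Hypotheses (A_an : analytic_on Om A) (B_an : analytic_on Om B) (C_an : analytic_on Om C).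
Hypothesis A_neq0 : forall z, Om z -> A z != 0.

Local Opaque pd ind dep.

Notation symL := (point_symmetries (@base R 2 @^-1` Om) (eqL A B C)).
Notation symDE := (point_symmetries ((@base R 2 \o @base R 3) @^-1` Om) (eqDE0 A B C)).

Section Slice.
Variables (h : lmap R 4) (J : 'I_4 -> set R) (e0 : R).
Hypothesis hDE : symDE h.
Hypotheses (Jo : forall i, open (J i)) (Ji : forall i, is_interval (J i)).
Hypotheses (Jh : box J `<=` h.1) (Je0 : J ie e0).

Let g z := base (h.2 (row_ext z e0)).

Let h_unit w : h.1 w -> jacobian h.2 w \in unitmx.
Proof.
have [hp _ _ _] := hDE; have [k [_ _ J']] := transformation_inverse hp.
by move=> hw; have [] := mulmx1_unit (J' w hw).
Qed.

Let h'O w : h.1 w -> Om (base (base (h.2 w))).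
Proof. by move=> hw; have [_ _ h'O _] := hDE; apply: h'O; exists w. Qed.

Let ho : open h.1. Proof. by have [[]] := hDE. Qed.
Let ha : analytic_map_on h.1 h.2. Proof. by have [[]] := hDE. Qed.
Let hO w : h.1 w -> Om (base (base w)). Proof. by have [_ hO _ _] := hDE => /hO. Qed.
Let hs w p P p' P' : h.1 w -> P^T = P -> P'^T = P' ->
  prolongs h.2 w p P p' P' -> (eqDE0 A B C w p P = 0 <-> eqDE0 A B C (h.2 w) p' P' = 0).
Proof. by have [_ _ _] := hDE; apply. Qed.

Let symDE_grp w (hw : h.1 w) := reduction_grp A_an A_neq0 ho ha hO h'O h_unit hs hw.

Lemma symDE_ie w : h.1 w -> pd ie (coordf h.2 ie) w != 0.
Proof.
move=> hw; have [_ _ [_ _ uu] [_ E] _] := symDE_grp hw.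
by apply: contraNneq uu => H0; rewrite -E H0 mul0r.
Qed.

Lemma symDE_dep w i : h.1 w -> pd (dep 3) (coordf h.2 (ind i)) w = 0.
Proof.
move=> hw; have [[_ _ te] [_ xe ue] _ _ _] := symDE_grp hw; have [[[e1 e2] e3] e4] := ind3.
rewrite e4; case: (I3P i) => ->; rewrite ?e1 ?e2 ?e3; [exact te|exact xe|exact ue].
Qed.

Let Je : J (dep 3) e0. Proof. by rewrite ind3. Qed.
Let haJ i : analytic_on (box J) (coordf h.2 i). Proof. by move=> w /Jh; exact: ha. Qed.
Let hJ0 i w : box J w -> pd (dep 3) (coordf h.2 (ind i)) w = 0.
Proof. by move=> /Jh; exact: symDE_dep. Qed.

Let gE i : coordf g i = fun z => coordf h.2 (ind i) (row_ext z e0).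
Proof. by apply/funext => z; rewrite /coordf /g mxE. Qed.

Lemma base_slice w : box J w -> base (h.2 w) = g (base w).
Proof.
move=> Jw; apply/rowP => i; rewrite !mxE.
exact: (slice_base Ji (haJ (ind i)) (hJ0 i) Je Jw).
Qed.

Lemma slice_analytic : analytic_map_on (box (fun i => J (ind i))) g.
Proof. by move=> i; rewrite gE; exact: (analytic_on_slice (haJ (ind i)) Je). Qed.

Lemma slice_pd w i k i' k' : box J w -> ind i = i' -> ind k = k' ->
  pd i' (coordf h.2 k') w = pd i (coordf g k) (base w).
Proof.
by move=> Jw <- <-; rewrite gE; exact: (pd_slice_base Jo Ji (haJ (ind k)) (hJ0 k) Je i Jw).
Qed.

Lemma slice_pd2 w i j k i' j' k' : box J w -> ind i = i' -> ind j = j' -> ind k = k' ->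
  pd j' (pd i' (coordf h.2 k')) w = pd j (pd i (coordf g k)) (base w).
Proof.
by move=> Jw <- <- <-; rewrite gE;
  exact: (pd2_slice_base Jo Ji (haJ (ind k)) (hJ0 k) Je i j Jw).
Qed.

(** At fixed [z] the quadratic of [reduction_poly] has coefficients depending only on the slice, and
    vanishes for all heights [e] in an open interval. *)
Lemma slice_struct : grp_struct A B C (box (fun i => J (ind i))) g.
Proof.
move=> z Nz; have [[[e1 e2] e3] e4] := ind3.
have Jw e : J ie e -> box J (row_ext z e).
  by move=> Je'; apply: box_row_ext => //; rewrite e4.
have bw e : base (row_ext z e) = z by exact: base_row_ext.
pose w := row_ext z e0; have hw : h.1 w by exact/Jh/Jw.
have d1 i k i' k' : ind i = i' -> ind k = k' ->
    forall e, J ie e -> pd i' (coordf h.2 k') (row_ext z e) = pd i (coordf g k) z.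
  by move=> E1 E2 e Je'; rewrite (slice_pd (Jw e Je') E1 E2) bw.
have d2 i j k i' j' k' : ind i = i' -> ind j = j' -> ind k = k' ->
    forall e, J ie e -> pd j' (pd i' (coordf h.2 k')) (row_ext z e) = pd j (pd i (coordf g k)) z.
  by move=> E1 E2 E3 e Je'; rewrite (slice_pd2 (Jw e Je') E1 E2 E3) bw.
have [[tx tu _] [xu _ _] [tt xx uu] _ E0] := symDE_grp hw.
have hbw e : J ie e -> base (h.2 (row_ext z e)) = g z by move=> Je'; rewrite base_slice ?bw//; exact: Jw.
rewrite (d1 _ _ _ _ e2 e1 _ Je0) in tx; rewrite (d1 _ _ _ _ e3 e1 _ Je0) in tu.
rewrite (d1 _ _ _ _ e3 e2 _ Je0) in xu; rewrite (d1 _ _ _ _ e1 e1 _ Je0) in tt.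
rewrite (d1 _ _ _ _ e2 e2 _ Je0) in xx; rewrite (d1 _ _ _ _ e3 e3 _ Je0) in uu.
rewrite (d1 _ _ _ _ e1 e1 _ Je0) (d1 _ _ _ _ e2 e2 _ Je0) (hbw _ Je0) (bw e0) in E0.
have zOm : Om (base z) by have := hO hw; rewrite bw.
have QZ e : J ie e -> grp_e2 A B C g z + e * grp_e1 A B g z
    + e ^+ 2 * - (A (base z) * pd ix (coordf g ix) z * pd iu (pd iu (coordf g iu)) z) = 0.
  move=> Je'; have := reduction_poly A_an A_neq0 ho ha hO h'O h_unit hs (Jh (Jw e Je')).
  rewrite /grp_e2 /grp_e1; cbv zeta; rewrite (hbw _ Je') (bw e).
  have -> : coordf h.2 iu (row_ext z e) = coordf g iu z.
    by rewrite /coordf -(hbw _ Je') mxE e3.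
  have -> : row_ext z e 0 iu = z 0 iu by rewrite -e3 row_ext_ind.
  have -> : row_ext z e 0 ie = e by rewrite -e4 row_ext_dep.
  rewrite (d1 _ _ _ _ e1 e1 _ Je') (d1 _ _ _ _ e1 e2 _ Je') (d1 _ _ _ _ e2 e2 _ Je').
  rewrite (d1 _ _ _ _ e1 e3 _ Je') (d1 _ _ _ _ e2 e3 _ Je') (d1 _ _ _ _ e3 e3 _ Je').
  rewrite (d2 _ _ _ _ _ _ e2 e2 e2 _ Je') (d2 _ _ _ _ _ _ e2 e2 e3 _ Je').
  rewrite (d2 _ _ _ _ _ _ e3 e2 e3 _ Je') (d2 _ _ _ _ _ _ e3 e3 e3 _ Je').
  by apply.
have Jne : J ie !=set0 by exists e0.
have [c0 c1 c2] := quadratic_zero (@Jo ie) Jne QZ.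
have uuu : pd iu (pd iu (coordf g iu)) z = 0.
  move/eqP: c2; rewrite oppr_eq0 mulf_eq0 (mulf_eq0 (A _)) (negbTE xx).
  by rewrite (negbTE (A_neq0 zOm)) => /eqP.
have e0z : grp_e0 A g z = 0.
  by rewrite /grp_e0 mulrC E0 mulrC subrr.
exact: And5 (conj tx tu) xu uuu (And3 tt xx uu) (And3 e0z c1 c0).
Qed.

Lemma slice_lift w : box J w -> lift g w = h.2 w.
Proof.
move=> Jw; have [[[e1 e2] e3] e4] := ind3.
rewrite -[RHS]row_ext_base /lift /lift_map base_slice//; congr row_ext.
have [_ _ [_ xx _] [hX _] _] := symDE_grp (Jh Jw).
rewrite (slice_pd Jw e2 e2) (slice_pd Jw e2 e3) (slice_pd Jw e3 e3) in hX.
rewrite (slice_pd Jw e2 e2) in xx.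
rewrite /afl /lift_coef e4 mulrA -mulrDl -hX mulfK//.
Qed.

End Slice.

Lemma analytic_near_image n m (f : 'rV[R]_n -> 'rV[R]_m) a (P : set 'rV[R]_m) :
  (forall k, analytic_at (coordf f k) a) -> nbhs (f a) P -> \forall w \near a, P (f w).
Proof.
move=> fa /nbhs_rowP[r r0 rP].
have : \forall w \near a, forall k, `|f w 0 k - f a 0 k| < r.
  apply: (@filter_forall _ _ (fun k w => `|f w 0 k - f a 0 k| < r) (nbhs a)) => k.
  have := differentiable_continuous (analytic_differentiable (fa k)).
  move=> /cvgrPdist_lt/(_ r r0); apply: filterS => w.
  by rewrite /coordf distrC.
by apply: filterS => w; exact: rP.
Qed.

Lemma ball_interval (a r : R) : is_interval (ball a r).
Proof.
move=> x y; rewrite /ball/= !ltr_norml => /andP[x1 x2] /andP[y1 y2] z /andP[xz zy].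
by rewrite ltr_norml; apply/andP; split; lra.
Qed.

Lemma box_ballP n (a : 'rV[R]_n) (r : R) w :
  box (fun i => ball (a 0 i) r) w <-> forall i, `|w 0 i - a 0 i| < r.
Proof. by split=> H i; have := H i; rewrite /ball/= distrC. Qed.

(* A symmetry [h] does not involve [eta] in its first three components, so that its
   slice through [q] is the sought map, on the base of a box [Q] around [q]. It is
   inverted by the slice of the inverse of [h] through [h q], on a box that
   contains [h Q]. *)
Lemma lam_surj h q : symDE h -> h.1 q -> exists2 g, symL g & germ_eq q (lam g) h.
Proof.
move=> hDE hq; have [hp hO h'O _] := hDE; have [ho h'o ha _] := hp.
have [k [ka kh J]] := transformation_inverse hp.
have Dk w : (h.2 @` h.1) w -> h.1 (k w) /\ h.2 (k w) = w.
  by move=> [y hy <-]; rewrite kh.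
have [r' r'0 rD'] : exists2 r' : R, 0 < r' &
    forall w : 'rV[R]_4, (forall i, `|w 0 i - h.2 q 0 i| < r') -> (h.2 @` h.1) w.
  by apply/nbhs_rowP/open_nbhs_nbhs; split=> //; exists q.
pose J' (i : 'I_4) : set R := ball (h.2 q 0 i) r'.
have J'o i : open (J' i) by exact: ball_open.
have J'i i : is_interval (J' i) by exact: ball_interval.
have J'D : box J' `<=` h.2 @` h.1 by move=> w /box_ballP; exact: rD'.
have J'q : box J' (h.2 q) by move=> i; exact: ballxx.
have [r r0 rQ] : exists2 r : R, 0 < r &
    forall w : 'rV[R]_4, (forall i, `|w 0 i - q 0 i| < r) -> h.1 w /\ box J' (h.2 w).
  apply/nbhs_rowP; apply: filterI; first exact: open_nbhs_nbhs.
  apply: analytic_near_image => [i|]; first exact: ha.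
  by apply: open_nbhs_nbhs; split=> //; exact: box_open.
pose Jq (i : 'I_4) : set R := ball (q 0 i) r.
have Jo i : open (Jq i) by exact: ball_open.
have Ji i : is_interval (Jq i) by exact: ball_interval.
have Jh : box Jq `<=` h.1 by move=> w /box_ballP/rQ[].
have JJ' w : box Jq w -> box J' (h.2 w) by move=> /box_ballP/rQ[].
have Jq0 : box Jq q by move=> i; exact: ballxx.
pose e0 := q 0 ie; have Je0 : Jq ie e0 by exact: ballxx.
pose g z := base (h.2 (row_ext z e0)); pose N := box (fun i : 'I_3 => Jq (ind i)).
have No : open N by exact: box_open.
have gs : grp_struct A B C N g by exact: (slice_struct hDE Jo Ji Jh Je0).
have ga : analytic_map_on N g by exact: (slice_analytic hDE Jh Je0).
have gb w : box Jq w -> base (h.2 w) = g (base w) by exact: (base_slice hDE Ji Jh Je0).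
have Jext z : N z -> box Jq (row_ext z e0).
  by move=> Nz; apply: box_row_ext => //; rewrite ind3.
(* In the [eta]-row of the Jacobian of [h] only [H_eta] is nonzero; multiplied by the inverse
   Jacobian, this row shows that the inverse is fibred as well. *)
have kdep w i : box J' w -> pd (dep 3) (coordf k (ind i)) w = 0.
  move=> /J'D[y hy <-]; have := J y hy => /matrixP/(_ (dep 3) (ind i)).
  rewrite mxE sum_ind_dep big1 => [|m _]; last by rewrite mxE (symDE_dep hDE m hy) mul0r.
  rewrite addr0 ![jacobian _ _ _ _]mxE ![(1%:M : 'M[R]_4) _ _]mxE eq_sym ind_neq_dep => /eqP.
  have H0 : pd (dep 3) (coordf h.2 (dep 3)) y != 0 by rewrite ind3; exact: symDE_ie hDE y hy.
  by rewrite mulf_eq0 (negbTE H0) => /eqP.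
pose e1 := h.2 q 0 (dep 3); have J'e1 : J' (dep 3) e1 by exact: ballxx.
pose kb z := base (k (row_ext z e1)).
have kbE i : coordf kb i = fun z => coordf k (ind i) (row_ext z e1).
  by apply/funext => z; rewrite /coordf /kb mxE.
have kaJ i : analytic_on (box J') (coordf k i) by move=> w /J'D; exact: ka.
have kbb w : box J' w -> base (k w) = kb (base w).
  move=> Jw; apply/rowP => i; rewrite !mxE.
  exact: (slice_base J'i (kaJ (ind i)) (fun y => @kdep y i) J'e1 Jw).
have kg z : N z -> kb (g z) = z.
  move=> Nz; have Jz := Jext z Nz.
  rewrite -(kbb _ (JJ' _ Jz)) -/(g z) kh ?base_row_ext//; exact: Jh.
have gN z : N z -> box (fun i : 'I_3 => J' (ind i)) (g z).
  by move=> /Jext/JJ'/box_base.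
(* A point near [g z] is given the height of [w], the image under [h] of the point of the slice over
   [z]; the inverse [k] sends it into the box, and its base is a preimage under [g]. *)
have gO : open (g @` N).
  rewrite openE => _ [z Nz <-]; have Jz := Jext z Nz; pose w := h.2 (row_ext z e0).
  have Jw : box J' w by exact: JJ'.
  have nk : \forall y \near w, box Jq (k y) /\ box J' y.
    apply: filterI; last by apply: open_nbhs_nbhs; split=> //; exact: box_open.
    apply: analytic_near_image => [i|]; first exact/ka/J'D.
    apply: open_nbhs_nbhs; split; first exact: box_open.
    by rewrite /w kh//; exact: Jh.
  have [d d0 dk] := (nbhs_rowP _ _).1 nk.
  apply/nbhs_rowP; exists d => // z' z'd.
  have [] := dk (row_ext z' (w 0 (dep 3))).
    move=> i; have [[m ->]|->] := indP i; last by rewrite row_ext_dep subrr normr0.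
    by have := z'd m; rewrite row_ext_ind /g mxE.
  set w' := row_ext z' _ => Jk Jw'; exists (base (k w')); first exact: box_base.
  by rewrite -gb// (Dk _ (J'D _ Jw')).2 base_row_ext.
exists (N, g); last first.
  split=> //; first exact: box_base.
  apply/nbhs_rowP; exists r => // w /box_ballP Jw.
  exact: (slice_lift hDE Jo Ji Jh Je0 Jw).
split=> /=.
- split=> //=; exists kb => //.
  move=> i; rewrite kbE => _ [z /gN Nz <-].
  exact: (analytic_on_slice (kaJ (ind i)) J'e1 Nz).
- by move=> z /Jext/Jh/hO /=; rewrite base_row_ext.
- by move=> _ [z /Jext/Jh hz <-]; apply: h'O; exists (row_ext z e0).
- exact: (grp_struct_symmetry No ga gs).
Qed.

End Surjectivity.

Theorem corollary12 (R : realType) (Om : set 'rV[R]_2) (A B C : 'rV[R]_2 -> R)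
  (Om_open : open Om)
  (A_an : analytic_on Om A) (B_an : analytic_on Om B) (C_an : analytic_on Om C)
  (A_neq0 : forall z, Om z -> A z != 0) :
  (exists Lam : lmap R 3 -> lmap R 4,
     pseudogroup_isomorphism (@base R 3)
       (point_symmetries (@base R 2 @^-1` Om) (eqL A B C))
       (point_symmetries ((@base R 2 \o @base R 3) @^-1` Om) (eqDE0 A B C)) Lam)
  /\
  (forall J : 'I_4 -> set R,
     (forall i, [/\ open (J i), is_interval (J i) & J i !=set0]) ->
     let D4 := box J in
     let D3 := box (fun i : 'I_3 => J (ind i)) in
     D4 `<=` (@base R 2 \o @base R 3) @^-1` Om ->
     exists Lam : vfield R 3 -> vfield R 4,
       [/\ lie_isomorphism D3 (lie_algebra (eqL A B C) D3)
                           D4 (lie_algebra (eqDE0 A B C) D4) Lam,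
           forall Q, lie_algebra (eqL A B C) D3 Q ->
             exists (tau : R -> R) (xi zeta1 zeta0 : 'rV[R]_2 -> R),
               {in D3, Q =1 opQ tau xi zeta1 zeta0}
         & forall Q (tau : R -> R) (xi zeta1 zeta0 : 'rV[R]_2 -> R),
             lie_algebra (eqL A B C) D3 Q ->
             {in D3, Q =1 opQ tau xi zeta1 zeta0} ->
             {in D4, Lam Q =1 opQ0 tau xi zeta1 zeta0}]).
Proof.
split; last by move=> J J_itv D4 D3 D4_Om; exact (lie_part A_an B_an C_an A_neq0 J_itv D4_Om).
exists lam; split.
- by move=> g; exact: lam_mem.
- by [].
- by move=> g q _ _; exact: base_lift.
- move=> g1 g2 L1 L2; have [[_ _ a1 _] _ _ _] := L1; have [[_ _ a2 _] _ _ _] := L2.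
  split=> [|y]; first by apply/seteqP; split=> y; rewrite /= base_lift.
  rewrite inE => -[/= y1 y2]; apply: lift_comp.
  - by move=> k; exact: a1.
  - by move=> k; exact: a2.
  - exact: struct_fibered (symL_struct A_neq0 L1) y1.
  - exact: struct_fibered (symL_struct A_neq0 L2) y2.
- by move=> g1 g2 q _ _; exact: lam_germ.
- by move=> h q; exact: lam_surj.
Qed.
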